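(* Let $V$ be the $2|1$-dimensional complex $\mathbb{Z}_2$-graded vector space with basis $v_1,v_2$ (even) and $v_3$ (odd). Let $d_{15}(p:q)=p\,\psi^{23}_1+q\,\psi^{32}_1$, a family parameterized projectively by $(p:q)$, and let $$\begin{aligned} d_1&=\psi^{23}_2-\psi^{32}_2+\psi^{22}_3-\psi^{33}_3,& d_4&=\psi^{33}_3+\psi^{31}_1-\psi^{23}_2,\\ d_5&=\psi^{33}_3-\psi^{13}_1+\psi^{32}_2-\psi^{23}_2,& d_6&=\psi^{33}_3+\psi^{31}_1+\psi^{32}_2-\psi^{23}_2,\\ d_7&=\psi^{33}_3+\psi^{32}_2,& d_8&=\psi^{33}_3-\psi^{23}_2,\\ d_{11}&=\psi^{33}_3+\psi^{32}_2-\psi^{23}_2,& d_{12}&=\psi^{22}_3+\psi^{23}_1-\psi^{32}_1. \end{aligned}$$ (a) Generic case ($(p:q)$ not one of $(0:1),(1:0),(1:1),(1:-1),(0:0)$). A miniversal deformation of $d_{15}(p:q)$ is $$\begin{aligned}d^\infty=\;&p\,\psi^{23}_1+(q+t_2)\psi^{32}_1+t_1\psi^{31}_1+t_1\psi^{33}_3+\tfrac{t_1(p-q-t_2)}{2(q+t_2)}\psi^{13}_1-\tfrac{t_1(p+q+t_2)}{2(q+t_2)}\psi^{23}_2\\&-\tfrac{t_1^2(p+q+t_2)(p-q-t_2)}{4p(q+t_2)^2}\psi^{13}_2-\tfrac{t_1^2(p+q+t_2)(p-q-t_2)}{4(q+t_2)p^2}\psi^{31}_2,\end{aligned}$$ with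 one relation on the base, $t_1^2(p+q+t_2)(p-q-t_2)/p^2=0$. Its only solution is $t_1=0$, which gives $d^\infty=d_{15}(p:q+t_2)$; so the deformations are only along the family. (b) $(p:q)=(0:1)$. A miniversal deformation of $d_{15}(0:1)$ is $$d^\infty=\psi^{32}_1+t_1\psi^{31}_1+t_1\psi^{33}_3+t_2\psi^{23}_1+t_3\psi^{23}_2+(t_3+t_1t_2)\psi^{13}_1,$$ with two nontrivial relations on the base, $t_3(t_1+t_3)=0$ and $t_2(t_1+2t_3+t_1t_2)=0$. Their solutions are $t_1=t_3=0$; $t_2=t_3=0$; $t_2=0,\ t_3=-t_1$; and the two solutions $t_3=0,\ t_2=-1$ and $t_3=-t_1,\ t_2=1$, which are not local (do not pass through the origin) and so are irrelevant to the deformations. Thus the base consists of three lines through the origin. The first line is $d_{15}(t_2:1)$, a deformation along the family; the second is a jump deformation to $d_7$; the third is a jump deformation to $d_5$. (c) $(p:q)=(1:0)$. This algebra is the opposite of $d_{15}(0:1)$, so a miniversal deformation is given by the opposite of the one in (b), with a similar description of the solutions: there are deformations along the family, and jump deformations to $d_8$ and $d_6$ (the opposites of $d_7$ and $d_5$). (d) $(p:q)=(1:1)$. A miniversal deformation of $d_{15}(1:1)$ is $$d^\infty=d_{15}(1:1)+t_1\psi^{31}_1+t_1\psi^{33}_3+t_2\psi^{32}_1-\tfrac{t_1(t_2+2)}{2(t_2+1)}\psi^{23}_2-\tfrac{t_1t_2}{2(t_2+1)}\psi^{13}_1+\tfrac{t_1^2t_2(t_2+1)}{4(t_2+1)^2}\psi^{13}_2,$$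 with one nontrivial relation on the base, $t_1^2t_2(t_2+2)/(1+t_2)=0$, which has two local solutions, $t_1=0$ or $t_2=0$. Thus the base is given by two lines through the origin. The first line gives $d^\infty=d_{15}(1:1+t_2)$, a deformation along the family; the second is a jump deformation to $d_4$. (e) $(p:q)=(1:-1)$. A miniversal deformation of $d_{15}(1:-1)$ has parameters $t_1,t_2,t_3$, and the relations on its base have two local solutions, $t_2=0$ or $t_1=t_3=0$, so the base is given by a plane and a line intersecting transversally at the origin. The first solution gives $$d^\infty=d_{15}(1:-1)-t_1\psi^{13}_1+t_1\psi^{31}_1+t_1\psi^{33}_3+t_3\psi^{22}_3+t_1^2t_3\psi^{11}_3-t_1t_3\psi^{12}_3-t_1t_3\psi^{21}_3,$$ which is equivalent to $d_1$ when neither $t_1$ nor $t_3$ vanishes, while on the line $t_3=0$ it jumps to $d_{11}$, and on the line $t_1=0$ it jumps to $d_{12}$. The second solution gives $d^\infty=d_{15}(1:-1+t_2)$, a deformation along the family. (f) $d_{15}(0:0)$ is the zero codifferential, which has jump deformations to every codifferential in the moduli space (of degree-2 codifferentials on $V$ up to equivalence).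
   Context: Notation: $\psi^{ij}_k:V\otimes V\to V$ is the linear map with $\psi^{ij}_k(v_a\otimes v_b)=v_k$ if $(a,b)=(i,j)$ and $0$ otherwise. A codifferential of degree 2 on $V$ is an odd (parity-reversing) linear map $d:V\otimes V\to V$ such that for all homogeneous $a,b,c$, $d(d(a,b),c)+(-1)^{|a|}d(a,d(b,c))=0$; it represents an associative algebra structure on the parity reversion of $V$. The codifferential of the opposite algebra is $d^{op}(a,b)=(-1)^{|a||b|+1}d(b,a)$. Two codifferentials $d,d'$ are equivalent if $d'=g^{-1}\circ d\circ(g\otimes g)$ for some even linear automorphism $g$ of $V$. A jump deformation from $d$ to $d'$ is a one-parameter family of deformations $d_t$ of $d$ (with $d_0=d$) such that $d_t$ is equivalent to $d'$ for every small $t\neq0$. Deformations: a formal base is a (purely even) commutative unital $\mathbb{C}$-algebra $A$ with an augmentation $A\to\mathbb{C}$ whose kernel $\mathfrak m$ is the unique maximal ideal of $A$ (so $A=\mathbb{C}\oplus\mathfrak m$), and which is complete, $A=\varprojlim_k A/\mathfrak m^k$; it is infinitesimal if $\mathfrak m^2=0$. A deformation of $d$ with base $A$ is $d_A=d+\varphi$ with $\varphi:V\otimes V\to V\otimes\mathfrak m$ odd and $d_A$ (extended $A$-linearly) satisfying the codifferential identity. Deformations $d_A,d_A'$ are equivalent ($d_A\sim d'_A$) if $d_A'=g^{-1}\circ d_A\circ(g\otimes g)$ for some $A$-linear automorphism $g=I+\lambda$ with $\lambda:V\to V\otimes\mathfrak m$ even. A morphism $f:A\to B$ of augmented algebras pushes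 $d_A$ forward to $f_*(d_A)=(1\otimes f)d_A$. A deformation $d_A$ with formal base is versal if for every deformation $d_B$ with formal base $B$ there is a morphism $f:A\to B$ with $f_*(d_A)\sim d_B$; it is miniversal if moreover $f$ is unique whenever $B$ is infinitesimal. When a deformation is given with relations, its base is the quotient of the ring of formal power series in the parameters $t_i$ by those relations, rational expressions being expanded as power series. *)

(* Defs.v *)
From HB Require Import structures.
From mathcomp Require Import all_boot all_order all_algebra ring_quotient.
From mathcomp Require Import boolp mpoly.

Set Implicit Arguments.
Unset Strict Implicit.
Unset Printing Implicit Defensive.

Import Order.TTheory GRing.Theory Num.Theory.
Local Open Scope ring_scope.

(** Vectors of V (or of V (x) A for a purely even commutative algebra A) are row
    vectors of length 3 in the basis v_1, v_2 (even), v_3 (odd).  A map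
    V (x) V -> V (x) A is given by its values on the pairs (v_a, v_b). *)

Section Cochains.
Variable A : comNzRingType.

Definition cochain := {ffun 'I_3 * 'I_3 -> 'rV[A]_3}.

Definition parity (i : 'I_3) : bool := i == ord_max.

Definition has_parity (s : bool) (x : 'rV[A]_3) : Prop :=
  forall i, parity i != s -> x 0 i = 0.

(* The A-bilinear extension of a cochain to V (x) A. *)
Definition app (d : cochain) (x y : 'rV[A]_3) : 'rV[A]_3 :=
  \sum_a \sum_b (x 0 a * y 0 b) *: d (a, b).

(* The basis is numbered from 1 here, as in the notation psi^{ij}_k. *)
Definition psi (i j k : nat) : cochain :=
  [ffun ab : 'I_3 * 'I_3 =>
    \row_(c < 3) [&& (ab.1 : nat).+1 == i, (ab.2 : nat).+1 == j & c.+1 == k]%:R].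

Definition odd_cochain (d : cochain) : Prop :=
  forall (s t : bool) x y, has_parity s x -> has_parity t y ->
    has_parity (~~ (s (+) t)) (app d x y).

Definition codifferential (d : cochain) : Prop :=
  odd_cochain d /\
  forall (s t u : bool) x y z, has_parity s x -> has_parity t y -> has_parity u z ->
    app d (app d x y) z + (-1) ^+ s *: app d x (app d y z) = 0.

(* d^op(a, b) = (-1)^(|a||b| + 1) d(b, a). *)
Definition opposite (d : cochain) : cochain :=
  [ffun ab => (-1) ^+ (parity ab.1 && parity ab.2).+1 *: d (ab.2, ab.1)].

(* A linear map is a matrix acting on row vectors on the right. *)
Definition even_mx (g : 'M[A]_3) : Prop :=
  forall s x, has_parity s x -> has_parity s (x *m g).

Definition even_automorphism (g h : 'M[A]_3) : Prop :=
  [/\ even_mx g, g *m h = 1%:M & h *m g = 1%:M].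

(* g^-1 o d o (g (x) g), where h = g^-1. *)
Definition transport (g h : 'M[A]_3) (d : cochain) : cochain :=
  [ffun ab => app d (row ab.1 g) (row ab.2 g) *m h].

Definition equivalent (d d' : cochain) : Prop :=
  exists g h, even_automorphism g h /\ d' = transport g h d.

End Cochains.

Arguments psi {A} i j k.

Section Ideals.
Variable A : comNzRingType.

Definition is_ideal (I : A -> Prop) : Prop :=
  [/\ I 0, forall x y, I x -> I y -> I (x + y) & forall a x, I x -> I (a * x)].

Definition maximal_ideal (I : A -> Prop) : Prop :=
  [/\ is_ideal I, ~ I 1 &
      forall J, is_ideal J -> (forall x, I x -> J x) ->
        (forall x, J x -> I x) \/ J 1].

Definition unique_maximal_ideal (I : A -> Prop) : Prop :=
  maximal_ideal I /\ forall J, maximal_ideal J -> forall x, J x <-> I x.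

Definition ideal_mul (I J : A -> Prop) (x : A) : Prop :=
  exists s : seq (A * A),
    (forall y, y \in s -> I y.1 /\ J y.2) /\ x = \sum_(y <- s) y.1 * y.2.

Fixpoint ideal_pow (I : A -> Prop) (k : nat) : A -> Prop :=
  if k is k'.+1 then ideal_mul I (ideal_pow I k') else fun=> True.

(* Injectivity and surjectivity of the canonical map A -> lim_k A / I^k; an
   element of the limit is given by representatives u k of its components. *)
Definition adic_complete (I : A -> Prop) : Prop :=
  (forall x, (forall k, ideal_pow I k x) -> x = 0) /\
  (forall u : nat -> A, (forall k, ideal_pow I k (u k.+1 - u k)) ->
     exists x, forall k, ideal_pow I k (x - u k)).

End Ideals.

Record augAlg (K : fieldType) := AugAlg {
  aug_alg :> comAlgType K;
  aug : {lrmorphism aug_alg -> K^o}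
}.

Section Deformations.
Variable K : fieldType.

Definition aug_ideal (A : augAlg K) (x : A) : Prop := aug A x = 0.

Definition formal_base (A : augAlg K) : Prop :=
  unique_maximal_ideal (@aug_ideal A) /\ adic_complete (@aug_ideal A).

Definition infinitesimal (A : augAlg K) : Prop :=
  forall x : A, ideal_pow (@aug_ideal A) 2 x -> x = 0.

Definition map_cochain (A B : comNzRingType) (f : A -> B) (d : cochain A) :
  cochain B := [ffun ab => map_mx f (d ab)].

Definition extend (A : augAlg K) (d : cochain K) : cochain A :=
  map_cochain (in_alg A) d.

Definition deformation (d : cochain K) (A : augAlg K) (dA : cochain A) : Prop :=
  codifferential dA /\
  exists phi : cochain A,
    [/\ odd_cochain phi, forall ab k, aug_ideal (phi ab 0 k)
      & dA = extend A d + phi].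

Definition deformation_equivalent (A : augAlg K) (dA dA' : cochain A) : Prop :=
  exists g h : 'M[A]_3,
    [/\ even_automorphism g h, forall i j, aug_ideal ((g - 1%:M) i j)
      & dA' = transport g h dA].

Definition aug_morphism (A B : augAlg K) (f : {lrmorphism A -> B}) : Prop :=
  forall x, aug B (f x) = aug A x.

Definition versal (d : cochain K) (A : augAlg K) (dA : cochain A) : Prop :=
  [/\ formal_base A, deformation d dA &
      forall (B : augAlg K) (dB : cochain B), formal_base B ->
        deformation d dB ->
        exists f : {lrmorphism A -> B},
          aug_morphism f /\ deformation_equivalent (map_cochain f dA) dB].

Definition miniversal (d : cochain K) (A : augAlg K) (dA : cochain A) : Prop :=
  versal d dA /\
  forall (B : augAlg K) (dB : cochain B), formal_base B -> infinitesimal B ->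
    deformation d dB ->
    forall f f' : {lrmorphism A -> B}, aug_morphism f -> aug_morphism f' ->
      deformation_equivalent (map_cochain f dA) dB ->
      deformation_equivalent (map_cochain f' dA) dB -> f =1 f'.

End Deformations.

(* Formal power series in n commuting parameters, given by their coefficients. *)
Record mseries (n : nat) (K : fieldType) := MSeries {
  mscoef : 'X_{1..n} -> K
}.

HB.instance Definition _ n K := gen_eqMixin (mseries n K).
HB.instance Definition _ n K := gen_choiceMixin (mseries n K).

Section Series.
Variables (n : nat) (K : fieldType).
Local Notation S := (mseries n K).
Implicit Types (f g h : S) (m : 'X_{1..n}).

Lemma mseriesP f g : (forall m, mscoef f m = mscoef g m) -> f = g.
Proof. by case: f g => [f] [g] /= /funext ->. Qed.

Definition ms_zero : S := MSeries (fun=> 0).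
Definition ms_opp f : S := MSeries (fun m => - mscoef f m).
Definition ms_add f g : S := MSeries (fun m => mscoef f m + mscoef g m).
Definition ms_scale (c : K) f : S := MSeries (fun m => c * mscoef f m).
Definition ms_poly (p : {mpoly K[n]}) : S := MSeries (fun m => p@_m).
Definition ms_mul f g : S := MSeries (fun m =>
  \sum_(k : 'X_{1..n < (mdeg m).+1, (mdeg m).+1} | m == (k.1 + k.2)%MM)
     mscoef f k.1 * mscoef g k.2).

Fact ms_addA : associative ms_add.
Proof. by move=> f g h; apply: mseriesP => m /=; rewrite addrA. Qed.
Fact ms_addC : commutative ms_add.
Proof. by move=> f g; apply: mseriesP => m /=; rewrite addrC. Qed.
Fact ms_add0 : left_id ms_zero ms_add.
Proof. by move=> f; apply: mseriesP => m /=; rewrite add0r. Qed.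
Fact ms_addN : left_inverse ms_zero ms_opp ms_add.
Proof. by move=> f; apply: mseriesP => m /=; rewrite addNr. Qed.

HB.instance Definition _ := GRing.isZmodule.Build S
  ms_addA ms_addC ms_add0 ms_addN.

Definition ms_trunc (N : nat) f : {mpoly K[n]} :=
  \sum_(m : 'X_{1..n < N}) mscoef f m *: 'X_[m].

Lemma ms_truncE N f m : (mdeg m < N)%N -> (ms_trunc N f)@_m = mscoef f m.
Proof. by move=> lt_mN; rewrite /ms_trunc (mcoeff_mpoly _ lt_mN). Qed.

Lemma ms_mulE f g (p q : {mpoly K[n]}) m :
  (forall k, (mdeg k <= mdeg m)%N -> mscoef f k = p@_k) ->
  (forall k, (mdeg k <= mdeg m)%N -> mscoef g k = q@_k) ->
  mscoef (ms_mul f g) m = (p * q)@_m.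
Proof.
move=> fp gq; rewrite mcoeffM /=; apply: eq_bigr => k _.
by rewrite fp ?gq // -ltnS bmdeg.
Qed.

Lemma ms_mul_trunc N f g m : (mdeg m < N)%N ->
  mscoef (ms_mul f g) m = (ms_trunc N f * ms_trunc N g)@_m.
Proof.
by move=> lt_mN; apply: ms_mulE => k le_km;
  rewrite ms_truncE // (leq_ltn_trans le_km).
Qed.

Fact ms_mulA : associative ms_mul.
Proof.
move=> f g h; apply: mseriesP => m; pose N := (mdeg m).+1.
have tr u k : (mdeg k <= mdeg m)%N -> mscoef u k = (ms_trunc N u)@_k.
  by move=> le_km; rewrite ms_truncE.
have trM u v k : (mdeg k <= mdeg m)%N ->
    mscoef (ms_mul u v) k = (ms_trunc N u * ms_trunc N v)@_k.
  by move=> le_km; rewrite (@ms_mul_trunc N).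
rewrite (ms_mulE (tr f) (trM g h)) (ms_mulE (trM f g) (tr h)).
by rewrite mulrA.
Qed.

Fact ms_mulC : commutative ms_mul.
Proof.
by move=> f g; apply: mseriesP => m; rewrite !(@ms_mul_trunc (mdeg m).+1) // mulrC.
Qed.

Fact ms_mul1 : left_id (ms_poly 1) ms_mul.
Proof.
move=> f; apply: mseriesP => m.
rewrite (@ms_mulE _ _ 1 (ms_trunc (mdeg m).+1 f)) ?mul1r ?ms_truncE //.
by move=> k le_km; rewrite ms_truncE.
Qed.

Fact ms_mulDl : left_distributive ms_mul ms_add.
Proof.
move=> f g h; apply: mseriesP => m /=; rewrite -big_split /=.
by apply: eq_bigr => k _; rewrite mulrDl.
Qed.

Fact ms_1neq0 : ms_poly 1 != 0.
Proof.
apply/eqP => /(congr1 (fun f => mscoef f 0%MM)) /=.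
by rewrite mcoeff1 eqxx => /eqP; rewrite oner_eq0.
Qed.

HB.instance Definition _ := GRing.Zmodule_isComNzRing.Build S
  ms_mulA ms_mulC ms_mul1 ms_mulDl ms_1neq0.

Fact ms_scaleA a b f : ms_scale a (ms_scale b f) = ms_scale (a * b) f.
Proof. by apply: mseriesP => m /=; rewrite mulrA. Qed.
Fact ms_scale1 : left_id 1 ms_scale.
Proof. by move=> f; apply: mseriesP => m /=; rewrite mul1r. Qed.
Fact ms_scaleDr : right_distributive ms_scale +%R.
Proof. by move=> a f g; apply: mseriesP => m /=; rewrite mulrDr. Qed.
Fact ms_scaleDl f : {morph ms_scale^~ f : a b / a + b}.
Proof. by move=> a b; apply: mseriesP => m /=; rewrite mulrDl. Qed.

HB.instance Definition _ := GRing.Zmodule_isLmodule.Build K S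
  ms_scaleA ms_scale1 ms_scaleDr ms_scaleDl.

Fact ms_scaleAl (a : K) (f g : S) : a *: (f * g) = a *: f * g.
Proof.
apply: mseriesP => m /=; rewrite mulr_sumr.
by apply: eq_bigr => k _; rewrite mulrA.
Qed.

HB.instance Definition _ := GRing.Lmodule_isLalgebra.Build K S ms_scaleAl.
HB.instance Definition _ := GRing.Lalgebra_isComAlgebra.Build K S.

(* The inverse is total: f itself when f is not invertible. *)
Definition ms_unit : pred S := fun f => `[< exists g, g * f = 1 >].
Definition ms_inv f : S :=
  if pselect (exists g, g * f = 1) is left ex then projT1 (cid ex) else f.

Fact ms_mulVr : {in ms_unit, left_inverse 1 ms_inv *%R}.
Proof.
move=> f /asboolP ex; rewrite /ms_inv; case: pselect => // ex'.
by case: (cid ex').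
Qed.
Fact ms_unitP f g : g * f = 1 -> ms_unit f.
Proof. by move=> gf; apply/asboolP; exists g. Qed.
Fact ms_inv_out : {in [predC ms_unit], ms_inv =1 id}.
Proof.
move=> f /asboolPn nex; rewrite /ms_inv.
by case: pselect => // ex; case: nex.
Qed.

HB.instance Definition _ := GRing.ComNzRing_hasMulInverse.Build S
  ms_mulVr ms_unitP ms_inv_out.

Definition ms_const f : K^o := mscoef f 0%MM.

Fact ms_const_is_semilinear : semilinear_for *:%R ms_const.
Proof. by split=> [a f|f g]. Qed.
Fact ms_const_is_monoid_morphism : monoid_morphism ms_const.
Proof.
split=> [|f g]; rewrite /ms_const; first by rewrite /= mcoeff1 eqxx.
rewrite (@ms_mul_trunc 1) ?mdeg0 // rmorphM /= !ms_truncE ?mdeg0 //.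
Qed.

End Series.

HB.instance Definition _ n (K : fieldType) := GRing.isSemilinear.Build K (mseries n K) K^o _
  (@ms_const n K) (@ms_const_is_semilinear n K).
HB.instance Definition _ n (K : fieldType) := GRing.isMonoidMorphism.Build (mseries n K) K^o
  (@ms_const n K) (@ms_const_is_monoid_morphism n K).

Section SeriesBase.
Variables (n : nat) (K : fieldType).
Implicit Types rels : seq (mseries n K).

(* The ideal generated by rels.  The first condition is redundant when the
   relations vanish at the origin, the only case in which this ideal is used; it
   makes the quotient nonzero without any hypothesis on rels. *)
Definition rel_ideal rels : pred (mseries n K) := fun f =>
  `[< ms_const f = 0 /\
      exists c : nat -> mseries n K, f = \sum_(i < size rels) c i * rels`_i >].

Fact rel_ideal_closed rels : idealr_closed (rel_ideal rels).
Proof.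
split=> [||a f g /asboolP[f0 [c fE]] /asboolP[g0 [e gE]]].
- apply/asboolP; split; first exact: rmorph0.
  by exists (fun=> 0); rewrite big1 // => i _; rewrite mul0r.
- apply/negP => /asboolP[/eqP]; rewrite rmorph1 => /eqP/eqP.
  by rewrite oner_eq0.
apply/asboolP; split; first by rewrite rmorphD rmorphM /= f0 g0 mulr0 addr0.
exists (fun i => a * c i + e i); rewrite fE gE mulr_sumr -big_split /=.
by apply: eq_bigr => i _; rewrite mulrDl mulrA.
Qed.

HB.instance Definition _ rels := isIdealr.Build (mseries n K) (rel_ideal rels)
  (rel_ideal_closed rels).

Definition rel_idealr rels : idealr (mseries n K) := rel_ideal rels.

Definition series_quot rels := {ideal_quot (rel_idealr rels)}.

HB.instance Definition _ rels := GRing.ComNzRing.on (series_quot rels).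
HB.instance Definition _ rels := EqQuotient.on (series_quot rels).
HB.instance Definition _ rels := NzRingQuotient.on (series_quot rels).

Definition sq_pi rels (f : mseries n K) : series_quot rels :=
  (\pi_(series_quot rels) f)%qT.

Fact sq_pi_is_zmod_morphism rels : zmod_morphism (sq_pi rels).
Proof. by move=> f g; rewrite /sq_pi raddfB. Qed.
Fact sq_pi_is_monoid_morphism rels : monoid_morphism (sq_pi rels).
Proof. by split=> [|f g]; rewrite /sq_pi ?rmorph1 ?rmorphM. Qed.

HB.instance Definition _ rels := GRing.isZmodMorphism.Build
  (mseries n K) (series_quot rels) (sq_pi rels) (sq_pi_is_zmod_morphism rels).
HB.instance Definition _ rels := GRing.isMonoidMorphism.Build
  (mseries n K) (series_quot rels) (sq_pi rels) (sq_pi_is_monoid_morphism rels).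

Lemma sq_pi_surj rels (x : series_quot rels) : exists f, x = sq_pi rels f.
Proof. by exists (repr x); rewrite /sq_pi reprK. Qed.

Lemma sq_piP rels f g : sq_pi rels f = sq_pi rels g <-> f - g \in rel_ideal rels.
Proof. by rewrite Quotient.idealrBE; split=> /eqP. Qed.

Definition sq_scale rels (c : K) (x : series_quot rels) : series_quot rels :=
  sq_pi rels c%:A * x.

Fact sq_scaleA rels a b (x : series_quot rels) :
  sq_scale a (sq_scale b x) = sq_scale (a * b) x.
Proof. by rewrite /sq_scale mulrA -rmorphM -scalerAl mul1r scalerA. Qed.
Fact sq_scale1 rels : left_id 1 (@sq_scale rels).
Proof. by move=> x; rewrite /sq_scale scale1r rmorph1 mul1r. Qed.
Fact sq_scaleDr rels : right_distributive (@sq_scale rels) +%R.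
Proof. by move=> a x y; rewrite /sq_scale mulrDr. Qed.
Fact sq_scaleDl rels (x : series_quot rels) :
  {morph (@sq_scale rels)^~ x : a b / a + b}.
Proof. by move=> a b; rewrite /sq_scale scalerDl rmorphD mulrDl. Qed.

HB.instance Definition _ rels := GRing.Zmodule_isLmodule.Build K
  (series_quot rels) (@sq_scaleA rels) (@sq_scale1 rels) (@sq_scaleDr rels)
  (@sq_scaleDl rels).

Fact sq_scaleAl rels (a : K) (x y : series_quot rels) :
  a *: (x * y) = a *: x * y.
Proof. exact: mulrA. Qed.

HB.instance Definition _ rels := GRing.Lmodule_isLalgebra.Build K
  (series_quot rels) (@sq_scaleAl rels).
HB.instance Definition _ rels := GRing.Lalgebra_isComAlgebra.Build K
  (series_quot rels).

Definition sq_aug rels (x : series_quot rels) : K^o := ms_const (repr x).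

Lemma sq_aug_pi rels f : sq_aug (sq_pi rels f) = ms_const f.
Proof.
apply/eqP; rewrite -subr_eq0 -rmorphB; apply/eqP.
suff /asboolP[] : repr (sq_pi rels f) - f \in rel_ideal rels by [].
by apply/sq_piP; rewrite /sq_pi reprK.
Qed.

Fact sq_aug_is_semilinear rels : semilinear_for *:%R (@sq_aug rels).
Proof.
split=> [a x|x y].
  have [f ->] := sq_pi_surj x; have -> : a *: sq_pi rels f = sq_pi rels (a *: f).
    rewrite -[a *: sq_pi rels f]/(sq_pi rels a%:A * sq_pi rels f) -rmorphM.
    by rewrite -scalerAl mul1r.
  by rewrite !sq_aug_pi linearZ.
have [f ->] := sq_pi_surj x; have [g ->] := sq_pi_surj y.
by rewrite -rmorphD !sq_aug_pi rmorphD.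
Qed.
Fact sq_aug_is_monoid_morphism rels : monoid_morphism (@sq_aug rels).
Proof.
split=> [|x y]; first by rewrite -(rmorph1 (sq_pi rels)) sq_aug_pi rmorph1.
have [f ->] := sq_pi_surj x; have [g ->] := sq_pi_surj y.
by rewrite -rmorphM !sq_aug_pi rmorphM.
Qed.

HB.instance Definition _ rels := GRing.isSemilinear.Build K (series_quot rels)
  K^o _ (@sq_aug rels) (@sq_aug_is_semilinear rels).
HB.instance Definition _ rels := GRing.isMonoidMorphism.Build (series_quot rels)
  K^o (@sq_aug rels) (@sq_aug_is_monoid_morphism rels).

Definition series_base rels : augAlg K := AugAlg (@sq_aug rels).

End SeriesBase.

(** A rational expression is a ring term in which the variable 'X_i stands for the
    parameter t_(i+1).  It can be evaluated at a point, or expanded as a formal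
    power series. *)

Section Families.
Variable K : fieldType.

(* No denominator vanishes at the origin (parameters missing from the
   environment are evaluated at 0). *)
Fixpoint regular (t : GRing.term K) : bool :=
  match t with
  | GRing.Add t1 t2 | GRing.Mul t1 t2 => regular t1 && regular t2
  | GRing.Opp t1 | GRing.NatMul t1 _ | GRing.Exp t1 _ => regular t1
  | GRing.Inv t1 => regular t1 && (GRing.eval [::] t1 != 0)
  | _ => true
  end.

Fixpoint map_term (A : Type) (f : K -> A) (t : GRing.term K) : GRing.term A :=
  match t with
  | GRing.Var i => GRing.Var A i
  | GRing.Const c => GRing.Const (f c)
  | GRing.NatConst k => GRing.NatConst A k
  | GRing.Add t1 t2 => GRing.Add (map_term f t1) (map_term f t2)
  | GRing.Opp t1 => GRing.Opp (map_term f t1)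
  | GRing.NatMul t1 k => GRing.NatMul (map_term f t1) k
  | GRing.Mul t1 t2 => GRing.Mul (map_term f t1) (map_term f t2)
  | GRing.Inv t1 => GRing.Inv (map_term f t1)
  | GRing.Exp t1 k => GRing.Exp (map_term f t1) k
  end.

Definition parameters (n : nat) : seq (mseries n K) :=
  [seq ms_poly 'X_i | i <- enum 'I_n].

Definition expand (n : nat) (t : GRing.term K) : mseries n K :=
  GRing.eval (parameters n) (map_term (in_alg (mseries n K)) t).

(* The entry (c, (i, j, k)) stands for the summand c psi^{ij}_k. *)
Definition rat_family := seq (GRing.term K * (nat * nat * nat)).

Definition psi_term (c : GRing.term K) (i j k : nat) := (c, (i, j, k)).

Definition regular_family (F : rat_family) : bool := all (fun x => regular x.1) F.

Definition family_in (A : comUnitRingType) (ev : GRing.term K -> A) (F : rat_family) :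
  cochain A := \sum_(x <- F) ev x.1 *: psi x.2.1.1 x.2.1.2 x.2.2.

Definition family_at (e : seq K) (F : rat_family) : cochain K :=
  family_in (GRing.eval e) F.

Definition solution (rels : seq (GRing.term K)) (e : seq K) : bool :=
  all (fun r => GRing.eval e r == 0) rels.

Definition presented_base (n : nat) (rels : seq (GRing.term K)) : augAlg K :=
  series_base [seq expand n r | r <- rels].

Definition family_over (n : nat) (rels : seq (GRing.term K)) (F : rat_family) :
  cochain (presented_base n rels) :=
  map_cochain (sq_pi [seq expand n r | r <- rels]) (family_in (expand n) F).

Definition miniversal_family (n : nat) (rels : seq (GRing.term K))
    (d : cochain K) (F : rat_family) : Prop :=
  [/\ all regular rels, solution rels [::], regular_family F
    & miniversal d (family_over n rels F)].

End Families.

Arguments psi_term {K} c%_T (i j k)%_N.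

Section Local.
Variable K : numFieldType.

Definition near1 (P : K -> Prop) : Prop :=
  exists2 eps : K, 0 < eps & forall t, `|t| < eps -> P t.

Definition near2 (P : K -> K -> Prop) : Prop :=
  exists2 eps : K, 0 < eps &
    forall t1 t2, `|t1| < eps -> `|t2| < eps -> P t1 t2.

Definition near3 (P : K -> K -> K -> Prop) : Prop :=
  exists2 eps : K, 0 < eps &
    forall t1 t2 t3, `|t1| < eps -> `|t2| < eps -> `|t3| < eps -> P t1 t2 t3.

(* One-parameter families are those given near 0 by rational expressions that
   are regular at 0. *)
Definition jump_deformation (dt : K -> cochain K) (d d' : cochain K) : Prop :=
  [/\ exists2 F : rat_family K, regular_family F &
        near1 (fun t => dt t = family_at [:: t] F),
      dt 0 = d,
      near1 (fun t => codifferential (dt t))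
    & near1 (fun t => t != 0 -> equivalent (dt t) d')].

End Local.

Section Codifferentials.
Variable K : fieldType.

Definition d15 (p q : K) : cochain K := p *: psi 2 3 1 + q *: psi 3 2 1.

Definition d1 : cochain K := psi 2 3 2 - psi 3 2 2 + psi 2 2 3 - psi 3 3 3.
Definition d4 : cochain K := psi 3 3 3 + psi 3 1 1 - psi 2 3 2.
Definition d5 : cochain K := psi 3 3 3 - psi 1 3 1 + psi 3 2 2 - psi 2 3 2.
Definition d6 : cochain K := psi 3 3 3 + psi 3 1 1 + psi 3 2 2 - psi 2 3 2.
Definition d7 : cochain K := psi 3 3 3 + psi 3 2 2.
Definition d8 : cochain K := psi 3 3 3 - psi 2 3 2.
Definition d11 : cochain K := psi 3 3 3 + psi 3 2 2 - psi 2 3 2.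
Definition d12 : cochain K := psi 2 2 3 + psi 2 3 1 - psi 3 2 1.

Local Notation t1 := (GRing.Var K 0).
Local Notation t2 := (GRing.Var K 1).
Local Notation t3 := (GRing.Var K 2).

Definition generic_family (p q : K) : rat_family K := [::
  psi_term p%:T 2 3 1;
  psi_term (q%:T + t2) 3 2 1;
  psi_term t1 3 1 1;
  psi_term t1 3 3 3;
  psi_term (t1 * (p%:T - q%:T - t2) / (2%:R * (q%:T + t2))) 1 3 1;
  psi_term (- (t1 * (p%:T + q%:T + t2) / (2%:R * (q%:T + t2)))) 2 3 2;
  psi_term (- (t1 ^+ 2 * (p%:T + q%:T + t2) * (p%:T - q%:T - t2)
        / (4%:R * p%:T * (q%:T + t2) ^+ 2))) 1 3 2;
  psi_term (- (t1 ^+ 2 * (p%:T + q%:T + t2) * (p%:T - q%:T - t2)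
        / (4%:R * (q%:T + t2) * p%:T ^+ 2))) 3 1 2].

Definition generic_relations (p q : K) : seq (GRing.term K) := [::
  t1 ^+ 2 * (p%:T + q%:T + t2) * (p%:T - q%:T - t2) / p%:T ^+ 2]%T.

Definition family01 : rat_family K := [::
  psi_term 1 3 2 1;
  psi_term t1 3 1 1;
  psi_term t1 3 3 3;
  psi_term t2 2 3 1;
  psi_term t3 2 3 2;
  psi_term (t3 + t1 * t2) 1 3 1].

Definition relations01 : seq (GRing.term K) := [::
  t3 * (t1 + t3);
  t2 * (t1 + 2%:R * t3 + t1 * t2)]%T.

Definition family11 : rat_family K := [::
  psi_term 1 2 3 1;
  psi_term 1 3 2 1;
  psi_term t1 3 1 1;
  psi_term t1 3 3 3;
  psi_term t2 3 2 1;
  psi_term (- (t1 * (t2 + 2%:R) / (2%:R * (t2 + 1)))) 2 3 2;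
  psi_term (- (t1 * t2 / (2%:R * (t2 + 1)))) 1 3 1;
  psi_term (t1 ^+ 2 * t2 * (t2 + 1) / (4%:R * (t2 + 1) ^+ 2)) 1 3 2].

Definition relations11 : seq (GRing.term K) := [::
  t1 ^+ 2 * t2 * (t2 + 2%:R) / (1 + t2)]%T.

(* The restriction of the miniversal deformation of d_15(1:-1) to t_2 = 0. *)
Definition plane_family (t1 t3 : K) : cochain K :=
  d15 1 (-1) - t1 *: psi 1 3 1 + t1 *: psi 3 1 1 + t1 *: psi 3 3 3
  + t3 *: psi 2 2 3 + (t1 ^+ 2 * t3) *: psi 1 1 3
  - (t1 * t3) *: psi 1 2 3 - (t1 * t3) *: psi 2 1 3.

End Codifferentials.

Arguments d1 {K}.
Arguments d4 {K}.
Arguments d5 {K}.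
Arguments d6 {K}.
Arguments d7 {K}.
Arguments d8 {K}.
Arguments d11 {K}.
Arguments d12 {K}.
Arguments family01 {K}.
Arguments relations01 {K}.
Arguments family11 {K}.
Arguments relations11 {K}.

(* Main.v *)
Require Import Defs.
From mathcomp Require Import all_boot all_order all_algebra reals complex.
From HB Require Import structures.
From mathcomp Require Import ring_quotient boolp mpoly ring.

Set Implicit Arguments.
Unset Strict Implicit.
Unset Printing Implicit Defensive.

Import Order.TTheory GRing.Theory Num.Theory.
Local Open Scope ring_scope.

(** Write an odd cochain as a pair of operators L, R on the span of v_1, v_2 (left
    and right multiplication by v_3), a bilinear form B on it, and the scalar c
    with d(v_3, v_3) = c v_3.  The codifferential identity says L^2 = c L,
    R^2 + c R = 0, LR = RL, together with equations linear in B.  Let d be a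
    deformation of d_15(p:q), q <> 0, over a complete base.  Since v_2 L is a unit
    multiple of v_1 modulo the maximal ideal, L is cyclic with cyclic vector v_2,
    so R = x + y L and B is determined by b = B(v_2, v_2).  In the basis
    v_2 L / q', v_2, v_3 the structure depends only on c, x, y, b and the free
    scale q', and the identity reduces to x (x + c) = 0, y (2x + yc + c) = 0,
    b (1 + y) = 0, b x = 0.  If p <> 0, then y is a unit, x = - c (1 + y) / 2, and
    the choice q' = p / y gives the parameters t_1 = c, t_2 = q' - q, t_3 = b; if
    p = 0, the choice q' = 1 gives t_1 = c, t_2 = y, t_3 = x.  In both cases these
    are the families of the theorem, and a first-order computation shows that an
    equivalence over an infinitesimal base cannot change the parameters.

    That the presented bases are formal bases needs finitely generated ideals of
    K[[t_1, ..., t_n]] to be closed.  Sending t_i to arbitrary elements of the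
    maximal ideal of a complete base extends to a morphism from K[[t]]. *)

(** * Complete augmented algebras *)

(** No cohomology or obstruction theory enters: an arbitrary deformation over a complete base is
    normalized exactly, and the coefficients left over are the images of the parameters t_i. Since y
    q' = p, the equation x (x + c) = 0 becomes c^2 (p + q') (p - q') = 0 up to a unit, which is the
    relation of (a) and (d). The coefficients of psi^{13}_2 and psi^{31}_2 there are multiples of
    it, so they vanish on the base. The factor p + q' is a unit unless p = -q, and p - q' is one
    unless p = q; this singles out (1:1) and (1:-1). Likewise b (1 + y) = 0 kills b unless p = -q,
    so b survives as a parameter only at (1:-1). The normal form is written without inverses by
    means of b q' = -b. For q' = p / y this amounts to b p = b, whence the representative with p = 1
    wherever b may be nonzero. *)

Section AdicRings.
Variables (A : comNzRingType) (I : A -> Prop).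
Hypothesis idI : is_ideal I.

Lemma is_idealN (J : A -> Prop) x : is_ideal J -> J x -> J (- x).
Proof. by case=> _ _ JM Jx; rewrite -mulN1r; apply: JM. Qed.

Lemma is_ideal_sum (J : A -> Prop) (idJ : is_ideal J) (T : Type) (s : seq T)
    (P : pred T) F :
  (forall i, P i -> J (F i)) -> J (\sum_(i <- s | P i) F i).
Proof. by case: idJ => J0 JD _ JF; exact: big_ind. Qed.

Lemma ideal_mul_ideal (J : A -> Prop) : is_ideal J -> is_ideal (ideal_mul I J).
Proof.
move=> [J0 JD JM]; split.
- by exists [::]; rewrite big_nil.
- move=> x y [s [sP ->]] [t [tP ->]]; exists (s ++ t); split; last by rewrite big_cat.
  by move=> z; rewrite mem_cat => /orP[/sP|/tP].
- move=> a x [s [sP ->]]; exists [seq (y.1, a * y.2) | y <- s]; split.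
    by move=> z /mapP[y /sP[Iy Jy] ->] /=; split=> //; apply: JM.
  by rewrite big_map mulr_sumr; apply: eq_bigr => y _ /=; rewrite mulrCA.
Qed.

Lemma ideal_mulM (J : A -> Prop) x y : I x -> J y -> ideal_mul I J (x * y).
Proof.
by exists [:: (x, y)]; rewrite big_seq1; split=> // z; rewrite inE => /eqP ->.
Qed.

Lemma ideal_pow_ideal k : is_ideal (ideal_pow I k).
Proof. by elim: k => [|k IHk]; [split | exact: ideal_mul_ideal]. Qed.

Lemma ideal_powM j k x y :
  ideal_pow I j x -> ideal_pow I k y -> ideal_pow I (j + k) (x * y).
Proof.
elim: j x y => [|j IHj] x y.
  by move=> _; case: (ideal_pow_ideal k) => _ _; apply.
move=> [s [sP ->]] ky; rewrite mulr_suml big_seq.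
apply: (is_ideal_sum (ideal_pow_ideal (j.+1 + k))) => z /sP[Iz jz].
by rewrite -mulrA; apply: ideal_mulM => //; apply: IHj.
Qed.

Lemma ideal_powS_sub k x : ideal_pow I k.+1 x -> ideal_pow I k x.
Proof.
case=> s [sP ->]; rewrite big_seq.
apply: (is_ideal_sum (ideal_pow_ideal k)) => z /sP[_ kz].
by case: (ideal_pow_ideal k) => _ _; apply.
Qed.

Lemma ideal_pow_sub j k x : (j <= k)%N -> ideal_pow I k x -> ideal_pow I j x.
Proof.
move=> /subnK <-; elim: (k - j)%N => // m IHm; rewrite addSn.
by move=> /ideal_powS_sub.
Qed.

Lemma ideal_pow1 x : ideal_pow I 1 x <-> I x.
Proof.
split=> [[s [sP ->]]|Ix]; last first.
  by rewrite -[x]mulr1; apply: ideal_mulM.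
rewrite big_seq; apply: (is_ideal_sum idI) => z /sP[Iz _].
by rewrite mulrC; case: idI => _ _; apply.
Qed.

Lemma ideal_pow_exp k x : I x -> ideal_pow I k (x ^+ k).
Proof.
by move=> Ix; elim: k => // k IHk; rewrite exprS; apply: ideal_mulM.
Qed.

Hypothesis complA : adic_complete I.

Lemma adic_separated x : (forall k, ideal_pow I k x) -> x = 0.
Proof. by case: complA => sep _; apply: sep. Qed.

(* The inverse of 1 - x is the geometric series. *)
Lemma adic_one_sub_unit x : I x -> exists y, y * (1 - x) = 1.
Proof.
move=> Ix; case: complA => sep lim.
have [|y yP] := lim (fun k => \sum_(i < k) x ^+ i).
  by move=> k; rewrite big_ord_recr /= addrAC subrr add0r; apply: ideal_pow_exp.
exists y; apply/eqP; rewrite -subr_eq0; apply/eqP/sep => k.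
case: (ideal_pow_ideal k) => _ JD JM.
set u := \sum_(i < k) x ^+ i.
have -> : y * (1 - x) - 1 = (1 - x) * (y - u) + - x ^+ k.
  have -> : x ^+ k = (x - 1) * u + 1 by rewrite -subrX1 subrK.
  by ring.
by apply: JD; [exact/JM/yP | exact/(is_idealN (ideal_pow_ideal k))/ideal_pow_exp].
Qed.

End AdicRings.

(** * Completeness implies locality *)

Section FormalBases.
Variables (K : fieldType) (A : augAlg K).
Implicit Types x y : A.

Lemma aug_ideal_is_ideal : is_ideal (@aug_ideal K A).
Proof.
split; first exact: rmorph0.
- by move=> x y x0 y0; rewrite /aug_ideal rmorphD /= x0 y0 addr0.
- by move=> a x x0; rewrite /aug_ideal rmorphM /= x0 mulr0.
Qed.

Lemma aug_alg (c : K) : aug A c%:A = c.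
Proof. by rewrite linearZ /= rmorph1; apply: mulr1. Qed.

Hypothesis complA : adic_complete (@aug_ideal K A).

(** Dividing by the scalar c = aug x gives an element 1 - z with z in the augmentation ideal, which
    is inverted by a geometric series. *)
Lemma complete_invertible x : aug A x != 0 -> exists y, y * x = 1.
Proof.
move=> ux; pose c := aug A x.
have [|y yx] := adic_one_sub_unit complA (x := 1 - c^-1 *: x).
  by rewrite /aug_ideal rmorphB /= linearZ /= rmorph1 -/c /GRing.scale /= mulVf ?subrr.
exists (c^-1 *: y); rewrite -yx opprB addrCA subrr addr0.
by rewrite -scalerAl -scalerAr.
Qed.

(** A proper ideal contains no invertible element, so by [complete_invertible] all its elements have
    augmentation 0. Completeness alone therefore makes the augmentation ideal the only maximal
    one. *)
Lemma complete_formal_base : formal_base A.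
Proof.
split=> //; have aug1 : ~ aug_ideal (1 : A).
  by rewrite /aug_ideal rmorph1 => /eqP; rewrite oner_eq0.
have idA := aug_ideal_is_ideal.
have sub J x : is_ideal J -> ~ J 1 -> J x -> aug_ideal x.
  move=> [_ _ JM] J1 Jx; apply: contrapT => /eqP ux; apply: J1.
  by have [y <-] := complete_invertible ux; apply: JM.
split.
  split=> // J idJ IJ; have [J1|J1] := EM (J 1); first by right.
  by left=> x; apply: sub.
move=> J [idJ J1 maxJ] x; split; first exact: sub.
by move=> Ix; have [H|//] := maxJ _ idA (fun y => sub J y idJ J1); apply: H.
Qed.

End FormalBases.

(** * Formal power series *)

Section StableChains.
Variables (K : fieldType) (vT : vectType K).

Definition is_subspace (W : vT -> Prop) : Prop :=
  W 0 /\ forall a u v, W u -> W v -> W (a *: u + v).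

(** Among the subspaces contained in W, one of maximal dimension exhausts W: adjoining a further
    vector of W would raise the dimension. *)
Lemma subspace_vspace (W : vT -> Prop) :
  is_subspace W -> exists U : {vspace vT}, forall v, v \in U <-> W v.
Proof.
move=> [W0 WD].
pose P d := `[< exists2 U : {vspace vT}, \dim U = d & forall v, v \in U -> W v >].
have exP : exists d, P d.
  exists 0%N; apply/asboolP; exists 0%VS; first exact: dimv0.
  by move=> v; rewrite memv0 => /eqP ->.
have ubP d : P d -> (d <= \dim {:vT})%N.
  by move=> /asboolP[U <- _]; apply: dimvS (subvf U).
case: (ex_maxnP exP ubP) => d /asboolP[U dimU UW] maxd; exists U => v.
split=> [|Wv]; first exact: UW.
have: P (\dim (U + <[v]>)).
  apply/asboolP; exists (U + <[v]>)%VS => // w.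
  case/memv_addP=> u Uu [_ /vlineP[a ->] ->]; rewrite addrC.
  by apply: WD => //; apply: UW.
move=> /maxd; rewrite -dimU => le_dim.
have /eqP -> : (U == U + <[v]>)%VS by rewrite eqEdim addvSl le_dim.
exact/(subvP (addvSr _ _))/memv_line.
Qed.

(** An index at which the dimension is minimal works: later members are included in that one and
    cannot have smaller dimension. *)
Lemma subspace_chain_stable (W : nat -> vT -> Prop) :
  (forall N, is_subspace (W N)) ->
  (forall M N v, (M <= N)%N -> W N v -> W M v) ->
  exists M, forall N v, (M <= N)%N -> W M v -> W N v.
Proof.
move=> subW decW.
pose U N := projT1 (cid (subspace_vspace (subW N))).
have UP N v : v \in U N <-> W N v by rewrite /U; case: cid.
have exd : exists d, `[< exists N, \dim (U N) = d >].
  by exists (\dim (U 0)); apply/asboolP; exists 0%N.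
case: (ex_minnP exd) => d /asboolP[M dimM] mind.
exists M => N v leMN /UP UMv; apply/UP.
have sNM : (U N <= U M)%VS by apply/subvP => w /UP /(decW _ _ _ leMN) /UP.
have /eqP -> // : (U N == U M)%VS.
by rewrite eqEdim sNM dimM; apply: mind; apply/asboolP; exists N.
Qed.

End StableChains.

Section SeriesOrder.
Variables (n : nat) (K : fieldType).
Local Notation S := (mseries n K).
Implicit Types (f g : S) (m : 'X_{1..n}).

Definition ms_order k f := forall m, (mdeg m < k)%N -> mscoef f m = 0.

Definition ms_var (i : 'I_n) : S := ms_poly 'X_i.

Lemma mscoefD f g m : mscoef (f + g) m = mscoef f m + mscoef g m.
Proof. by []. Qed.

Lemma mscoefN f m : mscoef (- f) m = - mscoef f m.
Proof. by []. Qed.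

Lemma mscoefZ a f m : mscoef (a *: f) m = a * mscoef f m.
Proof. by []. Qed.

Lemma mscoef_sum (T : Type) (s : seq T) (P : pred T) (F : T -> S) m :
  mscoef (\sum_(i <- s | P i) F i) m = \sum_(i <- s | P i) mscoef (F i) m.
Proof. by apply: (big_morph (fun f => mscoef f m)). Qed.

Lemma mscoef_var_mul i f m :
  mscoef (ms_var i * f) m = if m i == 0%N then 0 else mscoef f (m - U_(i))%MM.
Proof.
case: ifPn => [/eqP mi0|mi].
  apply: big1 => k /eqP mE /=; rewrite mcoeffX; case: eqP => [k1|]; last by rewrite mul0r.
  by have := congr1 (fun u : 'X_{1..n} => u i) mE; rewrite /= mi0 mnmDE -k1 mnm1E eqxx.
rewrite (@ms_mulE _ _ _ _ 'X_i (ms_trunc (mdeg m).+1 f)) //; last first.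
  by move=> k le_km; rewrite ms_truncE.
have := mcoeffMX (ms_trunc (mdeg m).+1 f) U_(i)%MM (m - U_(i))%MM.
by rewrite addmC submK ?lep1mP // mulrC => ->; rewrite ms_truncE // ltnS mdegB.
Qed.

Lemma ms_orderD k f g : ms_order k f -> ms_order k g -> ms_order k (f + g).
Proof. by move=> fk gk m lt_mk; rewrite mscoefD fk ?gk ?addr0. Qed.

Lemma ms_orderN k f : ms_order k f -> ms_order k (- f).
Proof. by move=> fk m lt_mk; rewrite mscoefN fk ?oppr0. Qed.

Lemma ms_orderB k f g : ms_order k f -> ms_order k g -> ms_order k (f - g).
Proof. by move=> fk gk; apply/ms_orderD/ms_orderN. Qed.

Lemma ms_order_sub j k f : (j <= k)%N -> ms_order k f -> ms_order j f.
Proof. by move=> le_jk fk m lt_mj; apply/fk/(leq_trans lt_mj). Qed.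

Lemma ms_orderM j k f g : ms_order j f -> ms_order k g -> ms_order (j + k) (f * g).
Proof.
move=> fj gk m lt_m; apply: big1 => u /eqP mE.
have [lt_j|le_j] := ltnP (mdeg u.1) j; first by rewrite fj ?mul0r.
rewrite gk ?mulr0 // -(ltn_add2l j); apply: leq_ltn_trans lt_m.
have := congr1 mdeg mE; rewrite mdegD => e.
by apply: leq_trans (eq_leq (esym e)); rewrite leq_add2r.
Qed.

Lemma ms_orderMl k f g : ms_order k g -> ms_order k (f * g).
Proof. exact: (@ms_orderM 0). Qed.

Lemma ms_order_sum k (T : Type) (s : seq T) (P : pred T) (F : T -> S) :
  (forall i, P i -> ms_order k (F i)) -> ms_order k (\sum_(i <- s | P i) F i).
Proof. by move=> Fk m lt_mk; rewrite mscoef_sum big1 // => i /Fk ->. Qed.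

Lemma ms_order_eq0 f : (forall k, ms_order k f) -> f = 0.
Proof. by move=> f0; apply: mseriesP => m; apply: (f0 (mdeg m).+1). Qed.

Lemma ms_order1P f : ms_order 1 f <-> ms_const f = 0.
Proof.
split=> [f1|f0 m]; first by apply: f1; rewrite mdeg0.
by rewrite ltnS leqn0 mdeg_eq0 => /eqP ->.
Qed.

(* Each monomial of f is attributed to the first variable that divides it. *)
Lemma ms_order_decomp k f : ms_order k.+1 f ->
  exists2 g : 'I_n -> S, forall i, ms_order k (g i) & f = \sum_i ms_var i * g i.
Proof.
move=> fk; pose first m : option 'I_n := [pick i | m i != 0%N].
exists (fun i => MSeries (fun m =>
  if first (m + U_(i))%MM == Some i then mscoef f (m + U_(i))%MM else 0)).
  by move=> i m lt_mk /=; case: eqP => // _; apply: fk; rewrite mdegD mdeg1 addn1.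
apply: mseriesP => m; rewrite mscoef_sum.
under eq_bigr => i _ do rewrite mscoef_var_mul /=.
case def_i: (first m) => [i|]; last first.
  move: def_i; rewrite /first; case: pickP => // m0 _.
  rewrite big1 => [|i _]; last by have /negbFE -> := m0 i.
  suff -> : m = 0%MM by apply: fk; rewrite mdeg0.
  by apply/mnmP => i; have /negbFE/eqP -> := m0 i; rewrite mnm0E.
rewrite (bigD1 i) //= big1 ?addr0 => [|j neq_ji].
  have mi : m i != 0%N by move: def_i; rewrite /first; case: pickP => // ? ? [<-].
  by rewrite (negbTE mi) submK ?lep1mP // def_i eqxx.
case: ifPn => // mj; rewrite submK ?lep1mP // def_i.
by case: (Some i =P Some j) => // -[ij]; rewrite ij eqxx in neq_ji.
Qed.

(** The ideal of series without constant term is generated by the variables, so its powers are the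
    order filtration. Adic statements thus become statements on coefficients. *)
Lemma ms_order_ideal_pow k f :
  ms_order k f <-> ideal_pow (fun g : S => ms_const g = 0) k f.
Proof.
elim: k f => [|k IHk] f; first by [].
split=> [/ms_order_decomp[g gk ->]|[s [sP ->]]].
  exists [seq (ms_var i, g i) | i <- enum 'I_n]; rewrite big_map big_enum /=.
  split=> // y /mapP[i _ ->] /=; split; last exact/IHk.
  by rewrite /ms_const /= mcoeffX mnm1_eq0.
rewrite big_seq; apply: ms_order_sum => y /sP[/ms_order1P y1 /IHk y2].
exact: (@ms_orderM 1).
Qed.

End SeriesOrder.

(** * Finitely generated ideals of K[[t]] are closed *)

Section ClosedIdeals.
Variables (n : nat) (K : fieldType) (rels : seq (mseries n K)).
Local Notation S := (mseries n K).
Local Notation s := (size rels).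
Local Notation C := {ffun 'I_s -> S}.

Let comb (c : C) : S := \sum_i c i * rels`_i.

Let combD (c e : C) : comb (c + e) = comb c + comb e.
Proof. by rewrite /comb -big_split; apply: eq_bigr => i _; rewrite ffunE mulrDl. Qed.

Let combB (c e : C) : comb (c - e) = comb c - comb e.
Proof.
rewrite combD /comb -sumrN; congr (_ + _).
by apply: eq_bigr => i _; rewrite ffunE mulNr.
Qed.

Let combZ a (c : C) : comb (a *: c) = a *: comb c.
Proof.
by rewrite /comb scaler_sumr; apply: eq_bigr => i _; rewrite ffunE scalerAl.
Qed.

(** The target is finite-dimensional, so that [subspace_chain_stable] applies to images under this
    map. *)
Let trunc k (c : C) : {ffun 'I_s * 'X_{1..n < k} -> K^o} :=
  [ffun x : 'I_s * 'X_{1..n < k} => mscoef (c x.1) x.2 : K^o].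

Let comb_order k (c : C) : trunc k c = 0 -> ms_order k (comb c).
Proof.
move=> c0; apply: ms_order_sum => i _; rewrite mulrC; apply: ms_orderMl => m lt_mk.
by have /ffunP/(_ (i, BMultinom lt_mk)) := c0; rewrite !ffunE.
Qed.

Let ker_trunc_subspace k N :
  is_subspace (fun v => exists2 c, ms_order N (comb c) & trunc k c = v).
Proof.
split.
  exists 0; last by apply/ffunP => x; rewrite !ffunE.
  by apply: ms_order_sum => i _; rewrite ffunE mul0r.
move=> a u v [c cN <-] [e eN <-]; exists (a *: c + e).
  rewrite combD combZ; apply: ms_orderD => // m lt_mN.
  by rewrite mscoefZ cN ?mulr0.
by apply/ffunP => x; rewrite !ffunE.
Qed.

(** The truncations of the c with [comb c] of order N form a decreasing chain of subspaces as N
    grows. Once it is stationary, an approximate syzygy can be replaced by one of any higher order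
    without changing its coefficients below degree k. *)
Let stable k : exists2 M, (k <= M)%N & forall N c, (M <= N)%N ->
  ms_order M (comb c) -> exists2 e, ms_order N (comb e) & trunc k e = trunc k c.
Proof.
have [|M stM] := subspace_chain_stable (ker_trunc_subspace k).
  by move=> M N v leMN [c cN <-]; exists c => //; apply: ms_order_sub cN.
exists (maxn k M); first exact: leq_maxl.
move=> N c; rewrite geq_max => /andP[_ leMN] cM.
have [|e eN <-] := stM N (trunc k c) leMN; last by exists e.
by exists c => //; apply: ms_order_sub cM; apply: leq_maxr.
Qed.

(* The combinations that represent f up to order N form affine spaces which are
   finite-dimensional after truncation, hence stationary: this makes it possible
   to pass to the limit in N. *)
Lemma series_ideal_closed f :
  (forall N, exists c : nat -> S, ms_order N (f - \sum_(i < s) c i * rels`_i)) ->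
  exists c : nat -> S, f = \sum_(i < s) c i * rels`_i.
Proof.
move=> approx; pose bound k := projT1 (cid2 (stable k)).
have boundP k : (k <= bound k)%N /\ forall N c, (bound k <= N)%N ->
    ms_order (bound k) (comb c) ->
    exists2 e, ms_order N (comb e) & trunc k e = trunc k c.
  by rewrite /bound; case: cid2.
have approxC N : exists c : C, ms_order N (f - comb c).
  have [c cN] := approx N; exists [ffun i : 'I_s => c i].
  by rewrite /comb; under eq_bigr => i _ do rewrite ffunE.
pose good k := {c : C | ms_order (bound k) (f - comb c)}.
(* A better approximation c' may differ from c in low degree. The difference c' - c is an
   approximate syzygy, so it has the same truncation as some w of higher order; then c' - w is still
   a better approximation and agrees with c below degree k. *)
have next k (c : good k) : {e : good k.+1 | trunc k (sval e) = trunc k (sval c)}.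
  case: c => c cP /=; apply: cid; pose N := maxn (bound k) (bound k.+1).
  have [c' c'N] := approxC N; have [_ /(_ N (c' - c))] := boundP k.
  case=> [||w wN wE]; first exact: leq_maxl.
    have -> : comb (c' - c) = (f - comb c) - (f - comb c') by rewrite combB; ring.
    by apply: ms_orderB => //; apply: ms_order_sub c'N; apply: leq_maxl.
  have c''P : ms_order (bound k.+1) (f - comb (c' - w)).
    rewrite combB opprB addrA addrAC; apply: ms_orderD.
      by apply: ms_order_sub c'N; apply: leq_maxr.
    by apply: ms_order_sub wN; apply: leq_maxr.
  exists (exist (fun e : C => ms_order (bound k.+1) (f - comb e)) (c' - w) c''P) => /=.
  apply/ffunP => x.
  have /ffunP/(_ x) := wE; rewrite !ffunE /= => ->.
  by rewrite opprB addrC subrK.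
have c0 : good 0 by apply: cid.
pose cs := nat_rect good c0 (fun k c => sval (next k c)).
have csS k x (lt_xk : (mdeg x < k)%N) i :
    mscoef (sval (cs k.+1) i) x = mscoef (sval (cs k) i) x.
  have /= := svalP (next k (cs k)) => /ffunP/(_ (i, BMultinom lt_xk)).
  by rewrite !ffunE.
have csE k j x i : (mdeg x < k)%N -> (k <= j)%N ->
    mscoef (sval (cs j) i) x = mscoef (sval (cs k) i) x.
  move=> lt_xk /subnK <-; elim: (j - k)%N => // m IHm.
  by rewrite addSn csS // (leq_trans lt_xk) // leq_addl.
(* The coefficient at m no longer changes from the index [(mdeg m).+1] on, so it can be read
   there. *)
pose c : C := [ffun i => MSeries (fun m => mscoef (sval (cs (mdeg m).+1) i) m)].
have cE k : trunc k c = trunc k (sval (cs k)).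
  apply/ffunP => -[i x]; rewrite !ffunE /=.
  by rewrite -(@csE (mdeg x).+1 k) // bmdeg.
have fE : f = comb c.
  apply/eqP; rewrite -subr_eq0; apply/eqP/ms_order_eq0 => k.
  rewrite -(subrKA (comb (sval (cs k)))); apply: ms_orderD.
    by apply: ms_order_sub (svalP (cs k)); case: (boundP k).
  rewrite -combB; apply: comb_order; apply/ffunP => x.
  have /ffunP/(_ x) := cE k; rewrite !ffunE /= => ->.
  by rewrite subrr.
exists (fun i => if insub i is Some j then c j else 0).
by rewrite fE /comb; apply: eq_bigr => i _; rewrite valK.
Qed.

End ClosedIdeals.

(** * Completeness of the presented bases *)

Section SeriesBase.
Variables (n : nat) (K : fieldType) (rels : seq (mseries n K)).
Local Notation S := (mseries n K).
Local Notation A := (series_base rels).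

Lemma sq_aug_idealP (f : S) : @aug_ideal K A (sq_pi rels f) <-> ms_const f = 0.
Proof. by rewrite /aug_ideal /= sq_aug_pi. Qed.

(** The adic filtration of the quotient is the image of the order filtration: the factors of each
    product are lifted separately. *)
Lemma sq_ideal_powP k (x : A) :
  ideal_pow (@aug_ideal K A) k x <-> exists2 f, ms_order k f & x = sq_pi rels f.
Proof.
split; last first.
  case=> f /ms_order_ideal_pow fk ->; elim: k f fk => [|k IHk] f //.
  case=> s [sP ->]; rewrite rmorph_sum big_seq.
  apply: (is_ideal_sum (ideal_pow_ideal _ k.+1)) => y /sP[y1 y2].
  by rewrite rmorphM; apply: ideal_mulM; [exact/sq_aug_idealP | exact: IHk].
elim: k x => [|k IHk] x; first by have [f ->] := sq_pi_surj x; exists f.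
case=> s [sP ->]; elim: s sP => [|y s IHs] sP.
  by exists 0; rewrite ?big_nil ?rmorph0.
have [|f fk fE] := IHs; first by move=> z zs; apply: sP; rewrite inE zs orbT.
have [y1 /IHk[h hk hE]] := sP y (mem_head _ _).
have [g gE] := sq_pi_surj y.1.
exists (g * h + f); last by rewrite big_cons fE rmorphD rmorphM gE hE.
apply: ms_orderD => //; apply: (@ms_orderM _ _ 1) => //.
by apply/ms_order1P/sq_aug_idealP; rewrite -gE.
Qed.

Lemma rel_idealP (f : S) :
  f \in rel_ideal rels <-> ms_const f = 0 /\
    exists c : nat -> S, f = \sum_(i < size rels) c i * rels`_i.
Proof. by split=> [/asboolP|?]; last exact/asboolP. Qed.

(** Separatedness is the closedness of the ideal of relations. For limits, each increment u (k+1) -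
    u k is lifted to a series of order k; the partial sums then stabilize coefficientwise, and the
    limit series is projected back. *)
Lemma series_base_complete : adic_complete (@aug_ideal K A).
Proof.
split=> [x xI|u uC].
  have [f fE] := sq_pi_surj x.
  rewrite fE -[0](rmorph0 (sq_pi rels)); apply/sq_piP; rewrite subr0.
  have approx k : exists2 g, ms_order k g & f - g \in rel_ideal rels.
    by have /sq_ideal_powP[g gk] := xI k; rewrite fE => /sq_piP; exists g.
  apply/rel_idealP; split.
    have [g /ms_order1P g1 /rel_idealP[+ _]] := approx 1%N.
    by rewrite rmorphB /= g1 subr0.
  apply: series_ideal_closed => k; have [g gk /rel_idealP[_ [c cE]]] := approx k.
  by exists c; rewrite -cE opprB addrC subrK.
have [f0 f0E] := sq_pi_surj (u 0%N).
have lift k : {e : S | ms_order k e /\ sq_pi rels e = u k.+1 - u k}.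
  by apply: cid; have /sq_ideal_powP[e ek eE] := uC k; exists e.
pose e k := sval (lift k); pose v k := f0 + \sum_(j < k) e j.
have eP k : ms_order k (e k) by rewrite /e; case: (lift k) => /= ? [].
have v1 k : v k.+1 = v k + e k by rewrite /v big_ord_recr addrA.
have vE k : sq_pi rels (v k) = u k.
  elim: k => [|k IHk]; first by rewrite /v big_ord0 addr0.
  rewrite v1 rmorphD /= IHk /e.
  by case: (lift k) => /= ? [_ ->]; rewrite addrC subrK.
have vS j k m : (mdeg m < k)%N -> (k <= j)%N -> mscoef (v j) m = mscoef (v k) m.
  move=> lt_mk /subnK <-; elim: (j - k)%N => // i IHi.
  rewrite addSn -IHi v1 mscoefD [X in _ + X]eP ?addr0 //.
  by rewrite (leq_trans lt_mk) // leq_addl.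
pose g : S := MSeries (fun m => mscoef (v (mdeg m).+1) m).
exists (sq_pi rels g) => k; apply/sq_ideal_powP; exists (g - v k).
  move=> m lt_mk; rewrite mscoefD mscoefN.
  by rewrite -[mscoef g m]/(mscoef (v (mdeg m).+1) m) -(vS k) // subrr.
by rewrite rmorphB /= vE.
Qed.

Lemma series_base_formal : formal_base A.
Proof. exact/complete_formal_base/series_base_complete. Qed.

End SeriesBase.

Lemma lrmorphism_of (K : fieldType) (A B : comAlgType K) (f : A -> B) :
  semilinear_for *:%R f -> monoid_morphism f ->
  exists F : {lrmorphism A -> B}, forall x, F x = f x.
Proof.
move=> lf mf.
pose L := GRing.isSemilinear.Build K A B _ f lf.
pose M := GRing.isMonoidMorphism.Build A B f mf.
pose F : {lrmorphism A -> B} := HB.pack f L M.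
by exists F.
Qed.

(** * Evaluation of power series in a complete base *)

Section Evaluation.
Variables (n : nat) (K : fieldType) (B : augAlg K) (b : 'I_n -> B).
Hypotheses (complB : adic_complete (@aug_ideal K B)).
Hypothesis b0 : forall i, aug_ideal (b i).
Local Notation S := (mseries n K).
Local Notation I := (@aug_ideal K B).

Let evp : {mpoly K[n]} -> B := mmap (in_alg B) b.

Let mmap1_ideal m : ideal_pow I (mdeg m) (mmap1 b m).
Proof.
rewrite mdegE /mmap1; elim/big_rec2: _ => [|i x k _ kx] //.
by apply: ideal_powM => //; apply: ideal_pow_exp.
Qed.

Let evp_order k (p : {mpoly K[n]}) :
  (forall m, (mdeg m < k)%N -> p@_m = 0) -> ideal_pow I k (evp p).
Proof.
move=> pk; rewrite /evp (mmapE _ (leqnn _)).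
apply: (is_ideal_sum (ideal_pow_ideal I k)) => m _.
have [lt_mk|le_km] := ltnP (mdeg m) k.
  by rewrite pk //= scale0r mul0r; case: (ideal_pow_ideal I k).
case: (ideal_pow_ideal I k) => _ _; apply; apply: ideal_pow_sub le_km _.
exact: mmap1_ideal.
Qed.

Let evp_sub k (p q : {mpoly K[n]}) :
  (forall m, (mdeg m < k)%N -> p@_m = q@_m) -> ideal_pow I k (evp p - evp q).
Proof.
move=> pq; have -> : evp p - evp q = evp (p - q) by rewrite /evp -rmorphB.
by apply: evp_order => m lt_mk; rewrite mcoeffB pq // subrr.
Qed.

(** Evaluation is the limit of the evaluated truncations. Limits are unique by separatedness, so
    each algebraic law of [ev] is proved by checking that the expected expression is a limit. *)
Let is_value (f : S) x := forall k, ideal_pow I k (x - evp (ms_trunc k f)).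

Let value_exists f : exists x, is_value f x.
Proof.
case: complB => _; apply => k.
by apply: evp_sub => m lt_mk; rewrite !ms_truncE // ltnW.
Qed.

Let ev f : B := projT1 (cid (value_exists f)).

Let evP f : is_value f (ev f). Proof. by rewrite /ev; case: cid. Qed.

Let ev_unique f x : is_value f x -> ev f = x.
Proof.
move=> fx; apply/eqP; rewrite -subr_eq0; apply/eqP/(adic_separated complB) => k.
rewrite -(subrKA (evp (ms_trunc k f))); case: (ideal_pow_ideal I k) => _ JD _.
apply: JD => //; first exact: evP.
by rewrite -opprB; apply: is_idealN => //; apply: ideal_pow_ideal.
Qed.

Let ev_poly p : ev (ms_poly p) = evp p.
Proof.
by apply: ev_unique => k; apply: evp_sub => m lt_mk; rewrite ms_truncE.
Qed.

Let evD f g : ev (f + g) = ev f + ev g.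
Proof.
apply: ev_unique => k; case: (ideal_pow_ideal I k) => _ JD _.
have -> : ev f + ev g - evp (ms_trunc k (f + g)) = (ev f - evp (ms_trunc k f)) +
    (ev g - evp (ms_trunc k g)) + (evp (ms_trunc k f + ms_trunc k g)
    - evp (ms_trunc k (f + g))).
  by rewrite [evp (_ + _)]rmorphD; ring.
apply: (JD); first by apply: (JD); exact: evP.
by apply: evp_sub => m lt_mk; rewrite mcoeffD !ms_truncE.
Qed.

Let evM f g : ev (f * g) = ev f * ev g.
Proof.
apply: ev_unique => k; case: (ideal_pow_ideal I k) => _ JD JM.
have -> : ev f * ev g - evp (ms_trunc k (f * g)) =
    ev g * (ev f - evp (ms_trunc k f)) +
    evp (ms_trunc k f) * (ev g - evp (ms_trunc k g)) +
    (evp (ms_trunc k f * ms_trunc k g) - evp (ms_trunc k (f * g))).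
  by rewrite [evp (_ * ms_trunc k g)]rmorphM; ring.
apply: (JD); first by apply: (JD); apply: (JM); exact: evP.
by apply: evp_sub => m lt_mk; rewrite -ms_mul_trunc // ms_truncE.
Qed.

Let ev_scalar (c : K) : ev c%:A = c%:A.
Proof.
have -> : c%:A = ms_poly c%:MP_[n] :> S.
  by apply: mseriesP => m /=; rewrite mcoeff1 mcoeffC.
by rewrite ev_poly /evp mmapC.
Qed.

Lemma series_eval_exists : exists e : {lrmorphism S -> B},
  (forall i, e (ms_var K i) = b i) /\ forall f, aug B (e f) = ms_const f.
Proof.
have [||e eE] := @lrmorphism_of K S B ev.
- split=> [c f|f g]; last exact: evD.
  by rewrite -[c *: f]mulr_algl evM ev_scalar mulr_algl.
- by split=> [|f g]; rewrite ?evM // -[1](scale1r 1) ev_scalar scale1r.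
exists e; split=> [i|f]; first by rewrite eE ev_poly /evp mmapX mmap1U.
rewrite eE; have /ideal_pow1 := evP f 1.
move=> /(_ (aug_ideal_is_ideal B)); rewrite /aug_ideal rmorphB /=.
have -> : ms_trunc 1 f = (ms_const f)%:MP_[n].
  apply/mpolyP => m; rewrite mcoeffC; case: eqP => [->|/eqP m0].
    by rewrite ms_truncE ?mdeg0 // mulr1.
  rewrite mulr0 /ms_trunc raddf_sum big1 //= => k _.
  rewrite mcoeffZ mcoeffX; case: eqP => [kE|]; last by rewrite mulr0.
  by have := bmdeg k; rewrite kE ltnS leqn0 mdeg_eq0 (negbTE m0).
by rewrite /evp mmapC /= aug_alg => /eqP; rewrite subr_eq0 => /eqP.
Qed.

End Evaluation.

(** * Morphisms out of a presented base *)

Section QuotientMorphisms.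
Variables (n : nat) (K : fieldType) (rels : seq (mseries n K)).
Local Notation S := (mseries n K).
Local Notation A := (series_base rels).

Lemma series_base_lift (B : augAlg K) (e : {lrmorphism S -> B}) :
  (forall f, aug B (e f) = ms_const f) ->
  (forall r, r \in rels -> e r = 0) ->
  exists F : {lrmorphism A -> B},
    aug_morphism F /\ forall f, F (sq_pi rels f) = e f.
Proof.
move=> aug_e e0; pose F (x : A) : B := e (repr (x : series_quot rels)).
have FE f : F (sq_pi rels f) = e f.
  apply/eqP; rewrite /F -subr_eq0 -rmorphB; apply/eqP.
  have : repr (sq_pi rels f) - f \in rel_ideal rels.
    by apply/sq_piP; rewrite /sq_pi reprK.
  case/rel_idealP => _ [c ->]; rewrite rmorph_sum big1 // => i _.
  by rewrite rmorphM /= (e0 rels`_i) ?mulr0 // mem_nth.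
have scalE c f : c *: sq_pi rels f = sq_pi rels (c *: f).
  rewrite -[c *: sq_pi rels f]/(sq_pi rels c%:A * sq_pi rels f) -rmorphM.
  by rewrite -scalerAl mul1r.
have [||G GE] := @lrmorphism_of K A B F.
- split=> [c x|x y]; have [f ->] := sq_pi_surj x; first by rewrite scalE !FE linearZ.
  by have [g ->] := sq_pi_surj y; rewrite -rmorphD !FE rmorphD.
- split=> [|x y]; first by rewrite -[1](rmorph1 (sq_pi rels)) FE rmorph1.
  have [f ->] := sq_pi_surj x; have [g ->] := sq_pi_surj y.
  by rewrite -rmorphM !FE rmorphM.
exists G; split=> [x|f]; last by rewrite GE FE.
by have [f ->] := sq_pi_surj x; rewrite GE FE aug_e /= sq_aug_pi.
Qed.

(** A series is its constant term plus a sum of products t_i u_i. The images of the t_i lie in an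
    ideal of square zero, so u_i matters only through its constant term: the morphism sees the
    linear part alone. *)
Lemma infinitesimal_morphism_eq (B : augAlg K) (f f' : {lrmorphism A -> B}) :
  infinitesimal B -> aug_morphism f -> aug_morphism f' ->
  (forall i, f (sq_pi rels (ms_var K i)) = f' (sq_pi rels (ms_var K i))) ->
  f =1 f'.
Proof.
move=> infB aug_f aug_f' eq_var x; have [g ->] := sq_pi_surj x.
have idB := aug_ideal_is_ideal B.
have algE (h : {lrmorphism A -> B}) c : h (sq_pi rels c%:A) = c%:A.
  have -> : sq_pi rels c%:A = c%:A :> A.
    by rewrite -[RHS]/(sq_pi rels c%:A * 1) mulr1.
  by rewrite linearZ rmorph1.
have linE (h : {lrmorphism A -> B}) i u : aug_morphism h ->
    h (sq_pi rels (ms_var K i * u)) = h (sq_pi rels (ms_var K i)) * (ms_const u)%:A.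
  move=> aug_h; rewrite !rmorphM; apply/eqP; rewrite -subr_eq0 -mulrBr; apply/eqP.
  apply: infB; apply: (@ideal_powM _ _ 1 1); apply/ideal_pow1 => //.
    by rewrite /aug_ideal aug_h /= sq_aug_pi /ms_const /= mcoeffX mnm1_eq0.
  by rewrite /aug_ideal rmorphB /= aug_alg aug_h /= sq_aug_pi subrr.
pose c : K := ms_const g; have g1 : ms_order 1 (g - c%:A : S).
  by apply/ms_order1P; rewrite /ms_const /= mcoeff1 eqxx mulr1 subrr.
have [u _ uE] := ms_order_decomp g1.
have hE (h : {lrmorphism A -> B}) : aug_morphism h ->
    h (sq_pi rels g) =
    c%:A + \sum_i h (sq_pi rels (ms_var K i)) * (ms_const (u i))%:A.
  move=> aug_h; rewrite -{1}(subrK c%:A g) uE addrC rmorphD rmorphD /= algE.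
  by rewrite rmorph_sum rmorph_sum; congr (_ + _); apply: eq_bigr => i _; apply: linE.
by rewrite !hE //; congr (_ + _); apply: eq_bigr => i _; rewrite eq_var.
Qed.

End QuotientMorphisms.

(** * Cochains, transport and opposites *)

Notation o1 := (@Ordinal 3 0 isT).
Notation o2 := (@Ordinal 3 1 isT).
Notation o3 := (@Ordinal 3 2 isT).

Lemma ord3_ind (P : 'I_3 -> Prop) : P o1 -> P o2 -> P o3 -> forall i, P i.
Proof.
move=> P1 P2 P3 [[|[|[|//]]] lti]; [move: P1|move: P2|move: P3];
  by congr P; apply: val_inj.
Qed.

Lemma sum3 (V : nmodType) (F : 'I_3 -> V) : \sum_i F i = F o1 + F o2 + F o3.
Proof.
rewrite !big_ord_recl big_ord0 addr0 addrA.
by congr (_ + _ + _); congr F; apply: val_inj.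
Qed.

Section CochainAlgebra.
Variable A : comNzRingType.
Implicit Types (d : cochain A) (x y z : 'rV[A]_3) (g h : 'M[A]_3).

Lemma cochainP d d' :
  (forall i j k, d (i, j) 0 k = d' (i, j) 0 k) -> d = d'.
Proof. by move=> dd'; apply/ffunP => -[i j]; apply/rowP => k; apply: dd'. Qed.

Lemma appE d x y k :
  app d x y 0 k = \sum_a \sum_b x 0 a * y 0 b * d (a, b) 0 k.
Proof.
rewrite summxE; apply: eq_bigr => a _; rewrite summxE; apply: eq_bigr => b _.
by rewrite mxE.
Qed.

Lemma app_linearl d y : linear (fun x => app d x y).
Proof.
move=> a u v; apply/rowP => k; rewrite !mxE !appE.
rewrite mulr_sumr -big_split; apply: eq_bigr => i _.
rewrite mulr_sumr -big_split; apply: eq_bigr => j _ /=; rewrite !mxE; ring.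
Qed.

Lemma app_linearr d x : linear (app d x).
Proof.
move=> a u v; apply/rowP => k; rewrite !mxE !appE.
rewrite mulr_sumr -big_split; apply: eq_bigr => i _.
rewrite mulr_sumr -big_split; apply: eq_bigr => j _ /=; rewrite !mxE; ring.
Qed.

HB.instance Definition _ d x :=
  GRing.isLinear.Build A 'rV[A]_3 'rV[A]_3 _ (app d x) (app_linearr d x).

Lemma app_suml d (F : 'I_3 -> A) (u : 'I_3 -> 'rV[A]_3) y :
  app d (\sum_i F i *: u i) y = \sum_i F i *: app d (u i) y.
Proof.
have Z a v : app d (a *: v) y = a *: app d v y.
  have app0 : app d 0 y = 0.
    by have := app_linearl d y (-1) 0 0; rewrite /= scaler0 addr0 scaleN1r addNr.
  by have := app_linearl d y a v 0; rewrite /= addr0 app0 addr0.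
have D u1 u2 : app d (u1 + u2) y = app d u1 y + app d u2 y.
  by have := app_linearl d y 1 u1 u2; rewrite /= !scale1r.
by rewrite !sum3 !D !Z.
Qed.

Lemma app_sumr d x (F : 'I_3 -> A) (u : 'I_3 -> 'rV[A]_3) :
  app d x (\sum_i F i *: u i) = \sum_i F i *: app d x (u i).
Proof. by rewrite linear_sum; apply: eq_bigr => i _; rewrite linearZ. Qed.

Lemma app_delta d i j : app d (delta_mx 0 i) (delta_mx 0 j) = d (i, j).
Proof.
apply/rowP => k; rewrite appE (bigD1 i) //= [X in _ + X]big1 ?addr0; last first.
  by move=> a /negbTE ai; rewrite big1 // => b _; rewrite mxE ai andbF !mul0r.
rewrite (bigD1 j) //= big1 ?addr0; last first.
  by move=> b /negbTE bj; rewrite [X in _ * X * _]mxE bj andbF mulr0 mul0r.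
by rewrite !mxE !eqxx !mul1r.
Qed.

Lemma has_parity_delta (i : 'I_3) : has_parity (parity i) (delta_mx 0 i : 'rV[A]_3).
Proof.
move=> j ij; rewrite mxE eqxx /=; have [ji|//] := eqVneq j i.
by rewrite ji eqxx in ij.
Qed.

Lemma has_parity_sum s (F : 'I_3 -> A) (u : 'I_3 -> 'rV[A]_3) :
  (forall i, F i = 0 \/ has_parity s (u i)) -> has_parity s (\sum_i F i *: u i).
Proof.
move=> Fu j js; rewrite summxE big1 // => i _; rewrite mxE.
by have [->|-> //] := Fu i; rewrite ?mul0r ?mulr0.
Qed.


Lemma odd_cochainP d : odd_cochain d <->
  forall i j, has_parity (~~ (parity i (+) parity j)) (d (i, j)).
Proof.
split=> [dodd i j|dodd s t x y xs yt k kst].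
  by rewrite -app_delta; apply: dodd; apply: has_parity_delta.
rewrite appE big1 // => a _; rewrite big1 // => b _.
have [as_|/xs ->] := eqVneq (parity a) s; last by rewrite !mul0r.
have [bt|/yt ->] := eqVneq (parity b) t; last by rewrite mulr0 mul0r.
by rewrite dodd ?mulr0 // as_ bt.
Qed.

Lemma even_mxP g : even_mx g <-> forall i, has_parity (parity i) (row i g).
Proof.
split=> [geven i|geven s x xs].
  by rewrite rowE; apply: geven; apply: has_parity_delta.
rewrite mulmx_sum_row; apply: has_parity_sum => i.
have [<-|/xs] := eqVneq (parity i) s; [by right; apply: geven | by left].
Qed.

Lemma codifferentialP d : codifferential d <-> odd_cochain d /\
  forall i j k l, \sum_m d (i, j) 0 m * d (m, k) 0 l +
    (-1) ^+ parity i * \sum_m d (j, k) 0 m * d (i, m) 0 l = 0.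
Proof.
have basisE i j k l : (app d (d (i, j)) (delta_mx 0 k) +
    (-1) ^+ parity i *: app d (delta_mx 0 i) (d (j, k))) 0 l =
    \sum_m d (i, j) 0 m * d (m, k) 0 l +
    (-1) ^+ parity i * \sum_m d (j, k) 0 m * d (i, m) 0 l.
  rewrite !mxE; congr (_ + _ * _).
    rewrite {1}[d (i, j)]row_sum_delta app_suml summxE.
    by apply: eq_bigr => m _; rewrite mxE app_delta.
  rewrite {1}[d (j, k)]row_sum_delta app_sumr summxE.
  by apply: eq_bigr => m _; rewrite mxE app_delta.
split=> -[dodd dd]; split=> //.
  move=> i j k l; have := dd _ _ _ _ _ _ (@has_parity_delta i) (@has_parity_delta j)
    (@has_parity_delta k).
  by rewrite !app_delta => /rowP/(_ l); rewrite basisE mxE.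
move=> s t u x y z xs yt zu.
(* This reduces one homogeneous argument to basis vectors of the same parity; it is applied to the
   three arguments in turn. *)
have step (v : bool) (T : 'rV[A]_3 -> 'rV[A]_3) w :
    (forall (F : 'I_3 -> A) (e : 'I_3 -> 'rV[A]_3),
      T (\sum_i F i *: e i) = \sum_i F i *: T (e i)) ->
    (forall i, parity i = v -> T (delta_mx 0 i) = 0) -> has_parity v w -> T w = 0.
  move=> Tsum T0 wv; rewrite [w]row_sum_delta Tsum big1 // => i _.
  by have [/T0 ->|/wv ->] := eqVneq (parity i) v; rewrite ?scaler0 ?scale0r.
apply: (step s (fun x => app d (app d x y) z + (-1) ^+ s *: app d x (app d y z))) xs.
  move=> F e; rewrite !app_suml scaler_sumr -big_split; apply: eq_bigr => i _ /=.
  by rewrite scalerDr !scalerA mulrC.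
move=> i <-.
apply: (step t (fun y => app d (app d _ y) z + _ *: app d _ (app d y z))) yt.
  move=> F e; rewrite app_sumr !app_suml app_sumr scaler_sumr -big_split.
  by apply: eq_bigr => j _ /=; rewrite scalerDr !scalerA mulrC.
move=> j _.
apply: (step u (fun z => app d (app d _ _) z + _ *: app d _ (app d _ z))) zu.
  move=> F e; rewrite !app_sumr scaler_sumr -big_split.
  by apply: eq_bigr => k _ /=; rewrite scalerDr !scalerA mulrC.
by move=> k _; apply/rowP => l; rewrite !app_delta basisE dd mxE.
Qed.

Lemma app_transport g h d x y :
  app (transport g h d) x y = app d (x *m g) (y *m g) *m h.
Proof.
rewrite (mulmx_sum_row x g) (mulmx_sum_row y g) app_suml mulmx_suml.
apply: eq_bigr => i _; rewrite app_sumr scaler_sumr mulmx_suml.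
by apply: eq_bigr => j _; rewrite ffunE /= scalerA -scalemxAl.
Qed.

Lemma transport_comp g h g' h' d :
  transport g h (transport g' h' d) = transport (g *m g') (h' *m h) d.
Proof.
by apply/ffunP => -[i j]; rewrite !ffunE /= app_transport -!row_mul mulmxA.
Qed.

Lemma transport1 d : transport 1%:M 1%:M d = d.
Proof. by apply/ffunP => -[i j]; rewrite !ffunE /= mulmx1 !row1 app_delta. Qed.

Lemma transport_unique g h d d' : g *m h = 1%:M ->
  (forall i j, d' (i, j) *m g = app d (row i g) (row j g)) -> d' = transport g h d.
Proof.
move=> gh dE; apply/ffunP => -[i j]; rewrite !ffunE /= -dE.
by rewrite -mulmxA gh mulmx1.
Qed.

(** A matrix that preserves parity commutes with the projector P onto the vectors of parity s, and
    hence so does its inverse. *)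
Lemma even_automorphism_inv g h : even_automorphism g h -> even_automorphism h g.
Proof.
case=> geven gh hg; split=> // s x xs.
pose P : 'M[A]_3 := diag_mx (\row_i (parity i == s)%:R).
have gP : g *m P = P *m g.
  apply/matrixP => i j; rewrite mul_mx_diag mul_diag_mx !mxE.
  have [ij|ij] := eqVneq (parity j) (parity i); first by rewrite ij mulrC.
  have /even_mxP/(_ i j ij) := geven; rewrite mxE => ->.
  by rewrite mulr0 mul0r.
have hP : h *m P = P *m h.
  by rewrite -[h *m P]mulmx1 -gh !mulmxA -(mulmxA h P g) -gP !mulmxA hg mul1mx.
have xE : x = x *m P.
  apply/rowP => i; rewrite mul_mx_diag !mxE; have [_|/xs ->] := eqVneq (parity i) s.
    by rewrite mulr1.
  by rewrite mul0r.
rewrite xE -mulmxA -hP mulmxA mul_mx_diag => i is_.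
by rewrite !mxE (negbTE is_) mulr0.
Qed.

Lemma even_automorphism_mul g h g' h' : even_automorphism g h ->
  even_automorphism g' h' -> even_automorphism (g *m g') (h' *m h).
Proof.
move=> [ge gh hg] [ge' gh' hg']; split.
- by move=> s x xs; rewrite mulmxA; apply/ge'/ge.
- by rewrite mulmxA -(mulmxA g) gh' mulmx1.
- by rewrite mulmxA -(mulmxA h') hg mulmx1.
Qed.

Lemma transportK g h : even_automorphism g h -> cancel (transport g h) (transport h g).
Proof. by case=> _ gh hg d; rewrite transport_comp hg transport1. Qed.

Lemma transport_odd g h d : even_automorphism g h -> odd_cochain d ->
  odd_cochain (transport g h d).
Proof.
move=> gh dodd s t x y xs yt; have [he _ _] := even_automorphism_inv gh.
by case: gh => ge _ _; rewrite app_transport; apply/he/dodd; apply: ge.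
Qed.

Lemma transport_codifferential g h d : even_automorphism g h ->
  codifferential d -> codifferential (transport g h d).
Proof.
move=> gh [dodd dd]; split=> [|s t u x y z xs yt zu]; first exact: transport_odd.
case: gh => ge gh hg; rewrite !app_transport -!mulmxA hg !mulmx1.
by rewrite scalemxAl -mulmxDl (dd s t u) ?mul0mx //; apply: ge.
Qed.

Lemma transportD g h d d' : transport g h (d + d') = transport g h d + transport g h d'.
Proof.
apply/ffunP => -[i j]; rewrite !ffunE /= -mulmxDl; congr (_ *m h).
apply/rowP => k; rewrite mxE !appE -big_split; apply: eq_bigr => a _.
by rewrite -big_split; apply: eq_bigr => b _ /=; rewrite ffunE [X in _ * X]mxE mulrDr.
Qed.

Lemma transportZ g h a d : transport g h (a *: d) = a *: transport g h d.
Proof.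
apply/ffunP => -[i j]; rewrite !ffunE /= scalemxAl; congr (_ *m h).
apply/rowP => k; rewrite mxE !appE mulr_sumr; apply: eq_bigr => u _.
by rewrite mulr_sumr; apply: eq_bigr => v _ /=; rewrite ffunE [X in _ * X]mxE; ring.
Qed.

Lemma oppositeD d d' : opposite (d + d') = opposite d + opposite d'.
Proof. by apply/ffunP => ij; rewrite !ffunE scalerDr. Qed.

Lemma oppositeZ a d : opposite (a *: d) = a *: opposite d.
Proof. by apply/ffunP => ij; rewrite !ffunE !scalerA mulrC. Qed.

Lemma oppositeK d : opposite (opposite d) = d.
Proof.
apply/ffunP => -[i j]; rewrite !ffunE /= scalerA andbC -expr2 sqrr_sign.
exact: scale1r.
Qed.

Lemma app_opposite d s t x y : has_parity s x -> has_parity t y ->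
  app (opposite d) x y = (-1) ^+ (s && t).+1 *: app d y x.
Proof.
move=> xs yt; apply/rowP => k; rewrite mxE !appE exchange_big mulr_sumr.
apply: eq_bigr => b _; rewrite mulr_sumr; apply: eq_bigr => a _.
have [<-|/xs ->] := eqVneq (parity a) s; last by rewrite mulr0 !mul0r mulr0.
have [<-|/yt ->] := eqVneq (parity b) t; last by rewrite mulr0 !mul0r mulr0.
by rewrite ffunE mxE /=; ring.
Qed.

Lemma opposite_odd d : odd_cochain d -> odd_cochain (opposite d).
Proof.
move=> dodd s t x y xs yt; rewrite (app_opposite d xs yt) addbC => k kst.
by rewrite mxE (dodd _ _ _ _ yt xs) ?mulr0.
Qed.

(** The identity of the opposite at (x, y, z) is, up to a sign, that of d at (z, y, x); the signs
    are checked for the eight choices of parities. *)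
Lemma opposite_codifferential d : codifferential d -> codifferential (opposite d).
Proof.
move=> [dodd dd]; split=> [|s t u x y z xs yt zu]; first exact: opposite_odd.
have oodd := opposite_odd dodd.
rewrite (app_opposite d (oodd _ _ _ _ xs yt) zu) (app_opposite d xs yt).
rewrite (app_opposite d xs (oodd _ _ _ _ yt zu)) (app_opposite d yt zu).
have Zl a v w : app d (a *: v) w = a *: app d v w.
  have := app_suml d (fun i => if i == o1 then a else 0) (fun=> v) w.
  by rewrite !sum3 /= !scale0r !addr0.
rewrite linearZ Zl /=; have := dd _ _ _ _ _ _ zu yt xs.
set X := app d (app d z y) x; set Y := app d z (app d y x) => XY.
have -> : X = - ((-1) ^+ u *: Y) by apply/eqP; rewrite -addr_eq0 XY.
by case: s t u {xs yt zu XY} => -[] [] /=;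
  rewrite ?(expr0, expr1, exprS, mulr1, mulrNN, scaleN1r, scale1r, scalerN, opprK, subrr, addNr).
Qed.

Lemma opposite_transport g h d : even_mx g ->
  opposite (transport g h d) = transport g h (opposite d).
Proof.
move=> /even_mxP ge; apply/ffunP => -[i j]; rewrite !ffunE /=.
by rewrite (app_opposite d (ge i) (ge j)) -scalemxAl.
Qed.

End CochainAlgebra.

Section MapCochain.
Variables (A B : comNzRingType) (f : {rmorphism A -> B}).

Lemma map_app d (x y : 'rV[A]_3) :
  map_mx f (app d x y) = app (map_cochain f d) (map_mx f x) (map_mx f y).
Proof.
apply/rowP => k; rewrite mxE !appE rmorph_sum; apply: eq_bigr => i _ /=.
rewrite rmorph_sum; apply: eq_bigr => j _ /=.
by rewrite !mxE ffunE mxE !rmorphM.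
Qed.

Lemma map_transport g h d :
  map_cochain f (transport g h d) =
  transport (map_mx f g) (map_mx f h) (map_cochain f d).
Proof.
by apply/ffunP => -[i j]; rewrite !ffunE /= map_mxM map_app !map_row.
Qed.

Lemma map_opposite d : map_cochain f (opposite d) = opposite (map_cochain f d).
Proof. by apply/ffunP => ij; rewrite !ffunE map_mxZ rmorph_sign. Qed.

Lemma map_cochainD d d' :
  map_cochain f (d + d') = map_cochain f d + map_cochain f d'.
Proof. by apply/ffunP => ij; rewrite !ffunE map_mxD. Qed.

Lemma map_even_automorphism g h :
  even_automorphism g h -> even_automorphism (map_mx f g) (map_mx f h).
Proof.
move=> [/even_mxP ge gh hg]; split; rewrite -?map_mxM ?gh ?hg ?map_mx1 //.
by apply/even_mxP => i k ki; have := ge i k ki; rewrite !mxE => ->; rewrite rmorph0.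
Qed.

Lemma map_odd_cochain d : odd_cochain d -> odd_cochain (map_cochain f d).
Proof.
move=> /odd_cochainP dodd; apply/odd_cochainP => i j k kij.
by rewrite ffunE mxE dodd ?rmorph0.
Qed.

End MapCochain.

(** * Deformations under conjugation and passage to the opposite *)

Section DeformationTransfer.
Variable K : fieldType.
Implicit Types (A B : augAlg K) (d : cochain K).

Lemma aug_in_alg A (m n : nat) (M : 'M[K]_(m, n)) :
  map_mx (aug A) (map_mx (in_alg A) M) = M.
Proof. by apply/matrixP => i j; rewrite !mxE /= aug_alg. Qed.

Lemma map_in_alg A B (f : {lrmorphism A -> B}) (m n : nat) (M : 'M[K]_(m, n)) :
  map_mx f (map_mx (in_alg A) M) = map_mx (in_alg B) M.
Proof. by apply/matrixP => i j; rewrite !mxE /= linearZ /= rmorph1. Qed.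

Lemma deformationP A d (dA : cochain A) : odd_cochain d ->
  deformation d dA <-> codifferential dA /\ map_cochain (aug A) dA = d.
Proof.
move=> dodd; have extE : map_cochain (aug A) (extend A d) = d.
  by apply/ffunP => ij; rewrite !ffunE aug_in_alg.
split=> [[cd [phi [_ phi0 dE]]]|[cd dE]]; split=> //.
  rewrite dE map_cochainD extE -[RHS]addr0; congr (_ + _).
  by apply: cochainP => i j k; rewrite !ffunE !mxE; apply: phi0.
exists (dA - extend A d); split; last by rewrite addrC subrK.
  have /odd_cochainP d1 : odd_cochain (extend A d) by apply: map_odd_cochain.
  have /odd_cochainP d2 := cd.1; apply/odd_cochainP => i j k kij.
  rewrite !ffunE !mxE (d2 i j k kij) add0r; have := d1 i j k kij.
  by rewrite ffunE mxE => ->; rewrite oppr0.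
move=> ij k; have /ffunP/(_ ij)/rowP/(_ k) := dE; rewrite ffunE mxE => kE.
by rewrite /aug_ideal !ffunE !mxE rmorphB /= kE aug_alg subrr.
Qed.

Lemma deformation_equivalentP A (dA dA' : cochain A) :
  deformation_equivalent dA dA' <->
  exists g h : 'M[A]_3, [/\ even_automorphism g h, map_mx (aug A) g = 1%:M
    & dA' = transport g h dA].
Proof.
have gP (g : 'M[A]_3) :
    (forall i j, aug_ideal ((g - 1%:M) i j)) <-> map_mx (aug A) g = 1%:M.
  split=> [g1|/matrixP g1 i j].
    apply/matrixP => i j; have := g1 i j; rewrite /aug_ideal !mxE rmorphB /=.
    by rewrite rmorph_nat => /eqP; rewrite subr_eq0 => /eqP.
  have := g1 i j; rewrite /aug_ideal !mxE rmorphB /= => ->.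
  by rewrite rmorph_nat subrr.
by split=> -[g [h [gh g1 ->]]]; exists g, h; split=> //; apply/gP.
Qed.

Lemma deformation_equivalent_sym A (dA dA' : cochain A) :
  deformation_equivalent dA dA' -> deformation_equivalent dA' dA.
Proof.
move=> /deformation_equivalentP[g [h [gh g1 ->]]].
apply/deformation_equivalentP; exists h, g; split.
- exact: even_automorphism_inv.
- case: gh => _ gh _; have := congr1 (map_mx (aug A)) gh.
  by rewrite map_mxM g1 mul1mx map_mx1.
- by rewrite transportK.
Qed.

Lemma deformation_equivalent_trans A (d1 d2 d3 : cochain A) :
  deformation_equivalent d1 d2 -> deformation_equivalent d2 d3 ->
  deformation_equivalent d1 d3.
Proof.
move=> /deformation_equivalentP[g [h [gh g1 ->]]].
move=> /deformation_equivalentP[g' [h' [gh' g1' ->]]].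
apply/deformation_equivalentP; exists (g' *m g), (h *m h'); split.
- exact: even_automorphism_mul.
- by rewrite map_mxM g1 g1' mulmx1.
- by rewrite transport_comp.
Qed.

(** T is a bijection between the deformations of d and those of d' over every base, natural in the
    base and compatible with equivalence. The universal property is transported along it. *)
Lemma miniversal_transfer (d d' : cochain K)
    (T T' : forall A, cochain A -> cochain A) :
  (forall A (dA : cochain A), deformation d dA -> deformation d' (T A dA)) ->
  (forall A (dA : cochain A), deformation d' dA -> deformation d (T' A dA)) ->
  (forall A, cancel (T A) (T' A)) -> (forall A, cancel (T' A) (T A)) ->
  (forall A (x y : cochain A),
     deformation_equivalent x y -> deformation_equivalent (T A x) (T A y)) ->
  (forall A (x y : cochain A),
     deformation_equivalent x y -> deformation_equivalent (T' A x) (T' A y)) ->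
  (forall A B (f : {lrmorphism A -> B}) x,
     map_cochain f (T A x) = T B (map_cochain f x)) ->
  forall A (dA : cochain A), miniversal d dA -> miniversal d' (T A dA).
Proof.
move=> defT defT' TK T'K eqT eqT' mapT A dA [[fA ddA vers] mini]; split.
  split=> [//||B dB fB ddB]; first exact: defT.
  have [f [augf fdA]] := vers B (T' B dB) fB (defT' _ _ ddB).
  by exists f; split=> //; rewrite mapT -(T'K B dB); apply: eqT.
move=> B dB fB iB ddB f f' augf augf'; rewrite !mapT => e e'.
apply: (mini B (T' B dB)) => //; first exact: defT'.
  by rewrite -(TK B (map_cochain f dA)); apply: eqT'.
by rewrite -(TK B (map_cochain f' dA)); apply: eqT'.
Qed.

(** The automorphism k may be nontrivial modulo the augmentation ideal, but the conjugate k g l of g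
    still reduces to the identity. *)
Lemma deformation_equivalent_conj A (k l : 'M[A]_3) (x y : cochain A) :
  even_automorphism k l -> deformation_equivalent x y ->
  deformation_equivalent (transport k l x) (transport k l y).
Proof.
move=> kl /deformation_equivalentP[g [h [gh g1 ->]]].
have lk := even_automorphism_inv kl.
apply/deformation_equivalentP; exists (k *m g *m l), (k *m h *m l); split.
- have := even_automorphism_mul (even_automorphism_mul kl gh) lk.
  by rewrite mulmxA.
- rewrite !map_mxM g1 mulmx1 -map_mxM; case: kl => _ -> _.
  by rewrite map_mx1.
rewrite !transport_comp; case: kl => _ kl lk'.
by rewrite -!mulmxA lk' mulmx1 (mulmxA l) lk' mul1mx.
Qed.

Lemma deformation_equivalent_opposite A (x y : cochain A) :
  deformation_equivalent x y -> deformation_equivalent (opposite x) (opposite y).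
Proof.
move=> /deformation_equivalentP[g [h [gh g1 ->]]].
apply/deformation_equivalentP; exists g, h; split=> //.
by rewrite opposite_transport //; case: gh.
Qed.

Lemma miniversal_opposite_transport (d : cochain K) (g h : 'M[K]_3) A dA :
  odd_cochain d -> even_automorphism g h -> @miniversal K d A dA ->
  miniversal (transport g h (opposite d))
    (transport (map_mx (in_alg A) g) (map_mx (in_alg A) h) (opposite dA)).
Proof.
move=> dodd gh; have hg := even_automorphism_inv gh.
have d'odd : odd_cochain (transport g h (opposite d)).
  exact/(transport_odd gh)/opposite_odd.
have ghB B := map_even_automorphism (in_alg B) gh.
have hgB B := map_even_automorphism (in_alg B) hg.
apply: (miniversal_transfer (d := d)
  (T := fun B x => transport (map_mx (in_alg B) g) (map_mx (in_alg B) h) (opposite x))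
  (T' := fun B x => opposite (transport (map_mx (in_alg B) h) (map_mx (in_alg B) g) x))).
- move=> B dB /(deformationP _ dodd)[cd dE]; apply/(deformationP _ d'odd); split.
    by apply: transport_codifferential => //; apply: opposite_codifferential.
  by rewrite map_transport map_opposite dE !aug_in_alg.
- move=> B dB /(deformationP _ d'odd)[cd dE]; apply/(deformationP _ dodd); split.
    by apply: opposite_codifferential; apply: transport_codifferential.
  rewrite map_opposite map_transport dE !aug_in_alg transportK //.
  exact: oppositeK.
- by move=> B x; rewrite transportK // oppositeK.
- by move=> B x; rewrite oppositeK transportK.
- move=> B x y xy; apply: deformation_equivalent_conj => //.
  exact: deformation_equivalent_opposite.
- move=> B x y xy; apply: deformation_equivalent_opposite.
  exact: deformation_equivalent_conj.
- by move=> B C f x; rewrite map_transport map_opposite !map_in_alg.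
Qed.

End DeformationTransfer.

(** * Normal forms of deformations of d_15 *)

Section LinearCombinations.
Variable A : comNzRingType.
Implicit Types x y k : A.

Lemma zl k x y : x = y -> k * (x - y) = 0.
Proof. by move=> ->; rewrite subrr mulr0. Qed.

Lemma za x y : x = 0 -> y = 0 -> x + y = 0.
Proof. by move=> -> ->; rewrite addr0. Qed.

(* To be used with a linear combination e of known equations, built with zl and
   za; the equation x - y = e is then a polynomial identity. *)
Lemma lincomb x y e : e = 0 -> x - y = e -> x = y.
Proof. by move=> -> /eqP; rewrite subr_eq0 => /eqP. Qed.

End LinearCombinations.

Section NormalForms.
Variable A : comNzRingType.

(** Natural number indices let coefficients given by pattern matching compute on concrete basis
    vectors. *)
Definition mkc (F : nat -> nat -> nat -> A) : cochain A :=
  [ffun ab : 'I_3 * 'I_3 => \row_(k < 3) F ab.1 ab.2 k].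

Lemma mkcE F (i j k : 'I_3) : mkc F (i, j) 0 k = F i j k.
Proof. by rewrite ffunE mxE. Qed.

(* The coefficients of psi^{3i}_j, psi^{i3}_j, psi^{ij}_3 (i, j = 1, 2) and
   psi^{33}_3 in an odd cochain. *)
Definition oc (l11 l12 l21 l22 r11 r12 r21 r22 b11 b12 b21 b22 c : A) :=
  mkc (fun i j k => match i, j, k return A with
  | 2%N, 0%N, 0%N => l11 | 2%N, 0%N, 1%N => l12 | 2%N, 1%N, 0%N => l21 | 2%N, 1%N, 1%N => l22
  | 0%N, 2%N, 0%N => r11 | 0%N, 2%N, 1%N => r12 | 1%N, 2%N, 0%N => r21 | 1%N, 2%N, 1%N => r22
  | 0%N, 0%N, 2%N => b11 | 0%N, 1%N, 2%N => b12 | 1%N, 0%N, 2%N => b21 | 1%N, 1%N, 2%N => b22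
  | 2%N, 2%N, 2%N => c | _, _, _ => 0
  end).

Lemma oc_odd l11 l12 l21 l22 r11 r12 r21 r22 b11 b12 b21 b22 c :
  odd_cochain (oc l11 l12 l21 l22 r11 r12 r21 r22 b11 b12 b21 b22 c).
Proof.
by apply/odd_cochainP; elim/ord3_ind; elim/ord3_ind; elim/ord3_ind => //;
  rewrite mkcE.
Qed.

Lemma odd_cochain_oc d : odd_cochain d ->
  d = oc (d (o3, o1) 0 o1) (d (o3, o1) 0 o2) (d (o3, o2) 0 o1) (d (o3, o2) 0 o2)
         (d (o1, o3) 0 o1) (d (o1, o3) 0 o2) (d (o2, o3) 0 o1) (d (o2, o3) 0 o2)
         (d (o1, o1) 0 o3) (d (o1, o2) 0 o3) (d (o2, o1) 0 o3) (d (o2, o2) 0 o3)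
         (d (o3, o3) 0 o3).
Proof.
move=> /odd_cochainP dodd; apply: cochainP.
by elim/ord3_ind; elim/ord3_ind; elim/ord3_ind; rewrite mkcE //= dodd.
Qed.

(* Here v_3 acts on v_1, v_2 by L = [[c, 0], [q, 0]] on the left and by
   R = [[r1, 0], [p, r2]] on the right. *)
Definition nf (c q p r1 r2 b : A) : cochain A :=
  oc c 0 q 0 r1 0 p r2 (c ^+ 2 * b) (- (c * b)) (- (c * b)) b c.

(** L^2 = c L holds by the shape of L. The first three equations are the entries of R^2 + c R = 0,
    the fourth is LR = RL, and the others are the conditions on B. The multipliers - c and c^2 below
    come from the entries of B. *)
Lemma nf_codifferential c q p r1 r2 b :
  r1 * (r1 + c) = 0 -> r2 * (r2 + c) = 0 -> p * (r1 + r2 + c) = 0 ->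
  q * r1 = p * c + q * r2 ->
  b * (c + r1) = 0 -> b * r2 = 0 -> b * p = b -> b * q = - b ->
  codifferential (nf c q p r1 r2 b).
Proof.
move=> e1 e2 e3 e4 b1 b2 b3 b4; apply/codifferentialP; split; first exact: oc_odd.
elim/ord3_ind; elim/ord3_ind; elim/ord3_ind; elim/ord3_ind;
  rewrite !sum3 !mkcE /=; first
  [ ring
  | by apply: (lincomb (zl 1 e1)); ring | by apply: (lincomb (zl 1 e2)); ring
  | by apply: (lincomb (zl 1 e3)); ring | by apply: (lincomb (zl 1 e4)); ring
  | by apply: (lincomb (zl 1 b2)); ring | by apply: (lincomb (zl (- c) b2)); ring
  | by apply: (lincomb (zl (- c) b3)); ring | by apply: (lincomb (zl (- c) b4)); ring
  | by apply: (lincomb (zl 1 b1)); ring | by apply: (lincomb (zl (- c) b1)); ring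
  | by apply: (lincomb (zl (c ^+ 2) b2)); ring
  | by apply: (lincomb (zl (c ^+ 2) b3)); ring
  | by apply: (lincomb (zl (c ^+ 2) b4)); ring
  | by apply: (lincomb (za (zl (- c) b4) (zl 1 b1))); ring
  | by apply: (lincomb (za (zl (c ^+ 2) b4) (zl (- c) b1))); ring
  | by apply: (lincomb (za (zl (c ^+ 2) b3) (zl (- c) b2))); ring
  | by apply: (lincomb (za (zl (- c) b4) (zl (- c) b3))); ring
  | by apply: (lincomb (za (zl 1 b4) (zl 1 b3))); ring
  | by apply: (lincomb (za (zl (- c) b3) (zl 1 b2))); ring
  | by apply: (lincomb (za (zl 1 b2) (za (zl (- c) b3) (zl (- c) b4)))); ring
  | by apply: (lincomb (zl (c ^+ 2) b1)); ring ].
Qed.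

End NormalForms.

(** * Reduction of an odd codifferential to the normal form *)

Section Normalization.
Variable A : comNzRingType.

Lemma unit_cancel (u x a b : A) : u * x = 1 -> x * a = x * b -> a = b.
Proof. by move=> ux ab; rewrite -[a]mul1r -[b]mul1r -ux -!mulrA ab. Qed.

(* Since v_2 and v_2 L form a basis, R commutes with the cyclic operator L and
   hence R = x + y L. *)
Lemma codifferential_cyclic l11 l12 l21 l22 r11 r12 r21 r22 b11 b12 b21 b22 c (u : A) :
  codifferential (oc l11 l12 l21 l22 r11 r12 r21 r22 b11 b12 b21 b22 c) ->
  u * l21 = 1 ->
  exists x y, [/\
    [/\ r21 = y * l21, r22 = x + y * l22, r11 = x + y * l11
      & r12 = y * (u * (l11 * l22))],
    c = l11 + l22 /\ l12 = u * (l11 * l22),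
    [/\ b12 = u * (l11 * b22), b21 = u * (l11 * b22)
      & b11 = u * (u * (l11 * l11 * b22))]
    & [/\ x * (x + c) = 0, y * (x + x + y * c + c) = 0, b22 * (1 + y) = 0
      & b22 * x = 0]].
Proof.
move=> /codifferentialP[_ cd] ul.
(* Evaluated at v_2, E1 and E2 say L^2 = c L, E3 and E4 say R^2 + c R = 0, E5 and E6 say LR = RL;
   this is enough because v_2 is cyclic. E1 and E2 give c as the trace of L and the vanishing of its
   determinant. E7 to E11 involve B. *)
have E1 := cd o3 o3 o2 o1; have E2 := cd o3 o3 o2 o2.
have E3 := cd o2 o3 o3 o1; have E4 := cd o2 o3 o3 o2.
have E5 := cd o3 o2 o3 o1; have E6 := cd o3 o2 o3 o2.
have E7 := cd o3 o2 o1 o3; have E8 := cd o3 o2 o2 o3; have E9 := cd o2 o3 o2 o3.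
have E10 := cd o2 o2 o2 o1; have E11 := cd o2 o2 o2 o2.
clear cd; rewrite !sum3 !mkcE /= in E1 E2 E3 E4 E5 E6 E7 E8 E9 E10 E11.
have [y r21E] : exists y, r21 = y * l21.
  by exists (u * r21); apply: (lincomb (zl (- r21) ul)); ring.
subst r21; have [x r22E] : exists x, r22 = x + y * l22.
  by exists (r22 - y * l22); rewrite subrK.
subst r22; exists x, y.
have cE : c = l11 + l22.
  by apply: (unit_cancel ul); apply: (lincomb (zl 1 E1)); ring.
subst c; have l12E : l21 * l12 = l11 * l22.
  by apply: (lincomb (zl (-1) E2)); ring.
have r11E : r11 = x + y * l11.
  by apply: (unit_cancel ul); apply: (lincomb (zl 1 E5)); ring.
subst r11; have r12E : r12 = y * l12.
  by apply: (unit_cancel ul); apply: (lincomb (zl 1 E6)); ring.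
subst r12.
have l12E' : l12 = u * (l11 * l22).
  by apply: (unit_cancel ul); apply: (lincomb (za (zl 1 l12E) (zl (- (l11 * l22)) ul))); ring.
have yE : y * (x + x + y * (l11 + l22) + (l11 + l22)) = 0.
  by apply: (unit_cancel ul); apply: (lincomb (zl 1 E3)); ring.
have xE : x * (x + (l11 + l22)) = 0.
  by apply: (lincomb (za (zl 1 E4) (za (zl (- l22) yE) (zl (- y ^+ 2) l12E)))); ring.
have bE : b22 * (1 + y) = 0.
  by apply: (unit_cancel ul); apply: (lincomb (zl 1 E10)); ring.
have bxE : b22 * x = 0.
  by apply: (lincomb (za (zl 1 E11) (zl (- l22) bE))); ring.
have b12E : l21 * b12 = l11 * b22.
  by apply: (lincomb (zl 1 E8)); ring.
have b21E : l21 * b21 = l11 * b22.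
  by apply: (lincomb (za (zl 1 E9) (za (zl (- y) b12E)
    (za (zl (- (l11 + l22)) bE) (zl (-1) bxE))))); ring.
have b11E : l21 * b11 = l11 * b21.
  by apply: (lincomb (zl 1 E7)); ring.
have invE a b : l21 * a = b -> a = u * b.
  by move=> <-; rewrite mulrA ul mul1r.
split; first by split; rewrite // -l12E'.
- by [].
- split; [exact: invE | exact: invE | rewrite (invE _ _ b11E) (invE _ _ b21E)].
  by ring.
- by [].
Qed.

Definition mx3 (F : nat -> nat -> A) : 'M[A]_3 := \matrix_(i < 3, j < 3) F i j.

Definition even_mx3 (g11 g12 g21 g22 g33 : A) := mx3 (fun i j =>
  match i, j return A with
  | 0%N, 0%N => g11 | 0%N, 1%N => g12 | 1%N, 0%N => g21 | 1%N, 1%N => g22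
  | 2%N, 2%N => g33 | _, _ => 0 end).

Lemma even_mx3_even (g11 g12 g21 g22 g33 : A) : even_mx (even_mx3 g11 g12 g21 g22 g33).
Proof. by apply/even_mxP; elim/ord3_ind; elim/ord3_ind => //; rewrite !mxE. Qed.

Lemma even_mx3_mul1 g11 g12 g21 g22 g33 h11 h12 h21 h22 (h33 : A) :
  g11 * h11 + g12 * h21 = 1 -> g11 * h12 + g12 * h22 = 0 ->
  g21 * h11 + g22 * h21 = 0 -> g21 * h12 + g22 * h22 = 1 -> g33 * h33 = 1 ->
  even_mx3 g11 g12 g21 g22 g33 *m even_mx3 h11 h12 h21 h22 h33 = 1%:M.
Proof.
move=> e11 e12 e21 e22 e33; apply/matrixP.
by elim/ord3_ind; elim/ord3_ind; rewrite !mxE sum3 !mxE /=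
  ?(e11, e12, e21, e22, e33, mulr0, mul0r, addr0, add0r).
Qed.

Lemma transport_mx3 g11 g12 g21 g22 g33 (h : 'M[A]_3) (d d' : cochain A) :
  let G := fun i j : 'I_3 => even_mx3 g11 g12 g21 g22 g33 i j in
  even_mx3 g11 g12 g21 g22 g33 *m h = 1%:M ->
  (forall i j k, \sum_a d' (i, j) 0 a * G a k =
    \sum_a \sum_b G i a * G j b * d (a, b) 0 k) ->
  d' = transport (even_mx3 g11 g12 g21 g22 g33) h d.
Proof.
move=> G gh dE; apply: transport_unique => // i j; apply/rowP => k.
rewrite mxE dE appE; apply: eq_bigr => a _; apply: eq_bigr => b _.
by rewrite /G ![row _ _ _ _]mxE.
Qed.

(** With s the inverse of q, the rows of g are the new basis v_2 L / q, v_2, v_3. The hypothesis on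
    b gives b s = - b, which turns the powers of s in B into the signs of [nf]. *)
Lemma normal_form_equivalent (l11 l21 l22 x y b u q s : A) :
  u * l21 = 1 -> s * q = 1 -> b * x = 0 -> b * q = - b ->
  let g := even_mx3 (s * l21) (s * l22) 0 1 1 in
  let h := even_mx3 (u * q) (- (u * l22)) 0 1 1 in
  even_automorphism g h /\
  nf (l11 + l22) q (y * q) (x + y * (l11 + l22)) x b =
  transport g h (oc l11 (u * (l11 * l22)) l21 l22
    (x + y * l11) (y * (u * (l11 * l22))) (y * l21) (x + y * l22)
    (u * (u * (l11 * l11 * b))) (u * (l11 * b)) (u * (l11 * b)) b (l11 + l22)).
Proof.
move=> ul sq bx bq g h.
have gh : g *m h = 1%:M.
  apply: even_mx3_mul1; try ring.
    by apply: (lincomb (za (zl (s * q) ul) (zl 1 sq))); ring.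
  by apply: (lincomb (zl (- s * l22) ul)); ring.
have hg : h *m g = 1%:M.
  apply: even_mx3_mul1; try ring.
    by apply: (lincomb (za (zl (s * q) ul) (zl 1 sq))); ring.
  by apply: (lincomb (zl (u * l22) sq)); ring.
split; first by split=> //; apply: even_mx3_even.
have bs : b * s = - b.
  by apply: (lincomb (za (zl s bq) (zl (- b) sq))); ring.
have bss : b * (s * s) = b.
  by apply: (lincomb (za (zl s bs) (zl (-1) bs))); ring.
have e11 := za (zl (- (l11 + l22) ^+ 2) bss)
  (zl (- (s ^+ 2 * b * l11 * (l11 + l22 + u * l21 * l11 + l22))) ul).
have e12 := za (zl (- (l11 + l22)) bs) (zl (- (s * b * l11)) ul).
apply: transport_mx3 => //.
elim/ord3_ind; elim/ord3_ind; elim/ord3_ind; rewrite !sum3 !mkcE !mxE /=; first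
  [ ring
  | by apply: (lincomb e11); ring | by apply: (lincomb e12); ring
  | by apply: (lincomb (zl (- (s * y * l11 * l22)) ul)); ring
  | by apply: (lincomb (zl (- (s * l11 * l22)) ul)); ring
  | by apply: (lincomb (zl (y * l21) sq)); ring
  | by apply: (lincomb (zl (y * l22) sq)); ring
  | by apply: (lincomb (zl l21 sq)); ring | by apply: (lincomb (zl l22 sq)); ring ].
Qed.

End Normalization.

(** * Equivalences over an infinitesimal base *)

Section FirstOrder.
Variables (K : fieldType) (B : augAlg K).
Hypothesis infB : infinitesimal B.
Implicit Types x y : B.

Lemma infinitesimal_mul0 x y : aug_ideal x -> aug_ideal y -> x * y = 0.
Proof.
move=> xI yI; apply: infB; apply: (@ideal_powM _ _ 1 1);
  by apply/(ideal_pow1 (aug_ideal_is_ideal B)).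
Qed.

(** Write g = 1 + e with e in the ideal. As c and b lie in the ideal too, their products with e
    vanish, while q and p are both multiplied by k = g22 g33 / g11. The entry r2 changes by a term
    in p g12, which vanishes when p is in the ideal. *)
Lemma nf_first_order (c q p r1 r2 b c' q' p' r1' r2' b' : B) :
  @aug_ideal K B c -> @aug_ideal K B r1 -> @aug_ideal K B r2 -> @aug_ideal K B b ->
  aug_ideal c' -> aug_ideal r2' -> aug_ideal b' ->
  deformation_equivalent (nf c q p r1 r2 b) (nf c' q' p' r1' r2' b') ->
  [/\ c' = c, b' = b & exists2 k, q' = k * q & p' = k * p /\
    (aug_ideal p -> r2' = r2)].
Proof.
move=> cI r1I r2I bI c'I r2'I b'I /deformation_equivalentP[g [h [gh g1 dE]]].
have eqE i j k : \sum_a nf c' q' p' r1' r2' b' (i, j) 0 a * g a k =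
    \sum_a \sum_b' g i a * g j b' * nf c q p r1 r2 b (a, b') 0 k.
  have /rowP/(_ k) : nf c' q' p' r1' r2' b' (i, j) *m g =
      app (nf c q p r1 r2 b) (row i g) (row j g).
    by case: gh => _ _ hg; rewrite dE ffunE /= -mulmxA hg mulmx1.
  rewrite mxE appE => ->; apply: eq_bigr => a _; apply: eq_bigr => e _.
  by rewrite ![row _ _ _ _]mxE.
have gz i j : parity j != parity i -> g i j = 0.
  by move=> ij; case: gh => /even_mxP/(_ i j ij); rewrite mxE.
have gI i j : @aug_ideal K B (g i j - (i == j)%:R).
  have /matrixP/(_ i j) := g1; rewrite !mxE => e.
  by rewrite /aug_ideal rmorphB /= e rmorph_nat subrr.
have E1 := eqE o3 o3 o3; have E2 := eqE o2 o2 o3; have E3 := eqE o2 o3 o1.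
have E4 := eqE o3 o2 o1; have E5 := eqE o2 o3 o2; clear eqE.
rewrite !sum3 !mkcE /= in E1 E2 E3 E4 E5.
have z13 : g o1 o3 = 0 by exact: gz. have z31 : g o3 o1 = 0 by exact: gz.
have z23 : g o2 o3 = 0 by exact: gz. have z32 : g o3 o2 = 0 by exact: gz.
have i11 := gI o1 o1; have i22 := gI o2 o2; have i33 := gI o3 o3.
have i12 := gI o1 o2; have i21 := gI o2 o1; clear gI gz.
rewrite z13 z23 z31 z32 ?eqxx /= in E1 E2 E3 E4 E5 i11 i22 i33 i12 i21.
rewrite !subr0 in i12 i21.
have [e11 g11E] : exists e, g o1 o1 = 1 + e by exists (g o1 o1 - 1); rewrite addrC subrK.
have [e22 g22E] : exists e, g o2 o2 = 1 + e by exists (g o2 o2 - 1); rewrite addrC subrK.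
have [e33 g33E] : exists e, g o3 o3 = 1 + e by exists (g o3 o3 - 1); rewrite addrC subrK.
rewrite g11E g22E g33E in E1 E2 E3 E4 E5 i11 i22 i33.
rewrite ![1 + _]addrC !addrK in i11 i22 i33.
have mm (x y : B) : aug_ideal x -> aug_ideal y -> x * y = 0 by exact: infinitesimal_mul0.
split.
- apply: (lincomb (za (zl 1 E1) (za (zl (-1) (mm _ _ c'I i33))
    (zl (2 + e33) (mm _ _ cI i33))))); ring.
- apply: (lincomb (za (zl 1 E2) (za (zl (-1) (mm _ _ b'I i33))
    (za (zl (2 + e22) (mm _ _ bI i22)) (zl (g o2 o1 * g o2 o1 * c
      - 2 * g o2 o1 * (1 + e22)) (mm _ _ cI bI)))))); ring.
(* Elements of the ideal have square zero, so 1 - e11 inverts g11 = 1 + e11. *)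
have inv11 : (1 - e11) * (1 + e11) = 1.
  by apply: (lincomb (zl (-1) (mm _ _ i11 i11))); ring.
exists ((1 - e11) * (1 + e22) * (1 + e33)).
  apply: (lincomb (za (zl (- q') inv11) (za (zl (1 - e11) E4)
    (zl ((1 - e11) * (1 + e33)) (mm _ _ i21 cI))))); ring.
split.
  apply: (lincomb (za (zl (- p') inv11) (za (zl (1 - e11) E3)
    (za (zl ((1 - e11) * (1 + e33)) (mm _ _ i21 r1I))
        (zl (- (1 - e11)) (mm _ _ r2'I i21)))))); ring.
move=> pI; have p'E : p' = (1 - e11) * (1 + e22) * (1 + e33) * p.
  apply: (lincomb (za (zl (- p') inv11) (za (zl (1 - e11) E3)
    (za (zl ((1 - e11) * (1 + e33)) (mm _ _ i21 r1I))
        (zl (- (1 - e11)) (mm _ _ r2'I i21)))))); ring.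
apply: (lincomb (za (zl 1 E5) (za (zl (- g o1 o2) p'E)
  (za (zl (- ((1 - e11) * (1 + e22) * (1 + e33))) (mm _ _ pI i12))
  (za (zl (-1) (mm _ _ r2'I i22)) (za (zl (1 + e33) (mm _ _ r2I i22))
    (zl 1 (mm _ _ r2I i33)))))))); ring.
Qed.

End FirstOrder.

Lemma d15_oc (K : fieldType) (p q : K) : d15 p q = oc 0 0 q 0 0 0 p 0 0 0 0 0 0.
Proof.
apply: cochainP; elim/ord3_ind; elim/ord3_ind; elim/ord3_ind;
  by rewrite mkcE /d15 !ffunE !mxE /= ?(mulr1, mulr0, addr0, add0r).
Qed.

(** * Deformations of d_15 over a complete base *)

Section D15Deformations.
Variables (K : fieldType) (p q : K) (B : augAlg K) (dB : cochain B).
Hypotheses (q0 : q != 0) (complB : adic_complete (@aug_ideal K B)).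
Hypothesis defB : deformation (d15 p q) dB.

(** The scale q' is left to the choice of the user, among the invertible lifts of q with b q' = - b.
    Modulo the ideal y is p / q, which decides whether y and 1 + y are units. *)
Lemma d15_normal_form : exists c x y b : B, [/\
  [/\ aug B c = 0, aug B x = 0, aug B b = 0 & aug B y * q = p],
  [/\ x * (x + c) = 0, y * (x + x + y * c + c) = 0, b * (1 + y) = 0 & b * x = 0]
  & forall q' s, s * q' = 1 -> b * q' = - b -> aug B q' = q ->
      deformation_equivalent (nf c q' (y * q') (x + y * c) x b) dB].
Proof.
have d15odd : odd_cochain (d15 p q) by rewrite d15_oc; apply: oc_odd.
have [cd dE] := (deformationP dB d15odd).1 defB.
have augE i j k : aug B (dB (i, j) 0 k) = d15 p q (i, j) 0 k.
  by rewrite -dE ffunE mxE.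
have A1 := augE o3 o1 o1; have A2 := augE o3 o2 o1; have A3 := augE o3 o2 o2.
have A4 := augE o2 o3 o1; have A5 := augE o2 o3 o2; have A6 := augE o2 o2 o3.
clear augE; rewrite d15_oc !mkcE /= in A1 A2 A3 A4 A5 A6.
have dBE := odd_cochain_oc cd.1; rewrite dBE in cd.
have [|u ul] := complete_invertible complB (x := dB (o3, o2) 0 o1).
  by rewrite A2.
have [x [y [[E1 E2 E3 E4] [E5 E6] [E7 E8 E9] [R1 R2 R3 R4]]]] :=
  codifferential_cyclic cd ul.
rewrite E1 E2 E3 E4 E5 E6 E7 E8 E9 in dBE.
rewrite E5 in R1 R2; rewrite E1 in A4; rewrite E2 in A5; clear cd E1 E2 E3 E4 E5 E6 E7 E8 E9.
move: (dB (o3, o1) 0 o1) (dB (o3, o2) 0 o1) (dB (o3, o2) 0 o2)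
  (dB (o2, o2) 0 o3) A1 A2 A3 A4 A5 A6 ul dBE R1 R2 R3 R4
  => l11 l21 l22 b A1 A2 A3 A4 A5 A6 ul dBE R1 R2 R3 R4.
exists (l11 + l22), x, y, b; split; last first.
- move=> q' s sq bq augq; apply: deformation_equivalent_sym.
  have [gh nfE] := normal_form_equivalent l11 l22 y ul sq R4 bq.
  rewrite dBE nfE; apply/deformation_equivalentP.
  set g := even_mx3 _ _ _ _ _ in gh *; set h := even_mx3 _ _ _ _ _ in gh *.
  exists g, h; split=> //; apply/matrixP.
  have augs : aug B s * q = 1 by rewrite -augq -rmorphM sq rmorph1.
  elim/ord3_ind; elim/ord3_ind; rewrite !mxE /= ?rmorph0 ?rmorph1 //.
    by rewrite rmorphM /= A2.
  by rewrite rmorphM /= A3 mulr0.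
- by [].
split=> //; first by rewrite rmorphD /= A1 A3 addr0.
  by move: A5; rewrite rmorphD rmorphM /= A3 mulr0 addr0.
by move: A4; rewrite rmorphM /= A2.
Qed.

(** The choice q' = p / y keeps the coefficient y q' of psi^{23}_1 equal to p. It is admissible when
    b p = b: if p + q is nonzero then 1 + y is a unit and b = 0, and otherwise p = 1. *)
Lemma d15_normal_form_p : (2%:R : K) != 0 -> p != 0 -> p = 1 \/ p + q != 0 ->
  exists c q' r1 r2 b : B, [/\
    [/\ aug B c = 0, aug B q' = q & aug B b = 0],
    [/\ 2%:R * q' * r1 = c * (p%:A - q'), 2%:R * q' * r2 = - (c * (p%:A + q')),
        c ^+ 2 * (p%:A + q') * (p%:A - q') = 0, b * q' = - b & b * p%:A = b],
    p + q != 0 -> b = 0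
    & deformation_equivalent (nf c q' p%:A r1 r2 b) dB].
Proof.
move=> K2 p0 pq; have [c [x [y [b [[cI xI bI yq] [R1 R2 R3 R4] equiv]]]]] := d15_normal_form.
have y0 : aug B y != 0.
  by apply: contra_neq p0 => y0; rewrite -yq y0 mul0r.
have [z zy] := complete_invertible complB y0.
have pp : p^-1%:A * p%:A = 1 :> B.
  by rewrite -scalerAl mul1r scalerA mulVf // scale1r.
have b0 : p + q != 0 -> b = 0.
  move=> pq0; have [|w wy] := complete_invertible complB (x := 1 + y).
    have : aug B (1 + y) * q != 0.
      by rewrite rmorphD rmorph1 /= mulrDl mul1r yq addrC.
    by apply: contra_neq => ->; rewrite mul0r.
  by rewrite -[b]mulr1 -wy (mulrC w) mulrA R3 mul0r.
have bp : b * p%:A = b.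
  by case: pq => [->|/b0 ->]; rewrite ?mul0r // scale1r mulr1.
have bz : b * z = - b.
  by apply: (lincomb (za (zl z R3) (zl (- b) zy))); ring.
(* As y is a unit it can be cancelled; this is x = - c (1 + y) / 2 without the division. *)
have x2 : x + x + y * c + c = 0.
  by rewrite -[LHS]mul1r -zy -mulrA R2 mulr0.
have yz : y * (p%:A * z) = p%:A by apply: (lincomb (zl p%:A zy)); ring.
have augq' : aug B (p%:A * z) = q.
  apply: (mulIf y0); have -> : q * aug B y = p by rewrite mulrC.
  by rewrite -[RHS](aug_alg B) -rmorphM -mulrA zy mulr1.
exists c, (p%:A * z), (x + y * c), x, b; split=> //.
- set P := p%:A; have e := zl (P * z) x2; split=> //.
  + by apply: (lincomb (za e (zl c yz))); rewrite /P; ring.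
  + by apply: (lincomb (za e (zl (- c) yz))); rewrite /P; ring.
  + have e1 : 2%:R * (P * z) * x = - (c * (P + P * z)).
      by apply: (lincomb (za e (zl (- c) yz))); rewrite /P; ring.
    (* The relation is x (x + c) = 0 multiplied by (2 q')^2, after 2 q' x has been replaced by its
       value e1. *)
    apply: (lincomb (za (zl (4%:R * (P * z) ^+ 2) R1)
      (zl (- (2%:R * (P * z) * x + c * (P * z) - c * P)) e1))).
    by ring.
  + by rewrite mulrA bp.
have := equiv (p%:A * z) (p^-1%:A * y); rewrite yz; apply.
- by rewrite mulrACA pp mul1r mulrC.
- by rewrite mulrA bp.
- exact: augq'.
Qed.

End D15Deformations.

Lemma d15_normal_form_01 (K : fieldType) (B : augAlg K) (dB : cochain B) :
  adic_complete (@aug_ideal K B) -> deformation (d15 0 1) dB ->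
  exists t1 t2 t3 : B, [/\
    [/\ aug B t1 = 0, aug B t2 = 0 & aug B t3 = 0],
    t3 * (t1 + t3) = 0, t2 * (t1 + 2%:R * t3 + t1 * t2) = 0
    & deformation_equivalent (nf t1 1 t2 (t3 + t1 * t2) t3 0) dB].
Proof.
move=> complB defB.
have [c [x [y [b [[cI xI bI yq] [R1 R2 R3 R4] equiv]]]]] :=
  d15_normal_form (oner_neq0 K) complB defB.
rewrite mulr1 in yq.
have [|w wy] := complete_invertible complB (x := 1 + y).
  by rewrite rmorphD rmorph1 /= yq addr0 oner_neq0.
have b0 : b = 0 by rewrite -[b]mulr1 -wy (mulrC w) mulrA R3 mul0r.
exists c, y, x; split=> //; first by rewrite addrC.
  by rewrite -[RHS]R2; ring.
have := equiv 1 1; rewrite b0 !mulr1 oppr0 rmorph1 (mulrC c).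
exact.
Qed.

(** * Miniversal families *)

Section MiniversalCriterion.
Variables (n : nat) (K : fieldType).
Local Notation S := (mseries n K).

Definition aug_compatible (B : augAlg K) (e : {lrmorphism S -> B}) : Prop :=
  forall f, aug B (e f) = ms_const f.

Definition kills (B : augAlg K) (e : {lrmorphism S -> B})
    (rels : seq (GRing.term K)) : Prop :=
  forall r : S, r \in [seq expand n t | t <- rels] -> e r = 0.

(** K[[t]] is treated as the quotient by the empty list of relations, where [complete_invertible]
    applies. *)
Lemma mseries_invertible (f : S) : ms_const f != 0 -> f \is a GRing.unit.
Proof.
move=> f0; have [|y yf] := complete_invertible (series_base_complete [::])
    (x := sq_pi [::] f : series_base [::]).
  by rewrite /= sq_aug_pi.
have [g gE] := sq_pi_surj y; apply/unitrPr; exists g.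
have : sq_pi [::] (f * g) = sq_pi [::] 1 by rewrite rmorphM /= -gE mulrC yf rmorph1.
case/sq_piP/rel_idealP => _ [c]; rewrite big_ord0 => /eqP.
by rewrite subr_eq0 => /eqP.
Qed.

Lemma ms_const_expand (t : GRing.term K) :
  regular t -> ms_const (expand n t) = GRing.eval [::] t :> K.
Proof.
have [C CE] : exists C : S -> K, forall f, ms_const f = C f by exists (@ms_const n K).
have constD f g : C (f + g) = C f + C g by rewrite -!CE.
have constN f : C (- f) = - C f by rewrite -!CE.
have constM f g : C (f * g) = C f * C g by rewrite -!CE rmorphM.
have constA (c : K) : C c%:A = c by rewrite -CE /ms_const /= mcoeff1 eqxx mulr1.
have constMn f k : C (f *+ k) = C f *+ k by rewrite -!CE raddfMn.
have const1 : C 1 = 1 by rewrite -(scale1r 1) constA.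
have constX f k : C (f ^+ k) = C f ^+ k by rewrite -!CE rmorphXn.
rewrite CE /expand.
elim: t => [i|c|k|t IHt u IHu|t IHt|t IHt k|t IHt u IHu|t IHt|t IHt k] /=.
- move=> _; rewrite nth_nil.
  (* A variable beyond the n parameters takes the default value 0, and the parameters have no
     constant term, so both agree with the evaluation at the origin. *)
  have [lti|gei] := ltnP i n; last first.
    by rewrite nth_default -?CE // size_map size_enum_ord.
  rewrite (nth_map (Ordinal lti)) ?size_enum_ord // -CE.
  by rewrite /ms_const /= mcoeffX mnm1_eq0.
- by rewrite constA.
- by rewrite constMn const1.
- by case/andP=> /IHt <- /IHu <-.
- by move=> /IHt <-.
- by move=> /IHt <-.
- by case/andP=> /IHt <- /IHu <-.
- case/andP=> /IHt tE t0; rewrite -tE in t0 *.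
  have tU := @mseries_invertible (GRing.eval (parameters K n) (map_term (in_alg S) t)).
  by apply: (mulIf t0); rewrite -constM mulVr ?tU ?CE // const1 mulVf.
- by move=> /IHt <-.
Qed.

Section Values.
Variables (B : augAlg K) (e : {lrmorphism S -> B}).

Lemma eval_const c : e (expand n c%:T) = c%:A.
Proof. by rewrite /expand /= linearZ rmorph1. Qed.

Lemma eval_nat k : e (expand n (GRing.NatConst K k)) = k%:R.
Proof. by rewrite /expand /= rmorph_nat. Qed.

Lemma eval_var (i : 'I_n) : e (expand n (GRing.Var K i)) = e (ms_var K i).
Proof.
by rewrite /expand /= (nth_map i) ?size_enum_ord // nth_ord_enum.
Qed.

Lemma eval_add t u : e (expand n (t + u)) = e (expand n t) + e (expand n u).
Proof. exact: rmorphD. Qed.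

Lemma eval_opp t : e (expand n (- t)%T) = - e (expand n t).
Proof. exact: rmorphN. Qed.

Lemma eval_mul t u : e (expand n (t * u)%T) = e (expand n t) * e (expand n u).
Proof. exact: rmorphM. Qed.

Lemma eval_exp t k : e (expand n (t ^+ k)%T) = e (expand n t) ^+ k.
Proof. exact: rmorphXn. Qed.

Definition evalE := (eval_add, eval_opp, eval_mul, eval_exp, eval_const, eval_nat).

(** The base B carries no inverse operation, so the image of an inverted series is handled through
    this equation. *)
Lemma eval_inv (t : GRing.term K) : regular t -> GRing.eval [::] t != 0 ->
  e (expand n (t^-1)%T) * e (expand n t) = 1.
Proof.
move=> rt t0; rewrite -rmorphM -[RHS](rmorph1 e); congr (e _).
by apply: mulVr; apply: mseries_invertible; rewrite ms_const_expand.
Qed.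

Lemma map_family (F : rat_family K) :
  map_cochain e (family_in (expand n) F) =
  \sum_(x <- F) e (expand n x.1) *: psi x.2.1.1 x.2.1.2 x.2.2.
Proof.
rewrite /family_in; elim: F => [|x F IHF]; rewrite ?big_nil ?big_cons.
  by apply/ffunP => ij; rewrite !ffunE map_mx0.
rewrite map_cochainD IHF; congr (_ + _); apply: cochainP => i j k.
by rewrite !ffunE !mxE rmorphM /= rmorph_nat.
Qed.

End Values.

(** Morphisms out of the presented base are morphisms out of K[[t]] that kill the relations, so
    everything can be checked without the quotient. For versality only the values b of the
    parameters have to be found: [series_eval_exists] supplies the morphism. *)
Lemma miniversal_criterion (rels : seq (GRing.term K)) (F : rat_family K)
    (d : cochain K) :
  all (@regular K) rels -> solution rels [::] -> odd_cochain d ->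
  (forall (B : augAlg K) (e : {lrmorphism S -> B}),
     adic_complete (@aug_ideal K B) -> aug_compatible e -> kills e rels ->
     let dB := map_cochain e (family_in (expand n) F) in
     codifferential dB /\ map_cochain (aug B) dB = d) ->
  (forall (B : augAlg K) (dB : cochain B),
     adic_complete (@aug_ideal K B) -> deformation d dB ->
     exists2 b : 'I_n -> B, forall i, aug_ideal (b i) &
     forall e : {lrmorphism S -> B}, aug_compatible e ->
       (forall i, e (ms_var K i) = b i) ->
       kills e rels /\
       deformation_equivalent (map_cochain e (family_in (expand n) F)) dB) ->
  (forall (B : augAlg K) (e e' : {lrmorphism S -> B}),
     adic_complete (@aug_ideal K B) -> infinitesimal B ->
     aug_compatible e -> aug_compatible e' -> kills e rels -> kills e' rels ->
     deformation_equivalent (map_cochain e (family_in (expand n) F))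
       (map_cochain e' (family_in (expand n) F)) ->
     forall i, e (ms_var K i) = e' (ms_var K i)) ->
  miniversal d (family_over n rels F).
Proof.
move=> reg_rels sol_rels dodd C0 C1 C2; set srels := [seq expand n r | r <- rels].
(* Membership in [rel_ideal] includes a zero constant term, which follows from the vanishing of the
   relations at the origin. *)
have srels0 r : r \in srels -> sq_pi srels r = 0.
  move=> rr; rewrite -(rmorph0 (sq_pi srels)); apply/sq_piP/rel_idealP; rewrite subr0.
  split.
    move: reg_rels sol_rels rr; rewrite /srels.
    elim: (rels) => //= t s IHs /andP[rt rs] /andP[/eqP t0 s0].
    by rewrite inE => /orP[/eqP ->|/(IHs rs s0)]; rewrite // ms_const_expand.
  exists (fun i => (i == index r srels)%:R); rewrite -index_mem in rr.
  rewrite (bigD1 (Ordinal rr)) //= eqxx mul1r nth_index -?index_mem // big1 ?addr0 //.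
  by move=> i ir; rewrite (negbTE (ir : (i : nat) != _)) mul0r.
pose A : augAlg K := presented_base n rels.
have scalE c g : sq_pi srels (c *: g) = c *: (sq_pi srels g : A).
  rewrite -[RHS]/(sq_pi srels c%:A * sq_pi srels g) -rmorphM.
  by rewrite -scalerAl mul1r.
have lift (B : augAlg K) (f : {lrmorphism A -> B}) : aug_morphism f ->
    exists e : {lrmorphism S -> B}, [/\ aug_compatible e, kills e rels
      & forall g, e g = f (sq_pi srels g)].
  move=> augf; have [||e eE] := @lrmorphism_of K S B (fun g => f (sq_pi srels g)).
  - by split=> [c g|g h]; rewrite ?scalE ?linearZ // !rmorphD.
  - by split=> [|g h]; rewrite ?rmorph1 // !rmorphM.
  exists e; split=> // [g|r rr]; first by rewrite eE augf /= sq_aug_pi.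
  by rewrite eE srels0 // rmorph0.
have mapE (B : augAlg K) (f : {lrmorphism A -> B}) (e : {lrmorphism S -> B}) :
    (forall g, e g = f (sq_pi srels g)) ->
    map_cochain f (family_over n rels F) = map_cochain e (family_in (expand n) F).
  by move=> eE; apply: cochainP => i j k; rewrite !ffunE !mxE eE.
have complA : adic_complete (@aug_ideal K A) by apply: series_base_complete.
have [//|eA [augA killA eAE]] := lift A (idfun : {lrmorphism A -> A}).
have famA : family_over n rels F = map_cochain eA (family_in (expand n) F).
  by apply: cochainP => i j k; rewrite !ffunE !mxE eAE.
split; first split.
- exact: series_base_formal.
- by rewrite famA; apply/deformationP => //; apply: C0.
- move=> B dB [_ complB] defB; have [b b0 bP] := C1 B dB complB defB.
  have [e [eb auge]] := series_eval_exists complB b0.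
  have [kille equiv] := bP e auge eb.
  have [f [augf fE]] := series_base_lift auge kille.
  have efE g : e g = f (sq_pi srels g) by rewrite fE.
  by exists f; split=> //; rewrite (mapE B f e efE).
move=> B dB [_ complB] infB defB f f' augf augf'.
have [e [auge kille eE]] := lift B f augf.
have [e' [auge' kille' eE']] := lift B f' augf'.
rewrite (mapE B f e) // (mapE B f' e') // => equiv equiv'.
apply: infinitesimal_morphism_eq => // i; rewrite -eE -eE'.
apply: (C2 B) => //; apply: deformation_equivalent_trans equiv _.
exact: deformation_equivalent_sym.
Qed.

End MiniversalCriterion.

Lemma map_nf (A B : comNzRingType) (f : {rmorphism A -> B}) c q p r1 r2 b :
  map_cochain f (nf c q p r1 r2 b) = nf (f c) (f q) (f p) (f r1) (f r2) (f b).
Proof.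
apply: cochainP; elim/ord3_ind; elim/ord3_ind; elim/ord3_ind;
  by rewrite ffunE mxE !mkcE /= ?rmorph0 ?rmorphN ?rmorphM.
Qed.

(** * The points (p:q) with p and q nonzero *)

Section CyclicFamilies.
Variables (K : fieldType) (p q : K).
Hypotheses (K2 : (2%:R : K) != 0) (p0 : p != 0) (q0 : q != 0).

(** Division-free form of r1 = c (p - q') / (2 q') and r2 = - c (p + q') / (2 q'), followed by the
    relations on c, q' and b. Since 2 q' is invertible, r1 and r2 are determined. *)
Definition nf_relations (B : augAlg K) (c q' r1 r2 b : B) : Prop :=
  [/\ 2%:R * q' * r1 = c * (p%:A - q'), 2%:R * q' * r2 = - (c * (p%:A + q')),
      c ^+ 2 * (p%:A + q') * (p%:A - q') = 0, b * q' = - b & b * p%:A = b].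

Section OverBase.
Variable B : augAlg K.
Hypothesis complB : adic_complete (@aug_ideal K B).

Lemma twice_invertible (q' : B) : aug B q' = q -> exists v, v * (2%:R * q') = 1.
Proof.
move=> augq; apply: complete_invertible => //.
by rewrite rmorphM rmorph_nat /= augq mulf_neq0.
Qed.

Lemma nf_relations_codifferential (c q' r1 r2 b : B) : aug B q' = q ->
  nf_relations c q' r1 r2 b -> codifferential (nf c q' p%:A r1 r2 b).
Proof.
move=> augq [e1 e2 e3 e4 e5]; have [v v1] := twice_invertible augq.
set P := p%:A in e1 e2 e3 e5 *.
have v2 : v * q' * 2%:R = 1 by rewrite -[RHS]v1; ring.
apply: nf_codifferential => //.
(* By the first equation 2 q' (r1 + c) = c (p + q'), so (2 q')^2 r1 (r1 + c) is the third relation;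
   the factor 2 q' is then cancelled twice. The case of r2 is similar. *)
- apply: (unit_cancel v1); apply: (unit_cancel v1).
  apply: (lincomb (za (zl 1 e3) (zl (2%:R * q' * r1 + 2%:R * q' * c + c * (P - q')) e1))).
  by ring.
- apply: (unit_cancel v1); apply: (unit_cancel v1).
  apply: (lincomb (za (zl 1 e3) (zl (2%:R * q' * r2 + 2%:R * q' * c - c * (P + q')) e2))).
  by ring.
- by apply: (unit_cancel v1); apply: (lincomb (za (zl P e1) (zl P e2))); ring.
- by apply: (unit_cancel v2); apply: (lincomb (za (zl 1 e1) (zl (-1) e2))); ring.
- apply: (unit_cancel v1); apply: (lincomb (za (zl b e1)
    (za (zl c e4) (zl c e5)))); ring.
- by apply: (unit_cancel v1); apply: (lincomb (za (zl b e2)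
    (za (zl (- c) e4) (zl (- c) e5)))); ring.
Qed.

Lemma nf_relations_aug (c q' r1 r2 b : B) : aug B c = 0 -> aug B q' = q ->
  nf_relations c q' r1 r2 b -> aug B r1 = 0 /\ aug B r2 = 0.
Proof.
move=> augc augq [/(congr1 (aug B)) e1 /(congr1 (aug B)) e2 _ _ _].
have q2 : 2%:R * q != 0 by rewrite mulf_neq0.
split; apply: (mulfI q2); rewrite mulr0 -{1}augq.
  by move: e1; rewrite !rmorphM rmorph_nat /= augc mul0r.
by move: e2; rewrite rmorphN !rmorphM rmorph_nat /= augc mul0r oppr0.
Qed.

Lemma nf_relations_unique (c q' r1 r2 s1 s2 b : B) : aug B q' = q ->
  nf_relations c q' r1 r2 b -> nf_relations c q' s1 s2 b -> r1 = s1 /\ r2 = s2.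
Proof.
move=> augq [e1 e2 _ _ _] [f1 f2 _ _ _]; have [v v1] := twice_invertible augq.
by split; apply: (unit_cancel v1); rewrite ?e1 ?f1 ?e2 ?f2.
Qed.

Lemma nf_relations_first_order (c q' r1 r2 b c' q'' r1' r2' b' : B) :
  infinitesimal B -> aug B c = 0 -> aug B q' = q -> aug B b = 0 ->
  aug B c' = 0 -> aug B q'' = q -> aug B b' = 0 ->
  nf_relations c q' r1 r2 b -> nf_relations c' q'' r1' r2' b' ->
  deformation_equivalent (nf c q' p%:A r1 r2 b) (nf c' q'' p%:A r1' r2' b') ->
  [/\ c' = c, q'' = q' & b' = b].
Proof.
move=> infB cI augq bI c'I augq' b'I rel rel' equiv.
have [r1I r2I] := nf_relations_aug cI augq rel.
have [r1I' r2I'] := nf_relations_aug c'I augq' rel'.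
have [-> -> [k qE [pE _]]] := nf_first_order infB cI r1I r2I bI c'I r2I' b'I equiv.
(* Both normal forms have the same invertible coefficient p, so the common scaling factor k is 1. *)
split=> //; rewrite qE; suff -> : k = 1 by rewrite mul1r.
have pp : p^-1%:A * p%:A = 1 :> B.
  by rewrite -scalerAl mul1r scalerA mulVf // scale1r.
by rewrite -[k]mulr1 -pp mulrCA -pE.
Qed.

End OverBase.

(** Common part of (a), (d) and (e): the parameter i1 is c, the parameter i2 is q' - q, and the
    series b is 0 except at (1:-1), where it is t_3. The hypotheses say that the family is the
    normal form, that its relations are equivalent to [nf_relations], and that c, q' - q and b can
    be prescribed and determine the parameters. *)
Lemma miniversal_cyclic (n : nat) (rels : seq (GRing.term K)) (F : rat_family K)
    (i1 i2 : 'I_n) (b : mseries n K) :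
  p = 1 \/ p + q != 0 -> all (@regular K) rels -> solution rels [::] ->
  ms_const b = 0 ->
  (forall (B : augAlg K) (e : {lrmorphism mseries n K -> B}),
     adic_complete (@aug_ideal K B) -> kills e rels ->
     exists r1 r2, nf_relations (e (ms_var K i1)) (q%:A + e (ms_var K i2)) r1 r2 (e b)
       /\ map_cochain e (family_in (expand n) F) =
          nf (e (ms_var K i1)) (q%:A + e (ms_var K i2)) p%:A r1 r2 (e b)) ->
  (forall (B : augAlg K) (e : {lrmorphism mseries n K -> B}) r1 r2,
     nf_relations (e (ms_var K i1)) (q%:A + e (ms_var K i2)) r1 r2 (e b) ->
     kills e rels) ->
  (forall (B : augAlg K) (x y z : B), aug_ideal x -> aug_ideal y -> aug_ideal z ->
     (p + q != 0 -> z = 0) ->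
     exists2 a : 'I_n -> B, forall i, aug_ideal (a i) &
       forall e : {lrmorphism mseries n K -> B}, (forall i, e (ms_var K i) = a i) ->
         [/\ e (ms_var K i1) = x, e (ms_var K i2) = y & e b = z]) ->
  (forall (B : augAlg K) (e e' : {lrmorphism mseries n K -> B}),
     e (ms_var K i1) = e' (ms_var K i1) -> e (ms_var K i2) = e' (ms_var K i2) ->
     e b = e' b -> forall i, e (ms_var K i) = e' (ms_var K i)) ->
  miniversal (d15 p q) (family_over n rels F).
Proof.
move=> pq reg_rels sol_rels b0 famE killE paramE varE.
have varI (B : augAlg K) (e : {lrmorphism mseries n K -> B}) i :
    aug_compatible e -> aug B (e (ms_var K i)) = 0.
  by move=> ->; rewrite /ms_const /= mcoeffX mnm1_eq0.
have qI (B : augAlg K) (e : {lrmorphism mseries n K -> B}) i :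
    aug_compatible e -> aug B (q%:A + e (ms_var K i)) = q.
  by move=> auge; rewrite rmorphD /= aug_alg varI // addr0.
apply: miniversal_criterion => //.
- by rewrite d15_oc; apply: oc_odd.
- move=> B e complB auge kille /=.
  have [r1 [r2 [rel ->]]] := famE B e complB kille; split.
    by apply: nf_relations_codifferential rel => //; apply: qI.
  have [r1I r2I] := nf_relations_aug (varI _ _ _ auge) (qI _ _ _ auge) rel.
  rewrite map_nf /= varI // qI // auge b0 r1I r2I aug_alg d15_oc /nf.
  by rewrite !mulr0 oppr0.
- move=> B dB complB defB.
  have [c [q' [r1 [r2 [z [[cI qI' zI] rel z0 equiv]]]]]] :=
    d15_normal_form_p q0 complB defB K2 p0 pq.
  have yI : aug B (q' - q%:A) = 0 by rewrite rmorphB /= aug_alg qI' subrr.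
  have [a aI aP] := paramE B c (q' - q%:A) z cI yI zI z0.
  exists a => // e auge ea; have [e1 e2 eb] := aP e ea.
  have q'E : q%:A + e (ms_var K i2) = q' by rewrite e2 addrC subrK.
  have kille : kills e rels by apply: (killE B e r1 r2); rewrite q'E e1 eb.
  split=> //; have [s1 [s2 []]] := famE B e complB kille.
  rewrite q'E e1 eb => rel' ->.
  by have [<- <-] := nf_relations_unique complB qI' rel rel'.
- move=> B e e' complB infB auge auge' kille kille'.
  have [r1 [r2 [rel ->]]] := famE B e complB kille.
  have [s1 [s2 [rel' ->]]] := famE B e' complB kille'.
  move=> /(nf_relations_first_order infB) [||||||||c2 q2 b2] //;
    try exact: varI; try exact: qI; try by rewrite ?auge ?auge' b0.
  by apply: varE => //; apply: (addrI q%:A).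
Qed.

End CyclicFamilies.

Section PsiSums.
Variable A : comNzRingType.
Implicit Types (x : A) (d : cochain A).

Lemma psiE i j k (a b c : 'I_3) :
  (psi i j k : cochain A) (a, b) 0 c = [&& a.+1 == i, b.+1 == j & c.+1 == k]%:R.
Proof. by rewrite ffunE mxE. Qed.

Lemma cochainDE d d' a b c : (d + d') (a, b) 0 c = d (a, b) 0 c + d' (a, b) 0 c.
Proof. by rewrite ffunE mxE. Qed.

Lemma cochainNE d a b c : (- d) (a, b) 0 c = - d (a, b) 0 c.
Proof. by rewrite ffunE mxE. Qed.

Lemma cochainZE x d a b c : (x *: d) (a, b) 0 c = x * d (a, b) 0 c.
Proof. by rewrite ffunE mxE. Qed.

Lemma cochain_scaleDE x d d' a b c :
  (x *: d + d') (a, b) 0 c = x * d (a, b) 0 c + d' (a, b) 0 c.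
Proof. by rewrite cochainDE cochainZE. Qed.

Lemma cochain0E a b c : (0 : cochain A) (a, b) 0 c = 0.
Proof. by rewrite !ffunE mxE. Qed.

Definition cochainE := (cochainDE, cochainNE, cochainZE, cochain0E, psiE).

Lemma psi_sum_generic (l11 l12 l21 r11 r12 p r22 c : A) :
  p *: psi 2 3 1 + (l21 *: psi 3 2 1 + (l11 *: psi 3 1 1 + (c *: psi 3 3 3 +
    (r11 *: psi 1 3 1 + (r22 *: psi 2 3 2 + (r12 *: psi 1 3 2 +
    (l12 *: psi 3 1 2 + 0))))))) = oc l11 l12 l21 0 r11 r12 p r22 0 0 0 0 c.
Proof.
apply: cochainP; elim/ord3_ind; elim/ord3_ind; elim/ord3_ind;
  by rewrite mkcE !cochain_scaleDE cochain0E !psiE /= ?(mulr1, mulr0, addr0, add0r).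
Qed.

Lemma psi_sum_01 (l11 l21 r11 p r22 c : A) :
  l21 *: psi 3 2 1 + (l11 *: psi 3 1 1 + (c *: psi 3 3 3 + (p *: psi 2 3 1 +
    (r22 *: psi 2 3 2 + (r11 *: psi 1 3 1 + 0))))) =
  oc l11 0 l21 0 r11 0 p r22 0 0 0 0 c.
Proof.
apply: cochainP; elim/ord3_ind; elim/ord3_ind; elim/ord3_ind;
  by rewrite mkcE !cochain_scaleDE cochain0E !psiE /= ?(mulr1, mulr0, addr0, add0r).
Qed.

Lemma psi_sum_11 (l11 l21 l21' r11 r12 p r22 c : A) :
  p *: psi 2 3 1 + (l21 *: psi 3 2 1 + (l11 *: psi 3 1 1 + (c *: psi 3 3 3 +
    (l21' *: psi 3 2 1 + (r22 *: psi 2 3 2 + (r11 *: psi 1 3 1 +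
    (r12 *: psi 1 3 2 + 0))))))) = oc l11 0 (l21 + l21') 0 r11 r12 p r22 0 0 0 0 c.
Proof.
apply: cochainP; elim/ord3_ind; elim/ord3_ind; elim/ord3_ind;
  by rewrite mkcE !cochain_scaleDE cochain0E !psiE /= ?(mulr1, mulr0, addr0, add0r).
Qed.

Lemma psi_sum_antisymmetric (l11 l21 r11 p r22 b11 b12 b21 b22 c : A) :
  p *: psi 2 3 1 + (l21 *: psi 3 2 1 + (l11 *: psi 3 1 1 + (c *: psi 3 3 3 +
    (r11 *: psi 1 3 1 + (r22 *: psi 2 3 2 + (b22 *: psi 2 2 3 +
    (b11 *: psi 1 1 3 + (b12 *: psi 1 2 3 + (b21 *: psi 2 1 3 + 0))))))))) =
  oc l11 0 l21 0 r11 0 p r22 b11 b12 b21 b22 c.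
Proof.
apply: cochainP; elim/ord3_ind; elim/ord3_ind; elim/ord3_ind;
  by rewrite mkcE !cochain_scaleDE cochain0E !psiE /= ?(mulr1, mulr0, addr0, add0r).
Qed.

End PsiSums.

(** * The families of (a), (b), (d) and (e) *)

Section Families.
Variable K : fieldType.
Hypothesis K2 : (2%:R : K) != 0.

Lemma ord2_ind (P : 'I_2 -> Prop) :
  P (@Ordinal 2 0 isT) -> P (@Ordinal 2 1 isT) -> forall i, P i.
Proof.
by move=> P1 P2 [[|[|//]] lti]; [move: P1|move: P2]; congr P; apply: val_inj.
Qed.

(** The coefficients of psi^{13}_2 and psi^{31}_2 contain the relation as a factor; over the base
    they vanish and the family is the normal form with b = 0. *)
Lemma generic_miniversal (p q : K) : p != 0 -> q != 0 -> p != q -> p != - q ->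
  miniversal_family 2 (generic_relations p q) (d15 p q) (generic_family p q).
Proof.
move=> p0 q0 pq pNq.
have q2 : 2%:R * (q + 0) != 0 by rewrite addr0 mulf_neq0.
have p2 : p ^+ 2 != 0 by rewrite expf_neq0.
have K4 : (4%:R : K) != 0 by rewrite (_ : 4%:R = 2%:R * 2%:R) ?mulf_neq0 // -natrM.
have q4 : 4%:R * p * (q + 0) ^+ 2 != 0 by rewrite addr0 !mulf_neq0 // expf_neq0.
have q5 : 4%:R * (q + 0) * p ^+ 2 != 0 by rewrite addr0 !mulf_neq0.
have pq0 : p + q != 0 by rewrite addr_eq0.
have reg_rels : all (@regular K) (generic_relations p q) by rewrite /= p2.
have sol_rels : solution (generic_relations p q) [::].
  by rewrite /= expr0n /= !mul0r eqxx.
split=> //; first by rewrite /= q2 q4 q5.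
pose i1 : 'I_2 := @Ordinal 2 0 isT; pose i2 : 'I_2 := @Ordinal 2 1 isT.
apply: (@miniversal_cyclic K p q K2 p0 q0 2 _ _ i1 i2 0) => //; first by right.
- move=> B e complB kille; have t1E := eval_var e i1; have t2E := eval_var e i2.
  have := kille _ (mem_head _ _).
  have := @eval_inv 2 K B e (p%:T ^+ 2) isT p2; rewrite !(evalE, t1E, t2E).
  set P := p%:A; set Q := q%:A; set T1 := e (ms_var K i1); set T2 := e (ms_var K i2).
  move=> vP kr; have {kr vP} rel : T1 ^+ 2 * (P + Q + T2) * (P - Q - T2) = 0.
    by apply: (lincomb (za (zl (P ^+ 2) kr)
      (zl (- (T1 ^+ 2 * (P + Q + T2) * (P - Q - T2))) vP))); ring.
  rewrite map_family /generic_family !big_cons big_nil /=.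
  rewrite psi_sum_generic.
  have v1 := @eval_inv 2 K B e (2%:R * (q%:T + 'X_1)) isT q2.
  have v2 := @eval_inv 2 K B e (4%:R * p%:T * (q%:T + 'X_1) ^+ 2) isT q4.
  have v3 := @eval_inv 2 K B e (4%:R * (q%:T + 'X_1) * p%:T ^+ 2) isT q5.
  rewrite !(evalE, t1E, t2E) in v1 v2 v3 *.
  move: v1 v2 v3; rewrite -/T1 -/T2 -/P -/Q rel rmorph0 !mul0r oppr0 => v1 _ _.
  set v := e (expand _ _) in v1 *.
  exists (T1 * (P - Q - T2) * v), (- (T1 * (P + Q + T2) * v)); split.
    split; rewrite ?mul0r ?oppr0 //.
    + by apply: (lincomb (zl (T1 * (P - Q - T2)) v1)); ring.
    + by apply: (lincomb (zl (- (T1 * (P + Q + T2))) v1)); ring.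
    + by apply: (lincomb (zl 1 rel)); ring.
  by rewrite /nf !mulr0 oppr0.
- move=> B e r1 r2 [_ _ rel _ _] r; rewrite mem_seq1 => /eqP ->.
  have t1E := eval_var e i1; have t2E := eval_var e i2.
  rewrite !(evalE, t1E, t2E).
  apply: (lincomb (zl (e (expand 2 (p%:T ^+ 2)^-1)) rel)); set P := p%:A; set Q := q%:A.
  by ring.
- move=> B x y z xI yI _ /(_ pq0) ->.
  exists (fun i => if i == i1 then x else y) => [i|e eE]; first by case: ifP.
  by rewrite !eE rmorph0.
- by move=> B e e' e1 e2 _; elim/ord2_ind.
Qed.

Lemma miniversal_11 :
  miniversal_family 2 relations11 (d15 (1 : K) 1) family11.
Proof.
have q2 : 2%:R * (0 + 1) != 0 :> K by rewrite add0r mulr1.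
have K4 : (4%:R : K) != 0 by rewrite (_ : 4%:R = 2%:R * 2%:R) ?mulf_neq0 // -natrM.
have q4 : 4%:R * (0 + 1) ^+ 2 != 0 :> K by rewrite add0r expr1n mulr1.
have w0 : 1 + 0 != 0 :> K by rewrite addr0 oner_neq0.
have u0 : 0 + 2%:R != 0 :> K by rewrite add0r.
have reg_rels : all (@regular K) relations11 by rewrite /= w0.
have sol_rels : solution (K := K) relations11 [::].
  by rewrite /= expr0n /= !mul0r eqxx.
split=> //; first by rewrite /= q2 q4.
pose i1 : 'I_2 := @Ordinal 2 0 isT; pose i2 : 'I_2 := @Ordinal 2 1 isT.
have n1 := oner_neq0 K; have pq0 : 1 + 1 != 0 :> K by [].
apply: (@miniversal_cyclic K 1 1 K2 n1 n1 2 _ _ i1 i2 0) => //; first by right.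
- move=> B e complB kille; have t1E := eval_var e i1; have t2E := eval_var e i2.
  have kr := kille _ (mem_head _ _).
  have vr := @eval_inv 2 K B e (1 + 'X_1) isT w0.
  have vu := @eval_inv 2 K B e ('X_1 + 2%:R) isT u0.
  rewrite map_family /family11 !big_cons big_nil /= psi_sum_11.
  have v1 := @eval_inv 2 K B e (2%:R * ('X_1 + 1)) isT q2.
  rewrite !(evalE, t1E, t2E, scale1r) in kr vr vu v1 *.
  set T1 := e (ms_var K i1) in kr v1 *; set T2 := e (ms_var K i2) in kr vr vu v1 *.
  have rel : T1 ^+ 2 * T2 * (T2 + 2%:R) = 0.
    by apply: (lincomb (za (zl (1 + T2) kr)
      (zl (- (T1 ^+ 2 * T2 * (T2 + 2%:R))) vr))); ring.
  (* The coefficient of psi^{13}_2 has the factor t_1^2 t_2 without t_2 + 2, but t_2 + 2 is a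
     unit. *)
  have rel' : T1 ^+ 2 * T2 = 0.
    by apply: (lincomb (za (zl (e (expand 2 ('X_1 + 2%:R)^-1)) rel)
      (zl (- (T1 ^+ 2 * T2)) vu))); ring.
  rewrite rel' rmorph0 !mul0r; set v := e (expand _ (2%:R * _)^-1) in v1 *.
  exists (- (T1 * T2 * v)), (- (T1 * (T2 + 2%:R) * v)); split.
    split; rewrite ?mul0r ?oppr0 ?scale1r //.
    + by apply: (lincomb (zl (- (T1 * T2)) v1)); ring.
    + by apply: (lincomb (zl (- (T1 * (T2 + 2%:R))) v1)); ring.
    + by apply: (lincomb (zl (-1) rel)); ring.
  by rewrite /nf !mulr0 oppr0.
- move=> B e r1 r2 [_ _ rel _ _] r; rewrite mem_seq1 => /eqP ->.
  have t1E := eval_var e i1; have t2E := eval_var e i2.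
  rewrite !(evalE, t1E, t2E) scale1r in rel *.
  by apply: (lincomb (zl (- e (expand 2 (1 + 'X_1)^-1)) rel)); ring.
- move=> B x y z xI yI _ /(_ pq0) ->.
  exists (fun i => if i == i1 then x else y) => [i|e eE]; first by case: ifP.
  by rewrite !eE rmorph0.
- by move=> B e e' e1 e2 _; elim/ord2_ind.
Qed.

(** Here y lies in the maximal ideal and cannot be divided by, so it stays as the parameter t_2. The
    scale is fixed by q' = 1, which also forces k = 1 in [nf_first_order]. *)
Lemma miniversal_01 :
  miniversal_family 3 relations01 (d15 (0 : K) 1) family01.
Proof.
have reg_rels : all (@regular K) relations01 by [].
have sol_rels : solution (K := K) relations01 [::].
  by rewrite /= !mul0r eqxx.
split=> //.
have famE (B : augAlg K) (e : {lrmorphism mseries 3 K -> B}) :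
    map_cochain e (family_in (expand 3) family01) =
    nf (e (ms_var K o1)) 1 (e (ms_var K o2))
      (e (ms_var K o3) + e (ms_var K o1) * e (ms_var K o2)) (e (ms_var K o3)) 0.
  have t1E := eval_var e o1; have t2E := eval_var e o2; have t3E := eval_var e o3.
  rewrite map_family /family01 !big_cons big_nil /= psi_sum_01.
  by rewrite !(evalE, t1E, t2E, t3E, scale1r) /nf !mulr0 oppr0.
have killP (B : augAlg K) (e : {lrmorphism mseries 3 K -> B}) :
    kills e relations01 <->
    e (ms_var K o3) * (e (ms_var K o1) + e (ms_var K o3)) = 0 /\
    e (ms_var K o2) * (e (ms_var K o1) + 2%:R * e (ms_var K o3)
      + e (ms_var K o1) * e (ms_var K o2)) = 0.
  have t1E := eval_var e o1; have t2E := eval_var e o2; have t3E := eval_var e o3.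
  split=> [kille|[k1 k2] r].
    have := kille _ (mem_head _ _); have := kille _ (mem_last _ _).
    by rewrite !(evalE, t1E, t2E, t3E, scale1r).
  by rewrite !inE => /orP[] /eqP ->; rewrite !(evalE, t1E, t2E, t3E).
have varI (B : augAlg K) (e : {lrmorphism mseries 3 K -> B}) i :
    aug_compatible e -> aug B (e (ms_var K i)) = 0.
  by move=> ->; rewrite /ms_const /= mcoeffX mnm1_eq0.
apply: miniversal_criterion => //.
- by rewrite d15_oc; apply: oc_odd.
- move=> B e _ auge /killP[k1 k2] /=; rewrite famE; split; last first.
    rewrite map_nf /= d15_oc /nf rmorph0 rmorph1 rmorphD rmorphM /= !varI //.
    by rewrite !mulr0 addr0 oppr0.
  apply: nf_codifferential; rewrite ?mul0r ?oppr0 //; last by ring.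
  + by apply: (lincomb (za (zl 1 k1) (zl (e (ms_var K o1)) k2))); ring.
  + by apply: (lincomb (zl 1 k1)); ring.
  + by apply: (lincomb (zl 1 k2)); ring.
- move=> B dB complB defB.
  have [t1 [t2 [t3 [[t1I t2I t3I] k1 k2 equiv]]]] := d15_normal_form_01 complB defB.
  exists (fun i => if i == o1 then t1 else if i == o2 then t2 else t3).
    by move=> i; rewrite /aug_ideal; case: ifP => _ //; case: ifP.
  by move=> e auge eE; rewrite famE killP !eE.
- move=> B e e' complB infB auge auge' /killP[k1 k2] /killP[k1' k2'].
  rewrite !famE => /(nf_first_order infB)[] //; try exact: varI; try exact: rmorph0.
    by rewrite /aug_ideal rmorphD rmorphM /= !varI // mulr0 addr0.
  move=> e1 _ [k kE [e2 e3]]; rewrite mulr1 in kE; rewrite -kE mul1r in e2.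
  by elim/ord3_ind => //; rewrite e3 //; apply: varI.
Qed.

(* The family of part (e): the normal form with p = 1, q' = t_2 - 1 and b = t_3.
   The base is not reduced along the line t_1 = t_3 = 0. *)
Definition antisymmetric_relations : seq (GRing.term K) := [::
  GRing.Var K 0 ^+ 2 * GRing.Var K 1;
  GRing.Var K 1 * GRing.Var K 2]%T.

Definition antisymmetric_family : rat_family K :=
  let t1 := GRing.Var K 0 in let t2 := GRing.Var K 1 in let t3 := GRing.Var K 2 in [::
  psi_term 1 2 3 1;
  psi_term (- (1) + t2) 3 2 1;
  psi_term t1 3 1 1;
  psi_term t1 3 3 3;
  psi_term (t1 * (2%:R - t2) / (2%:R * (- (1) + t2))) 1 3 1;
  psi_term (- (t1 * t2 / (2%:R * (- (1) + t2)))) 2 3 2;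
  psi_term t3 2 2 3;
  psi_term (t1 ^+ 2 * t3) 1 1 3;
  psi_term (- (t1 * t3)) 1 2 3;
  psi_term (- (t1 * t3)) 2 1 3].

(** With q' = t_2 - 1 the relations of the normal form read t_1^2 t_2 (2 - t_2) = 0 and t_2 t_3 = 0,
    and 2 - t_2 is a unit. *)
Lemma miniversal_antisymmetric :
  miniversal_family 3 antisymmetric_relations (d15 (1 : K) (-1)) antisymmetric_family.
Proof.
have q2 : 2%:R * (- 1 + 0) != 0 :> K by rewrite addr0 mulrN1 oppr_eq0.
have u0 : 2%:R - 0 != 0 :> K by rewrite subr0.
have reg_rels : all (@regular K) antisymmetric_relations by [].
have sol_rels : solution antisymmetric_relations [::].
  by rewrite /= expr0n /= !mul0r eqxx.
split=> //; first by rewrite /= q2.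
have n1 := oner_neq0 K; have n2 : -1 != 0 :> K by rewrite oppr_eq0.
apply: (@miniversal_cyclic K 1 (-1) K2 n1 n2 3 _ _ o1 o2 (ms_var K o3)) => //.
- by left.
- by rewrite /ms_const /= mcoeffX mnm1_eq0.
- move=> B e complB kille.
  have t1E := eval_var e o1; have t2E := eval_var e o2; have t3E := eval_var e o3.
  have k1 := kille _ (mem_head _ _); have k2 := kille _ (mem_last _ _).
  rewrite map_family /antisymmetric_family !big_cons big_nil /= psi_sum_antisymmetric.
  have v1 := @eval_inv 3 K B e (2%:R * (- (1) + 'X_1)) isT q2.
  rewrite /= !(evalE, t1E, t2E, t3E, scale1r, scaleN1r) in k1 k2 v1 *.
  set T1 := e (ms_var K o1) in k1 v1 *; set T2 := e (ms_var K o2) in k1 k2 v1 *.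
  set T3 := e (ms_var K o3) in k2 *.
  set v := e (expand _ (2%:R * _)^-1) in v1 *.
  exists (T1 * (2%:R - T2) * v), (- (T1 * T2 * v)); split; last by [].
  split; rewrite ?scale1r ?mulr1 //.
  + by apply: (lincomb (zl (T1 * (2%:R - T2)) v1)); ring.
  + by apply: (lincomb (zl (- (T1 * T2)) v1)); ring.
  + by apply: (lincomb (zl (2%:R - T2) k1)); ring.
  + by apply: (lincomb (zl 1 k2)); ring.
- move=> B e r1 r2 [_ _ rel1 rel2 _] r.
  have t1E := eval_var e o1; have t2E := eval_var e o2; have t3E := eval_var e o3.
  have u := @eval_inv 3 K B e (2%:R - 'X_1) isT u0.
  rewrite scale1r scaleN1r in rel1; rewrite scaleN1r in rel2.
  rewrite !(evalE, t1E, t2E, t3E) in u.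
  rewrite !inE => /orP[] /eqP ->; rewrite !(evalE, t1E, t2E, t3E).
    by apply: (lincomb (za (zl (e (expand 3 (2%:R - 'X_1)^-1)) rel1)
      (zl (- (e (ms_var K o1) ^+ 2 * e (ms_var K o2))) u))); ring.
  by apply: (lincomb (zl 1 rel2)); ring.
- move=> B x y z xI yI zI _.
  exists (fun i => if i == o1 then x else if i == o2 then y else z) => [i|e eE].
    by do 2?case: ifP.
  by rewrite !eE.
- by move=> B e e' e1 e2 e3; elim/ord3_ind.
Qed.

End Families.

(** * Equivalences and jump deformations *)

Section Equivalences.
Variable K : fieldType.
Implicit Types d : cochain K.

Lemma equivalent_sym d d' : equivalent d d' -> equivalent d' d.
Proof.
move=> [g [h [gh ->]]]; exists h, g; split; first exact: even_automorphism_inv.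
by rewrite transportK.
Qed.

Lemma equivalent_trans d1 d2 d3 :
  equivalent d1 d2 -> equivalent d2 d3 -> equivalent d1 d3.
Proof.
move=> [g [h [gh ->]]] [g' [h' [gh' ->]]].
exists (g' *m g), (h *m h'); split; first exact: even_automorphism_mul.
by rewrite transport_comp.
Qed.

Lemma equivalent_opposite d d' :
  equivalent d d' -> equivalent (opposite d) (opposite d').
Proof.
move=> [g [h [gh ->]]]; exists g, h; split=> //.
by rewrite opposite_transport //; case: gh.
Qed.

Lemma app_scale (A : comNzRingType) a (d : cochain A) x y :
  app (a *: d) x y = a *: app d x y.
Proof.
apply/rowP => k; rewrite mxE !appE mulr_sumr; apply: eq_bigr => i _.
by rewrite mulr_sumr; apply: eq_bigr => j _; rewrite ffunE mxE; ring.
Qed.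

Lemma codifferential_scale a d : codifferential d -> codifferential (a *: d).
Proof.
move=> [dodd dd]; split=> [s t x y xs yt k kst|s t u x y z xs yt zu].
  by rewrite app_scale mxE (dodd _ _ _ _ xs yt) ?mulr0.
have Zl v w : app d (a *: v) w = a *: app d v w.
  by have := app_suml d (fun i => if i == o1 then a else 0) (fun=> v) w;
    rewrite !sum3 /= !scale0r !addr0.
have comb (v w : 'rV[K]_3) (c : K) :
    a *: (a *: v) + c *: (a *: (a *: w)) = (a * a) *: (v + c *: w).
  by rewrite scalerDr !scalerA; congr (_ + _ *: _); ring.
have Zr v w : app d v (a *: w) = a *: app d v w by rewrite linearZ.
rewrite !app_scale Zr Zl comb (dd _ _ _ _ _ _ xs yt zu).
exact: scaler0.
Qed.

(** A cochain is quadratic in its source and linear in its target, so the homothety of ratio 1/a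
    multiplies it by 1/a. *)
Lemma equivalent_scale a d : a != 0 -> equivalent (a *: d) d.
Proof.
move=> a0; have sc (b c : K) : b * c = 1 -> b%:M *m c%:M = 1%:M :> 'M[K]_3.
  by rewrite mul_scalar_mx scale_scalar_mx => ->.
exists (a^-1)%:M, a%:M; split.
  split; [|by apply: sc; rewrite mulVf|by apply: sc; rewrite mulfV].
  by move=> s x xs k ks; rewrite mul_mx_scalar mxE xs ?mulr0.
have Zl b v w : app d (b *: v) w = b *: app d v w.
  by have := app_suml d (fun i => if i == o1 then b else 0) (fun=> v) w;
    rewrite !sum3 /= !scale0r !addr0.
have Zr b v w : app d v (b *: w) = b *: app d v w by rewrite linearZ.
have rowE c i : row i (c%:M : 'M[K]_3) = c *: delta_mx 0 i.
  by apply/rowP => j; rewrite !mxE eqxx /= mulr_natr eq_sym.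
apply/ffunP => -[i j]; rewrite ffunE /= !rowE app_scale Zl Zr app_delta mul_mx_scalar.
rewrite !scalerA (_ : _ * _ = 1) ?scale1r //.
by field.
Qed.

Lemma opposite_oc (l11 l12 l21 l22 r11 r12 r21 r22 b11 b12 b21 b22 c : K) :
  opposite (oc l11 l12 l21 l22 r11 r12 r21 r22 b11 b12 b21 b22 c) =
  oc (- r11) (- r12) (- r21) (- r22) (- l11) (- l12) (- l21) (- l22)
     (- b11) (- b21) (- b12) (- b22) c.
Proof.
apply: cochainP; elim/ord3_ind; elim/ord3_ind; elim/ord3_ind;
  by rewrite ffunE mxE !mkcE /= ?(expr1, mulN1r, oppr0, sqrrN, expr1n, mul1r).
Qed.
Lemma d1_oc : d1 = oc 0 0 0 (-1) 0 0 0 1 0 0 0 1 (-1) :> cochain K.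
Proof.
apply: cochainP; elim/ord3_ind; elim/ord3_ind; elim/ord3_ind;
  by rewrite mkcE /d1 !cochainE /= ?(addr0, add0r, subr0, sub0r, oppr0).
Qed.
Lemma d4_oc : d4 = oc 1 0 0 0 0 0 0 (-1) 0 0 0 0 1 :> cochain K.
Proof.
apply: cochainP; elim/ord3_ind; elim/ord3_ind; elim/ord3_ind;
  by rewrite mkcE /d4 !cochainE /= ?(addr0, add0r, subr0, sub0r, oppr0).
Qed.
Lemma d5_oc : d5 = oc 0 0 0 1 (-1) 0 0 (-1) 0 0 0 0 1 :> cochain K.
Proof.
apply: cochainP; elim/ord3_ind; elim/ord3_ind; elim/ord3_ind;
  by rewrite mkcE /d5 !cochainE /= ?(addr0, add0r, subr0, sub0r, oppr0).
Qed.
Lemma d6_oc : d6 = oc 1 0 0 1 0 0 0 (-1) 0 0 0 0 1 :> cochain K.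
Proof.
apply: cochainP; elim/ord3_ind; elim/ord3_ind; elim/ord3_ind;
  by rewrite mkcE /d6 !cochainE /= ?(addr0, add0r, subr0, sub0r, oppr0).
Qed.
Lemma d7_oc : d7 = oc 0 0 0 1 0 0 0 0 0 0 0 0 1 :> cochain K.
Proof.
apply: cochainP; elim/ord3_ind; elim/ord3_ind; elim/ord3_ind;
  by rewrite mkcE /d7 !cochainE /= ?(addr0, add0r, subr0, sub0r, oppr0).
Qed.
Lemma d8_oc : d8 = oc 0 0 0 0 0 0 0 (-1) 0 0 0 0 1 :> cochain K.
Proof.
apply: cochainP; elim/ord3_ind; elim/ord3_ind; elim/ord3_ind;
  by rewrite mkcE /d8 !cochainE /= ?(addr0, add0r, subr0, sub0r, oppr0).
Qed.
Lemma d11_oc : d11 = oc 0 0 0 1 0 0 0 (-1) 0 0 0 0 1 :> cochain K.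
Proof.
apply: cochainP; elim/ord3_ind; elim/ord3_ind; elim/ord3_ind;
  by rewrite mkcE /d11 !cochainE /= ?(addr0, add0r, subr0, sub0r, oppr0).
Qed.
Lemma d12_oc : d12 = oc 0 0 (-1) 0 0 0 1 0 0 0 0 1 0 :> cochain K.
Proof.
apply: cochainP; elim/ord3_ind; elim/ord3_ind; elim/ord3_ind;
  by rewrite mkcE /d12 !cochainE /= ?(addr0, add0r, subr0, sub0r, oppr0).
Qed.

Lemma opposite_d7 : opposite d7 = d8 :> cochain K.
Proof. by rewrite d7_oc d8_oc opposite_oc oppr0. Qed.

Lemma opposite_d5 : opposite d5 = d6 :> cochain K.
Proof. by rewrite d5_oc d6_oc opposite_oc oppr0 opprK. Qed.

Lemma plane_nf (t s : K) : plane_family t s = nf t (-1) 1 (- t) 0 s.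
Proof.
apply: cochainP; elim/ord3_ind; elim/ord3_ind; elim/ord3_ind;
  rewrite mkcE /plane_family !cochainE /= ?(mulr0, mulr1, addr0, add0r, oppr0) //; ring.
Qed.

Lemma oc_equivalent (g11 g12 g21 g22 g33 h11 h12 h21 h22 h33
    l11 l12 l21 l22 r11 r12 r21 r22 b11 b12 b21 b22 c
    l11' l12' l21' l22' r11' r12' r21' r22' b11' b12' b21' b22' c' : K) :
  [/\ g11 * h11 + g12 * h21 = 1, g11 * h12 + g12 * h22 = 0,
      g21 * h11 + g22 * h21 = 0, g21 * h12 + g22 * h22 = 1 & g33 * h33 = 1] ->
  [/\ l11' * g11 + l12' * g21 = g33 * (g11 * l11 + g12 * l21),
      l11' * g12 + l12' * g22 = g33 * (g11 * l12 + g12 * l22),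
      l21' * g11 + l22' * g21 = g33 * (g21 * l11 + g22 * l21)
    & l21' * g12 + l22' * g22 = g33 * (g21 * l12 + g22 * l22)] ->
  [/\ r11' * g11 + r12' * g21 = g33 * (g11 * r11 + g12 * r21),
      r11' * g12 + r12' * g22 = g33 * (g11 * r12 + g12 * r22),
      r21' * g11 + r22' * g21 = g33 * (g21 * r11 + g22 * r21)
    & r21' * g12 + r22' * g22 = g33 * (g21 * r12 + g22 * r22)] ->
  [/\ b11' * g33 = g11 * (g11 * b11 + g12 * b12) + g12 * (g11 * b21 + g12 * b22),
      b12' * g33 = g11 * (g21 * b11 + g22 * b12) + g12 * (g21 * b21 + g22 * b22),
      b21' * g33 = g21 * (g11 * b11 + g12 * b12) + g22 * (g11 * b21 + g12 * b22)
    & b22' * g33 = g21 * (g21 * b11 + g22 * b12) + g22 * (g21 * b21 + g22 * b22)] ->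
  c' * g33 = g33 * g33 * c ->
  equivalent (oc l11 l12 l21 l22 r11 r12 r21 r22 b11 b12 b21 b22 c)
    (oc l11' l12' l21' l22' r11' r12' r21' r22' b11' b12' b21' b22' c').
Proof.
move=> [e11 e12 e21 e22 e33] [L1 L2 L3 L4] [R1 R2 R3 R4] [B1 B2 B3 B4] C.
have gh := even_mx3_mul1 e11 e12 e21 e22 e33.
exists (even_mx3 g11 g12 g21 g22 g33), (even_mx3 h11 h12 h21 h22 h33).
split; first by split=> //; [exact: even_mx3_even | exact: mulmx1C].
apply: transport_mx3 => //.
elim/ord3_ind; elim/ord3_ind; elim/ord3_ind; rewrite !sum3 !mkcE ![even_mx3 _ _ _ _ _ _ _]mxE /=;
  rewrite ?(mulr0, mul0r, addr0, add0r) // ?(L1, L2, L3, L4, R1, R2, R3, R4, B1, B2, B3, B4, C) //;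
  ring.
Qed.

Lemma d15_scale (p q c : K) : c != 0 -> equivalent (d15 p q) (d15 (c * p) (c * q)).
Proof.
move=> c0; rewrite !d15_oc.
apply: (@oc_equivalent 1 0 0 1 c 1 0 0 1 c^-1); by first [split; field | field].
Qed.

(** For nonzero t the operators L and R are diagonalized together: the rows of the witness are the
    common eigenvectors v_1 - t v_2 and v_1, and the factor 1/t on v_3 makes c equal to 1. The
    witnesses for d_5, d_4 and d_11 arise in the same way. *)
Lemma nf_d7 (t : K) : t != 0 -> equivalent (nf t 1 0 0 0 0) d7.
Proof.
move=> t0; rewrite d7_oc.
apply: (@oc_equivalent 1 (- t) 1 0 t^-1 0 1 (- t^-1) t^-1 t);
  by first [split; field | field].
Qed.

Lemma nf_d5 (t : K) : t != 0 -> equivalent (nf t 1 0 (- t) (- t) 0) d5.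
Proof.
move=> t0; rewrite d5_oc.
apply: (@oc_equivalent 1 (- t) 1 0 t^-1 0 1 (- t^-1) t^-1 t);
  by first [split; field | field].
Qed.

Lemma nf_d4 (t : K) : t != 0 -> equivalent (nf t 1 1 0 (- t) 0) d4.
Proof.
move=> t0; rewrite d4_oc.
apply: (@oc_equivalent 1 0 1 (- t) t^-1 1 0 t^-1 (- t^-1) t);
  by first [split; field | field].
Qed.

Lemma nf_d11 (t : K) : t != 0 -> equivalent (nf t (-1) 1 (- t) 0 0) d11.
Proof.
move=> t0; rewrite d11_oc.
apply: (@oc_equivalent 1 t 1 0 t^-1 0 1 t^-1 (- t^-1) t);
  by first [split; field | field].
Qed.

Lemma nf_d12 (t : K) : t != 0 -> equivalent (nf 0 (-1) 1 0 0 t) d12.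
Proof.
move=> t0; rewrite d12_oc.
apply: (@oc_equivalent t 0 0 1 t t^-1 0 0 1 t^-1);
  by first [split; field | field].
Qed.

(* The factor b normalizes the form, B(b v_1, b v_1) = (b t)^2 s v_3 = - v_3 / t. *)
Lemma nf_d1 (t s b : K) : t != 0 -> s != 0 -> b ^+ 2 * (t ^+ 3 * s) = -1 ->
  equivalent (nf t (-1) 1 (- t) 0 s) d1.
Proof.
move=> t0 s0 b2; rewrite d1_oc.
have b0 : b != 0.
  by apply: contra_eq_neq b2 => ->; rewrite expr0n mul0r eq_sym oppr_eq0 oner_eq0.
apply: (@oc_equivalent 1 t b 0 (- t^-1) 0 b^-1 t^-1 (- (t * b)^-1) (- t));
  try by first [split; field; rewrite ?t0 ?b0 | field].
split; try by field.
have t1 : t^-1 * t = 1 by rewrite mulVf.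
apply: (lincomb (za (zl (- t^-1) b2) (zl (b ^+ 2 * t ^+ 2 * s) t1))).
by ring.
Qed.

End Equivalences.

(** * Affine families and neighbourhoods of the origin *)

Section Jumps.
Variable K : numFieldType.
Implicit Types (d : cochain K) (t : K).

Lemma family_at_sum (e : seq K) (F : rat_family K) :
  family_at e F = \sum_(x <- F) GRing.eval e x.1 *: psi x.2.1.1 x.2.1.2 x.2.2.
Proof. by []. Qed.

(** A jump deformation asks for rational expressions; an affine family is listed with one term for
    each of the 27 maps psi^{ij}_k. *)
Lemma affine_family (D0 D1 : cochain K) :
  exists2 F : rat_family K, regular_family F &
    forall t, D0 + t *: D1 = family_at [:: t] F.
Proof.
pose entry (x : 'I_3 * 'I_3 * 'I_3) : GRing.term K * (nat * nat * nat) :=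
  (GRing.Add (D0 x.1 0 x.2)%:T (GRing.Mul (GRing.Var K 0) (D1 x.1 0 x.2)%:T),
   (x.1.1.+1, x.1.2.+1, x.2.+1)).
exists [seq entry x | x <- enum {: 'I_3 * 'I_3 * 'I_3}].
  by rewrite /regular_family all_map; apply/allP.
move=> t; rewrite family_at_sum big_map big_enum /=; apply: cochainP => i j k.
rewrite cochainDE cochainZE sum_ffunE summxE (bigD1 (i, j, k)) //= big1 ?addr0.
  by rewrite cochainZE psiE !eqxx mulr1.
move=> [[a b] c] abc; rewrite cochainZE psiE /= !eqSS.
suff /negbTE -> : ~~ [&& (i : nat) == a, (j : nat) == b & (k : nat) == c].
  by rewrite mulr0.
by apply: contraNN abc => /and3P[/eqP/val_inj -> /eqP/val_inj -> /eqP/val_inj ->].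
Qed.

Lemma affine_jump (dt : K -> cochain K) (D0 D1 d d' : cochain K) :
  (forall t, dt t = D0 + t *: D1) -> dt 0 = d ->
  (forall t, codifferential (dt t)) -> (forall t, t != 0 -> equivalent (dt t) d') ->
  jump_deformation dt d d'.
Proof.
move=> dtE dt0 cd equiv; have [F rF FE] := affine_family D0 D1.
split=> //; last by exists 1 => // t _; apply: equiv.
  by exists F => //; exists 1 => // t _; rewrite dtE FE.
by exists 1.
Qed.

Lemma oc_affine (l11 l21 r11 p r22 b22 c m11 m21 s11 p' s22 e22 c' t : K) :
  oc (l11 + t * m11) 0 (l21 + t * m21) 0 (r11 + t * s11) 0 (p + t * p') (r22 + t * s22)
     0 0 0 (b22 + t * e22) (c + t * c') =
  oc l11 0 l21 0 r11 0 p r22 0 0 0 b22 c + t *: oc m11 0 m21 0 s11 0 p' s22 0 0 0 e22 c'.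
Proof.
apply: cochainP; elim/ord3_ind; elim/ord3_ind; elim/ord3_ind;
  by rewrite cochainDE cochainZE !mkcE /= ?(mulr0, addr0).
Qed.

Lemma addr_neq0 (a t : K) : `|t| < `|a| -> a + t != 0.
Proof. by apply: contraTneq => /eqP; rewrite addr_eq0 => /eqP ->; rewrite normrN ltxx. Qed.

(** The radius |a| |b| / (|a| + |b|) lies below both norms, so they need not be compared. *)
Lemma near_both (a b : K) : a != 0 -> b != 0 ->
  exists2 eps : K, 0 < eps & forall t, `|t| < eps -> `|t| < `|a| /\ `|t| < `|b|.
Proof.
move=> a0 b0; have na : 0 < `|a| by rewrite normr_gt0.
have nb : 0 < `|b| by rewrite normr_gt0.
have nab : 0 < `|a| + `|b| by apply: addr_gt0.
exists (`|a| * `|b| / (`|a| + `|b|)); first by rewrite divr_gt0 ?mulr_gt0.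
move=> t /lt_trans H; split; apply: H; rewrite ltr_pdivrMr // mulrDr.
  by rewrite ltrDr mulr_gt0.
by rewrite mulrC ltrDl mulr_gt0.
Qed.

End Jumps.

(** * Specializations of the families *)

Section FamilyValues.
Variable K : fieldType.
Implicit Types t : K.

Lemma family01_at t1 t2 t3 : family_at [:: t1; t2; t3] family01 =
  nf t1 1 t2 (t3 + t1 * t2) t3 0.
Proof.
by rewrite /family_at /family_in !big_cons big_nil /= psi_sum_01 /nf !mulr0 oppr0.
Qed.

Lemma generic_family_at (p q t2 : K) :
  family_at [:: 0; t2] (generic_family p q) = d15 p (q + t2).
Proof.
rewrite /family_at /family_in !big_cons big_nil /= psi_sum_generic d15_oc.
by rewrite expr0n /= !mul0r oppr0.
Qed.

Lemma family11_line t2 : family_at [:: 0; t2] family11 = d15 1 (1 + t2).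
Proof.
rewrite /family_at /family_in !big_cons big_nil /= psi_sum_11 d15_oc.
by rewrite expr0n /= !mul0r oppr0.
Qed.

Lemma family11_jump t : (2%:R : K) != 0 ->
  family_at [:: t; 0] family11 = nf t 1 1 0 (- t) 0.
Proof.
move=> K2; rewrite /family_at /family_in !big_cons big_nil /= psi_sum_11 /nf.
by rewrite !(mulr0, mul0r, oppr0, addr0, add0r, mulr1) mulfK.
Qed.

Lemma antisymmetric_family_plane t1 t3 : (2%:R : K) != 0 ->
  family_at [:: t1; 0; t3] (antisymmetric_family K) = plane_family t1 t3.
Proof.
move=> K2; rewrite plane_nf /family_at /family_in !big_cons big_nil /=.
rewrite psi_sum_antisymmetric /nf.
rewrite !(mulr0, mul0r, oppr0, addr0, add0r, mulr1, subr0).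
by rewrite mulrN1 invrN mulrN mulfK.
Qed.

Lemma antisymmetric_family_line t2 :
  family_at [:: 0; t2; 0] (antisymmetric_family K) = d15 1 (-1 + t2).
Proof.
rewrite /family_at /family_in !big_cons big_nil /= psi_sum_antisymmetric d15_oc.
by rewrite !(mulr0, mul0r, oppr0).
Qed.

Lemma family01_codifferential t1 t2 t3 : t3 * (t1 + t3) = 0 ->
  t2 * (t1 + 2%:R * t3 + t1 * t2) = 0 ->
  codifferential (family_at [:: t1; t2; t3] family01).
Proof.
move=> k1 k2; rewrite family01_at.
apply: nf_codifferential; rewrite ?mul0r ?oppr0 //; last by ring.
- by apply: (lincomb (za (zl 1 k1) (zl t1 k2))); ring.
- by apply: (lincomb (zl 1 k1)); ring.
- by apply: (lincomb (zl 1 k2)); ring.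
Qed.

Lemma family11_jump_codifferential t : codifferential (nf t 1 1 0 (- t) 0).
Proof. by apply: nf_codifferential; ring. Qed.

Lemma plane_codifferential t1 t3 : codifferential (plane_family t1 t3).
Proof. by rewrite plane_nf; apply: nf_codifferential; ring. Qed.

Lemma opposite_d15 (p q : K) : opposite (d15 p q) = d15 (- q) (- p).
Proof. by rewrite !d15_oc opposite_oc oppr0. Qed.

(** The pencil is spanned by the opposite of d_15(0:1), whose image is given, and by its own
    opposite. The image of the latter follows because transport commutes with passage to the
    opposite. *)
Lemma transport_d15 (g h : 'M[K]_3) t : even_mx g ->
  transport g h (opposite (d15 0 1)) = d15 1 0 ->
  transport g h (opposite (d15 t 1)) = d15 1 t.
Proof.
move=> ge dE.
have lin (p q : K) : d15 1 0 + (- p) *: opposite (d15 1 0) = d15 1 p.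
  rewrite opposite_d15 !d15_oc; apply: cochainP.
  by elim/ord3_ind; elim/ord3_ind; elim/ord3_ind;
    rewrite cochainDE cochainZE !mkcE /=; ring.
have -> : opposite (d15 t 1) =
    opposite (d15 0 1) + (- t) *: opposite (opposite (d15 0 1)).
  rewrite oppositeK opposite_d15 opposite_d15 !d15_oc; apply: cochainP.
  by elim/ord3_ind; elim/ord3_ind; elim/ord3_ind;
    rewrite cochainDE cochainZE !mkcE /=; ring.
by rewrite transportD transportZ -(opposite_transport h (opposite (d15 0 1)) ge) dE lin.
Qed.

End FamilyValues.

(** * Local solutions and jump deformations *)

Section JumpFamilies.
Variable K : numFieldType.
Implicit Types t : K.

Let K2 : (2%:R : K) != 0. Proof. by rewrite pnatr_eq0. Qed.

Lemma family01_line t2 : family_at [:: 0; t2; 0] family01 = d15 t2 1.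
Proof. by rewrite family01_at d15_oc /nf !(mulr0, mul0r, addr0, oppr0). Qed.

Lemma solution01P t1 t2 t3 : solution relations01 [:: t1; t2; t3] <->
    [\/ t1 = 0 /\ t3 = 0, t2 = 0 /\ t3 = 0, t2 = 0 /\ t3 = - t1 |
        (t3 = 0 /\ t2 = -1) \/ (t3 = - t1 /\ t2 = 1)].
Proof.
rewrite /solution /= andbT; split=> [/andP[]|].
  rewrite mulf_eq0 => /orP[/eqP ->|].
    rewrite mulr0 addr0 -{1}(mulr1 t1) -mulrDr !mulf_eq0.
    case/or3P=> [/eqP ->|/eqP ->|]; [by constructor 2|by constructor 1|].
    by rewrite addrC addr_eq0 => /eqP ->; constructor 4; left.
  rewrite addrC addr_eq0 => /eqP ->.
  have -> : t1 + 2%:R * - t1 + t1 * t2 = t1 * (t2 - 1) by ring.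
  rewrite !mulf_eq0 subr_eq0 => /or3P[/eqP ->|/eqP ->|/eqP ->].
  - by constructor 3.
  - by constructor 1; rewrite oppr0.
  - by constructor 4; right.
by case=> [[-> ->]|[-> ->]|[-> ->]|[[-> ->]|[-> ->]]];
  apply/andP; split; apply/eqP; ring.
Qed.

Lemma near_solution01 : near3 (fun t1 t2 t3 : K =>
  solution relations01 [:: t1; t2; t3] <->
  [\/ t1 = 0 /\ t3 = 0, t2 = 0 /\ t3 = 0 | t2 = 0 /\ t3 = - t1]).
Proof.
(* Both nonlocal solutions have |t_2| = 1, so the radius 1 excludes them. *)
exists 1 => // t1 t2 t3 _ h2 _; rewrite solution01P.
split=> [[h|h|h|[[_ e]|[_ e]]]|[h|h|h]].
- by constructor 1.
- by constructor 2.
- by constructor 3.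
- by move: h2; rewrite e normrN normr1 ltxx.
- by move: h2; rewrite e normr1 ltxx.
- by constructor 1.
- by constructor 2.
- by constructor 3.
Qed.

Lemma near_generic_solution (p q : K) : p != 0 -> p != q -> p != - q ->
  near2 (fun t1 t2 => solution (generic_relations p q) [:: t1; t2] <-> t1 = 0).
Proof.
move=> p0 pq pNq; have pq1 : p + q != 0 by rewrite addr_eq0.
have pq2 : p - q != 0 by rewrite subr_eq0.
have [eps eps0 epsP] := near_both pq1 pq2; exists eps => // t1 t2 _ /epsP[h1 h2].
have n1 : p + q + t2 != 0 by apply: addr_neq0.
have n2 : p - q - t2 != 0 by apply: addr_neq0; rewrite normrN.
rewrite /solution /= andbT; split=> [|->]; last by rewrite expr0n /= !mul0r.
rewrite !mulf_eq0 invr_eq0 (negbTE n1) (negbTE n2) !mulf_eq0 (negbTE p0) !orbF orbb.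
by move/eqP.
Qed.

Lemma near_solution11 : near2 (fun t1 t2 : K =>
  solution relations11 [:: t1; t2] <-> t1 = 0 \/ t2 = 0).
Proof.
exists 1 => // t1 t2 _ h2.
have n1 : 1 + t2 != 0 by apply: addr_neq0; rewrite normr1.
have n2 : t2 + 2%:R != 0.
  rewrite addrC; apply: addr_neq0; apply: lt_trans h2 _.
  by rewrite normr_nat ltr1n.
rewrite /solution /= andbT !mulf_eq0 invr_eq0 (negbTE n1) (negbTE n2) !orbF orbb.
by split=> [/orP[] /eqP|[] ->]; rewrite ?eqxx ?orbT //; [left|right].
Qed.

Lemma antisymmetric_solutionP t1 t2 t3 :
  solution (antisymmetric_relations K) [:: t1; t2; t3] <->
  t2 = 0 \/ (t1 = 0 /\ t3 = 0).
Proof.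
rewrite /solution /= andbT !mulf_eq0 orbb.
split=> [|[->|[-> ->]]]; rewrite ?eqxx ?orbT //.
case/andP=> /orP[/eqP t10|/eqP ->]; last by left.
by case/orP=> /eqP; [left | right].
Qed.

(** The map T serves both (b), where it is the identity, and (c), where it is the passage to the
    opposite followed by a change of basis. *)
Lemma family01_jumps (T : cochain K -> cochain K) (d d' d'' : cochain K) :
  (forall D0 D1 t, T (D0 + t *: D1) = T D0 + t *: T D1) ->
  (forall D, codifferential D -> codifferential (T D)) ->
  T (d15 0 1) = d ->
  (forall D, equivalent D d7 -> equivalent (T D) d') ->
  (forall D, equivalent D d5 -> equivalent (T D) d'') ->
  jump_deformation (fun t => T (family_at [:: t; 0; 0] family01)) d d' /\
  jump_deformation (fun t => T (family_at [:: t; 0; - t] family01)) d d''.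
Proof.
move=> Taff Tcd Td T7 T5; split.
  apply: (@affine_jump _ _ (T (oc 0 0 1 0 0 0 0 0 0 0 0 0 0))
    (T (oc 1 0 0 0 0 0 0 0 0 0 0 0 1))).
  - move=> t; rewrite -Taff; congr (T _); rewrite family01_at -oc_affine /nf.
    by rewrite !(mulr0, mulr1, addr0, add0r, oppr0).
  - by rewrite family01_line.
  - by move=> t; apply/Tcd/family01_codifferential; rewrite !mul0r.
  - move=> t t0; apply: T7; rewrite family01_at mulr0 addr0; exact: nf_d7.
apply: (@affine_jump _ _ (T (oc 0 0 1 0 0 0 0 0 0 0 0 0 0))
  (T (oc 1 0 0 0 (-1) 0 0 (-1) 0 0 0 0 1))).
- move=> t; rewrite -Taff; congr (T _); rewrite family01_at -oc_affine /nf.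
  by rewrite !(mulr0, mulr1, mulrN1, addr0, add0r, oppr0).
- by rewrite oppr0 family01_line.
- by move=> t; apply/Tcd/family01_codifferential; rewrite ?subrr ?mulr0 ?mul0r.
- move=> t t0; apply: T5; rewrite family01_at mulr0 addr0; exact: nf_d5.
Qed.

Lemma family01_jump :
  jump_deformation (fun t : K => family_at [:: t; 0; 0] family01) (d15 0 1) d7 /\
  jump_deformation (fun t : K => family_at [:: t; 0; - t] family01) (d15 0 1) d5.
Proof. exact: (family01_jumps (T := id)). Qed.

Lemma opposite_family01_jump (g h : 'M[K]_3) : even_automorphism g h ->
  transport g h (opposite (d15 0 1)) = d15 1 0 ->
  jump_deformation (fun t : K =>
    transport g h (opposite (family_at [:: t; 0; 0] family01))) (d15 1 0) d8 /\
  jump_deformation (fun t : K =>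
    transport g h (opposite (family_at [:: t; 0; - t] family01))) (d15 1 0) d6.
Proof.
move=> gh dE; have equivT D D' : equivalent D D' ->
    equivalent (transport g h (opposite D)) (opposite D').
  move=> DD'; apply: equivalent_trans (equivalent_opposite DD').
  by apply: equivalent_sym; exists g, h.
apply: (family01_jumps (T := fun D => transport g h (opposite D))) => //.
- by move=> D0 D1 t; rewrite oppositeD oppositeZ transportD transportZ.
- by move=> D cD; apply: transport_codifferential => //; apply: opposite_codifferential.
- by move=> D /equivT; rewrite opposite_d7.
- by move=> D /equivT; rewrite opposite_d5.
Qed.

Lemma family11_jump_deformation :
  jump_deformation (fun t : K => family_at [:: t; 0] family11) (d15 1 1) d4.
Proof.
apply: (@affine_jump _ _ (oc 0 0 1 0 0 0 1 0 0 0 0 0 0)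
  (oc 1 0 0 0 0 0 0 (-1) 0 0 0 0 1)).
- move=> t; rewrite family11_jump // -oc_affine /nf.
  by rewrite !(mulr0, mulr1, mulrN1, addr0, add0r, oppr0).
- by rewrite family11_line addr0.
- by move=> t; rewrite family11_jump //; apply: family11_jump_codifferential.
- by move=> t t0; rewrite family11_jump //; apply: nf_d4.
Qed.

Lemma plane_jump_d11 :
  jump_deformation (fun t : K => plane_family t 0) (d15 1 (-1)) d11.
Proof.
apply: (@affine_jump _ _ (oc 0 0 (-1) 0 0 0 1 0 0 0 0 0 0)
  (oc 1 0 0 0 (-1) 0 0 0 0 0 0 0 1)).
- move=> t; rewrite plane_nf -oc_affine /nf.
  by rewrite !(mulr0, mulr1, mulrN1, addr0, add0r, oppr0).
- by rewrite plane_nf d15_oc /nf !(mulr0, oppr0).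
- by move=> t; apply: plane_codifferential.
- by move=> t t0; rewrite plane_nf; apply: nf_d11.
Qed.

Lemma plane_jump_d12 :
  jump_deformation (fun t : K => plane_family 0 t) (d15 1 (-1)) d12.
Proof.
apply: (@affine_jump _ _ (oc 0 0 (-1) 0 0 0 1 0 0 0 0 0 0)
  (oc 0 0 0 0 0 0 0 0 0 0 0 1 0)).
- move=> t; rewrite plane_nf -oc_affine /nf.
  by rewrite !(expr0n, mul0r, mulr0, mulr1, addr0, add0r, oppr0).
- by rewrite plane_nf d15_oc /nf !(mulr0, oppr0).
- by move=> t; apply: plane_codifferential.
- by move=> t t0; rewrite plane_nf oppr0; apply: nf_d12.
Qed.

(** The line t d through the origin works: by [equivalent_scale], t d is equivalent to d for every
    nonzero t. *)
Lemma zero_jump (d : cochain K) : codifferential d ->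
  exists dt : K -> cochain K, jump_deformation dt 0 d.
Proof.
move=> cd; exists (fun t => t *: d); apply: (@affine_jump _ _ 0 d).
- by move=> t; rewrite add0r.
- exact: scale0r.
- by move=> t; apply: codifferential_scale.
- by move=> t; apply: equivalent_scale.
Qed.

End JumpFamilies.

(** The normalizing factor of [nf_d1] is a square root of - 1 / (t_1^3 t_3), which exists in an
    algebraically closed field. *)
Lemma plane_d1 (K : numClosedFieldType) (t1 t3 : K) : t1 != 0 -> t3 != 0 ->
  equivalent (plane_family t1 t3) d1.
Proof.
move=> t10 t30; rewrite plane_nf.
apply: (@nf_d1 _ _ _ (sqrtC (- (t1 ^+ 3 * t3)^-1))) => //.
by rewrite sqrtCK mulNr mulVf // mulf_neq0 // expf_neq0.
Qed.

Theorem mainTheorem8 (R : realType) :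
  (* d_15(p:q) depends, up to equivalence, only on (p:q) *)
  (forall p q c : R[i], c != 0 -> equivalent (d15 p q) (d15 (c * p) (c * q))) /\
  (* (a) *)
  (forall p q : R[i], p != 0 -> q != 0 -> p != q -> p != - q ->
    [/\ miniversal_family 2 (generic_relations p q) (d15 p q)
          (generic_family p q),
        near2 (fun t1 t2 =>
          solution (generic_relations p q) [:: t1; t2] <-> t1 = 0)
      & forall t2 : R[i], q + t2 != 0 ->
          family_at [:: 0; t2] (generic_family p q) = d15 p (q + t2)]) /\
  (* (b) *)
  ([/\ miniversal_family 3 relations01 (d15 (0 : R[i]) 1) family01,
       forall t1 t2 t3 : R[i], solution relations01 [:: t1; t2; t3] <->
         [\/ t1 = 0 /\ t3 = 0, t2 = 0 /\ t3 = 0, t2 = 0 /\ t3 = - t1 |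
             (t3 = 0 /\ t2 = -1) \/ (t3 = - t1 /\ t2 = 1)]
     & near3 (fun t1 t2 t3 : R[i] => solution relations01 [:: t1; t2; t3] <->
         [\/ t1 = 0 /\ t3 = 0, t2 = 0 /\ t3 = 0 | t2 = 0 /\ t3 = - t1])] /\
   [/\ forall t2 : R[i], family_at [:: 0; t2; 0] family01 = d15 t2 1,
       jump_deformation (fun t : R[i] => family_at [:: t; 0; 0] family01)
         (d15 0 1) d7
     & jump_deformation (fun t : R[i] => family_at [:: t; 0; - t] family01)
         (d15 0 1) d5]) /\
  (* (c): d_15(1:0) is identified with the opposite of d_15(0:1) through g *)
  ([/\ equivalent (opposite (d15 (0 : R[i]) 1)) (d15 1 0),
       opposite d7 = d8 :> cochain R[i],
       opposite d5 = d6 :> cochain R[i]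
     & forall g h : 'M[R[i]]_3, even_automorphism g h ->
         transport g h (opposite (d15 0 1)) = d15 1 0 ->
         [/\ miniversal (d15 1 0)
               (transport (map_mx (in_alg (presented_base 3 relations01)) g)
                          (map_mx (in_alg (presented_base 3 relations01)) h)
                  (opposite (family_over 3 relations01 family01))),
             forall t2 : R[i],
               transport g h (opposite (family_at [:: 0; t2; 0] family01))
               = d15 1 t2,
             jump_deformation (fun t : R[i] =>
                 transport g h (opposite (family_at [:: t; 0; 0] family01)))
               (d15 1 0) d8
           & jump_deformation (fun t : R[i] =>
                 transport g h (opposite (family_at [:: t; 0; - t] family01)))
               (d15 1 0) d6]]) /\
  (* (d) *)
  ([/\ miniversal_family 2 relations11 (d15 (1 : R[i]) 1) family11,
       near2 (fun t1 t2 : R[i] =>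
         solution relations11 [:: t1; t2] <-> t1 = 0 \/ t2 = 0),
       forall t2 : R[i], 1 + t2 != 0 ->
         family_at [:: 0; t2] family11 = d15 1 (1 + t2)
     & jump_deformation (fun t : R[i] => family_at [:: t; 0] family11)
         (d15 1 1) d4]) /\
  (* (e) *)
  ((exists (relations : seq (GRing.term R[i])) (F : rat_family R[i]),
     [/\ miniversal_family 3 relations (d15 1 (-1)) F,
         near3 (fun t1 t2 t3 => solution relations [:: t1; t2; t3] <->
           t2 = 0 \/ (t1 = 0 /\ t3 = 0)),
         near2 (fun t1 t3 => family_at [:: t1; 0; t3] F = plane_family t1 t3)
       & near1 (fun t2 => family_at [:: 0; t2; 0] F = d15 1 (-1 + t2))]) /\
   [/\ forall t1 t3 : R[i], t1 != 0 -> t3 != 0 ->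
         equivalent (plane_family t1 t3) d1,
       jump_deformation (fun t : R[i] => plane_family t 0) (d15 1 (-1)) d11
     & jump_deformation (fun t : R[i] => plane_family 0 t) (d15 1 (-1)) d12]) /\
  (* (f) *)
  (d15 (0 : R[i]) 0 = 0 /\
   forall d : cochain R[i], codifferential d ->
     exists dt : R[i] -> cochain R[i], jump_deformation dt (d15 0 0) d).
Proof.
have K2 : (2%:R : R[i]) != 0 by rewrite pnatr_eq0.
split; first exact: d15_scale.
split.
  move=> p q p0 q0 pq pNq; split; first exact: generic_miniversal.
    exact: near_generic_solution.
  by move=> t2 _; exact: generic_family_at.
split.
  have [jump7 jump5] := family01_jump R[i].
  split; split.
  - exact: miniversal_01.
  - exact: solution01P.
  - exact: near_solution01.
  - exact: family01_line.
  - exact: jump7.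
  - exact: jump5.
split.
  split; [|exact: opposite_d7|exact: opposite_d5|].
    (* The opposite of d_15(0:1) is d_15(-1:0), which the projective scaling by -1 identifies with
       d_15(1:0). *)
    rewrite opposite_d15 oppr0; have := @d15_scale R[i] (-1) 0 (-1).
    by rewrite mulrNN mulr1 mulr0; apply; rewrite oppr_eq0 oner_neq0.
  move=> g h gh dE; have [jump8 jump6] := opposite_family01_jump gh dE.
  have d01_odd : odd_cochain (d15 (0 : R[i]) 1) by rewrite d15_oc; exact: oc_odd.
  split; [|move=> t2|exact: jump8|exact: jump6].
    have [_ _ _ mini] := miniversal_01 R[i].
    by have := miniversal_opposite_transport d01_odd gh mini; rewrite dE.
  by rewrite family01_line; apply: transport_d15 => //; case: gh.
split.
  split; [exact: miniversal_11|exact: near_solution11|move=> t2 _|].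
    exact: family11_line.
  exact: family11_jump_deformation.
split.
  split; last by split; [exact: plane_d1|exact: plane_jump_d11|exact: plane_jump_d12].
  exists (antisymmetric_relations R[i]), (antisymmetric_family R[i]); split.
  - exact: miniversal_antisymmetric.
  - by exists 1 => // t1 t2 t3 _ _ _; exact: antisymmetric_solutionP.
  - by exists 1 => // t1 t3 _ _; exact: antisymmetric_family_plane.
  - by exists 1 => // t2 _; exact: antisymmetric_family_line.
have d00 : d15 (0 : R[i]) 0 = 0 by rewrite /d15 !scale0r addr0.
by rewrite d00; split; [|exact: zero_jump].
Qed.
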